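(* Let $l\ge1$. The vertex superalgebra $\mathcal{WB}(0,l)$ is the sum of the vertex algebra $V_{l+1/2}$ and the irreducible $V_{l+1/2}$-module $L(\hat{\mathcal D}^+;e(\det),l+\frac12)$: it contains $V_{l+1/2}$ as a vertex subalgebra and, as a $V_{l+1/2}$-module, $\mathcal{WB}(0,l)\cong V_{l+1/2}\oplus L(\hat{\mathcal D}^+;e(\det),l+\frac12)$. Here $e(\det)$ consists of the single exponent $1$ with multiplicity $2l+1$.
   Context: **$\hat{\mathcal D}^+$ and modules.** $\hat{\mathcal D}=\mathcal D\oplus\mathbb CC$, $\mathcal D$ spanned by $t^kf(D)$ ($k\in\mathbb Z$, $f\in\mathbb C[w]$, $D=t\partial_t$), $C$ central, $[t^rf(D),t^sg(D)]=t^{r+s}(f(D+s)g(D)-f(D)g(D+r))+\Psi\,C$, $\Psi$ antisymmetric, $\Psi=\sum_{-r\le j\le-1}f(j)g(j+r)$ if $r=-s\ge0$, $\Psi=0$ if $r+s\ne0$; $\deg t^kf(D)=k$. $\hat{\mathcal D}^+$ is the subalgebra spanned by $C$ and $t^kg(D+(k+1)/2)$, $g$ an odd polynomial. For a finite set $e$ of nonzero exponents $e_i$ with multiplicities $n_i$, $L(\hat{\mathcal D}^+;e,c)$ is the irreducible highest weight module (highest weight vector killed by positive degree) with highest weight $\xi$, $\xi(C)=c$, $-\sum_{n\text{ odd}}\xi((D+\frac12)^n)\frac{x^n}{n!}=\frac{\sum_in_i(\cosh(e_ix)-1)}{2\sinh(x/2)}$. **Vertex algebra $V_c$.** Let $W^n_k=-\frac12(t^{k+n}\partial_t^n+(-1)^{n+1}\partial_t^nt^{k+n})$,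 $n$ odd, $k\in\mathbb Z$, $W^n(z)=\sum_kW^n_kz^{-k-n-1}$. $V_c=L(\hat{\mathcal D}^+;\varnothing,c)$ is the irreducible quotient of the vacuum module induced from the one-dimensional module over $\mathrm{span}\{W^n_k:n+k\ge0,\ n\text{ odd}\}\oplus\mathbb CC$ on which the $W^n_k$ act by $0$ and $C$ by $c$. It is a vertex algebra with vacuum $|0\rangle$, translation operator $W^1_{-1}$, generated by the fields $Y(W^n_{-n-1}|0\rangle,z)=W^n(z)$. A $V_c$-module structure on a $\hat{\mathcal D}^+$-module of central charge $c$ is the one in which $W^n_{-n-1}|0\rangle$ acts by $W^n(z)$. **$\mathcal{WB}(0,l)$.** Let $\psi^{\pm,p}(z)=\sum_{n\in\frac12+\mathbb Z}\psi^{\pm,p}_nz^{-n-1/2}$ ($1\le p\le l$), $\phi(z)=\sum_{n\in\frac12+\mathbb Z}\phi_nz^{-n-1/2}$ be fermionic fields with $[\psi^{+,p}_m,\psi^{-,q}_n]_+=\delta_{pq}\delta_{m+n,0}$, $[\phi_m,\phi_n]_+=\delta_{m,-n}$, other anticommutators zero, and let $\mathcal F^{\otimes l+1/2}$ be their Fock space (vacuum killed by all positive modes), a vertex superalgebra. $SO(2l+1)$ acts on it by vertex superalgebra automorphisms fixing the vacuum and acting linearly on the span of the $2l+1$ fields $\psi^{\pm,p}(z),\phi(z)$, preserving the symmetric form with $(\psi^{+,p},\psi^{-,q})=\delta_{pq}$, $(\phi,\phi)=1$, others $0$. $\mathcal{WB}(0,l)$ is the vertex superalgebra of $SO(2l+1)$-invariants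 in $\mathcal F^{\otimes l+1/2}$. *)

(* Defs.v *)
From HB Require Import structures.
From mathcomp Require Import all_boot all_order all_algebra.
From mathcomp Require Import finmap.
From mathcomp.multinomials Require Import monalg.
From mathcomp Require Import reals complex.

Set Implicit Arguments.
Unset Strict Implicit.
Unset Printing Implicit Defensive.

Import Order.TTheory GRing.Theory Num.Theory.
Local Open Scope ring_scope.

(* The associative algebra of differential operators on C[t, t^-1]: a finitely
   supported map from int to polynomials, with x@_k = f when the degree k
   component of x is t^k f(D), D = t d/dt. *)
Definition dop (K : fieldType) : Type := {malg {poly K}[int]}.

HB.instance Definition _ (K : fieldType) := GRing.Zmodule.on (dop K).

Section DopLmodule.
Variable K : fieldType.
Implicit Types (a b : K) (x y : dop K).

Let P_scale a x : dop K := (a%:P *: (x : {malg {poly K}[int]}) :> {malg _[_]}).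

Let P_scaleA a b x : P_scale a (P_scale b x) = P_scale (a * b) x.
Proof. by rewrite /P_scale scalerA polyCM. Qed.
Let P_scale0 x : P_scale 0 x = 0.
Proof. by rewrite /P_scale polyC0; exact: scale0r. Qed.
Let P_scale1 : left_id 1 P_scale.
Proof. by move=> x; rewrite /P_scale polyC1; exact: scale1r. Qed.
Let P_scaleDr : right_distributive P_scale +%R.
Proof. by move=> a x y; exact: scalerDr. Qed.
Let P_scaleDl x : {morph P_scale^~ x : a b / a + b}.
Proof. by move=> a b; rewrite /P_scale polyCD; exact: scalerDl. Qed.

HB.instance Definition _ := GRing.Zmodule_isLmodule.Build K (dop K)
  P_scaleA P_scale1 P_scaleDr P_scaleDl.
End DopLmodule.

Section Dhat.
Variable K : fieldType.
Implicit Types (f g : {poly K}) (k r s : int) (x y : dop K).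

(* t^k f(D) *)
Definition tmon k f : dop K := << f *g k >>.

(* t^r f(D) . t^s g(D) = t^(r+s) f(D+s) g(D) *)
Definition dmul x y : dop K :=
  \sum_(r <- msupp x) \sum_(s <- msupp y)
    tmon (r + s) ((x@_r \Po ('X + (s%:~R)%:P)) * y@_s).

Definition dcomm x y : dop K := dmul x y - dmul y x.

Definition dexp x (n : nat) : dop K := iter n (dmul x) (tmon 0 1).

Definition dt : dop K := tmon (-1) 'X.

(* \sum_(-r <= j <= -1) f(j) g(j+r), for r : nat *)
Definition psi_sum (r : nat) f g : K :=
  \sum_(1 <= j < r.+1) f.[- j%:R] * g.[r%:R - j%:R].

Definition Psi_hom r s f g : K :=
  if r + s == 0 then
    (if 0 <= r then psi_sum `|r|%N f g else - psi_sum `|s|%N g f)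
  else 0.

Definition Psi x y : K :=
  \sum_(r <- msupp x) \sum_(s <- msupp y) Psi_hom r s x@_r y@_s.

(* The pair (x, a) stands for x + a C. *)
Definition Dhat : lmodType K := (dop K * K^o)%type.

Definition Cc : Dhat := (0, 1).

Definition Dbracket (X Y : Dhat) : Dhat := (dcomm X.1 Y.1, Psi X.1 Y.1).

Lemma tmonE k f i : (tmon k f)@_i = if i == k then f else 0.
Proof. by rewrite mcoeffU eq_sym; case: eqP. Qed.

Lemma tmon0 k : tmon k 0 = 0.
Proof. by apply/malgP => i; rewrite tmonE mcoeff0 if_same. Qed.

Lemma dmul_tmon r s f g :
  dmul (tmon r f) (tmon s g) = tmon (r + s) ((f \Po ('X + (s%:~R)%:P)) * g).
Proof.
rewrite /dmul /tmon !msuppU; case: (eqVneq f 0) => [->|f0].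
  by rewrite big_nil comp_poly0 mul0r; exact/esym/tmon0.
rewrite big_seq_fset1; case: (eqVneq g 0) => [->|g0].
  by rewrite big_nil mulr0; exact/esym/tmon0.
by rewrite big_seq_fset1 !mcoeffUU.
Qed.

Lemma Psi_tmon r s f g : Psi (tmon r f) (tmon s g) = Psi_hom r s f g.
Proof.
have P0l h : Psi_hom r s 0 h = 0.
  rewrite /Psi_hom /psi_sum !big1 ?oppr0 ?if_same // => j _;
  by rewrite horner0 ?mul0r ?mulr0.
have P0r h : Psi_hom r s h 0 = 0.
  rewrite /Psi_hom /psi_sum !big1 ?oppr0 ?if_same // => j _;
  by rewrite horner0 ?mul0r ?mulr0.
rewrite /Psi /tmon !msuppU; case: (eqVneq f 0) => [->|f0].
  by rewrite big_nil P0l.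
rewrite big_seq_fset1; case: (eqVneq g 0) => [->|g0].
  by rewrite big_nil P0r.
by rewrite big_seq_fset1 !mcoeffUU.
Qed.

Lemma Dbracket_tmon r s f g (a b : K) :
  Dbracket (tmon r f, a) (tmon s g, b)
  = (tmon (r + s) ((f \Po ('X + (s%:~R)%:P)) * g
                   - f * (g \Po ('X + (r%:~R)%:P))),
     Psi_hom r s f g).
Proof.
rewrite /Dbracket /dcomm /= !dmul_tmon Psi_tmon (addrC s r); congr (_, _).
apply/malgP => i; rewrite mcoeffB !tmonE; case: eqP => _; last by rewrite subr0.
by rewrite (mulrC f).
Qed.

Definition odd_polynomial g : Prop := forall n, ~~ odd n -> g`_n = 0.

(* The span of C and the t^k g(D+(k+1)/2), g odd.  As odd polynomials form a
   subspace, membership may be tested degree by degree. *)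
Definition Dplus (X : Dhat) : Prop :=
  forall k, exists2 g, odd_polynomial g
    & X.1@_k = g \Po ('X + ((k + 1)%:~R / 2%:R)%:P).

Definition W (n : nat) k : Dhat :=
  (- 2%:R^-1 *: (dmul (tmon (k + n%:Z) 1) (dexp dt n)
                 + (-1) ^+ n.+1 *: dmul (dexp dt n) (tmon (k + n%:Z) 1)), 0).

(* Modules are given by maps defined on all of Dhat, of which only the values
   on Dplus matter. *)
Record Dplus_rep (M : lmodType K) (rho : Dhat -> M -> M) : Prop := {
  rep_linear : forall X, Dplus X -> linear (rho X);
  rep_linearl : forall (a : K) X Y v, Dplus X -> Dplus Y ->
    rho (a *: X + Y) v = a *: rho X v + rho Y v;
  rep_bracket : forall X Y v, Dplus X -> Dplus Y ->
    rho (Dbracket X Y) v = rho X (rho Y v) - rho Y (rho X v)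
}.

Definition subspace (M : lmodType K) (P : M -> Prop) : Prop :=
  P 0 /\ forall (a : K) u v, P u -> P v -> P (a *: u + v).

Definition irreducible_family (I : Type) (M : lmodType K) (S : I -> M -> M) :=
  (exists v : M, v != 0) /\
  forall P : M -> Prop, subspace P -> (forall i v, P v -> P (S i v)) ->
    (forall v, P v -> v = 0) \/ (forall v, P v).

Definition Dplus_irreducible (M : lmodType K) (rho : Dhat -> M -> M) : Prop :=
  irreducible_family (fun X : {X | Dplus X} => rho (sval X)).

Record highest_weight_vector (M : lmodType K) (rho : Dhat -> M -> M)
    (xi : Dhat -> K) (v : M) : Prop := {
  hwv_neq0 : v != 0;
  hwv_pos : forall X, Dplus X -> X.2 = 0 ->
    (forall k, X.1@_k != 0 -> 0 < k) -> rho X v = 0;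
  hwv_weight : forall X, Dplus X ->
    (forall k, X.1@_k != 0 -> k = 0) -> rho X v = xi X *: v
}.

(* Formal power series in x are given by their coefficient sequences. *)
Definition fps_mul (a b : nat -> K) (n : nat) : K :=
  \sum_(i < n.+1) a i * b (n - i)%N.

Definition fps_cosh (a : K) (n : nat) : K :=
  if odd n then 0 else a ^+ n / n`!%:R.

Definition fps_sinh (a : K) (n : nat) : K :=
  if odd n then a ^+ n / n`!%:R else 0.

(* xi(C) = c and
     - \sum_(n odd) xi((D+1/2)^n) x^n/n!
         = (\sum_i n_i (cosh (e_i x) - 1)) / (2 sinh (x/2)),
   the quotient being the series whose product with the denominator is the
   numerator; e lists the pairs (e_i, n_i). *)
Definition weight_of (e : seq (K * K)) (c : K) (xi : Dhat -> K) : Prop :=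
  xi Cc = c /\
  fps_mul
    (fun n => if odd n then
        - xi (tmon 0 (('X + (2%:R^-1)%:P) ^+ n), 0) / n`!%:R
      else 0)
    (fun n => 2%:R * fps_sinh 2%:R^-1 n)
  =1 fun n => \sum_(p <- e) p.2 * (fps_cosh p.1 n - (n == 0)%:R).

(* (M, rho) is L(Dplus; e, c), with highest weight vector v. *)
Record is_L (e : seq (K * K)) (c : K) (M : lmodType K)
    (rho : Dhat -> M -> M) (v : M) : Prop := {
  L_rep : Dplus_rep rho;
  L_irreducible : Dplus_irreducible rho;
  L_weight : exists2 xi, weight_of e c xi & highest_weight_vector rho xi v
}.

End Dhat.

Arguments Cc {K}.
Arguments W {K} n k.

Section VertexAlgebras.
Variable K : fieldType.

Definition ibinom (m : int) (j : nat) : K :=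
  (\prod_(i < j) (m - i%:Z)%:~R) / j`!%:R.

(* Y a n b is the n-th product a_(n) b, so that Y(a,z) = \sum_n a_(n) z^(-n-1).
   The sums over j >= 0 are finite, whence the large upper bound N. *)
Definition borcherds_identity (V M : lmodType K) (Y : V -> int -> V -> V)
    (YM : V -> int -> M -> M) (sgn : K) (a b : V) (c : M) : Prop :=
  forall m n k : int, exists N0 : nat, forall N : nat, (N0 <= N)%N ->
    \sum_(j < N) ibinom m j *: YM (Y a (n + j%:Z) b) (m + k - j%:Z) c
    = \sum_(j < N) ((-1) ^+ j * ibinom n j) *:
        (YM a (m + n - j%:Z) (YM b (k + j%:Z) c)
         - ((-1) ^ n * sgn) *: YM b (n + k - j%:Z) (YM a (m + j%:Z) c)).

Definition is_field_map (V M : lmodType K) (Y : V -> int -> M -> M) : Prop :=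
  [/\ forall a n, linear (Y a n),
      forall n v, linear (fun a => Y a n v)
    & forall a v, exists N : int, forall n, N <= n -> Y a n v = 0].

Record vertexSuperalgebra := VertexSuperalgebra {
  vsa_car :> lmodType K;
  parity : bool -> vsa_car -> Prop;    (* false: even, true: odd *)
  vac : vsa_car;
  transl : vsa_car -> vsa_car;
  Y : vsa_car -> int -> vsa_car -> vsa_car;
  parity_subspace : forall p, subspace (parity p);
  parity_sum : forall v, exists v0 v1,
    [/\ parity false v0, parity true v1 & v = v0 + v1];
  parity_direct : forall v, parity false v -> parity true v -> v = 0;
  Y_field : is_field_map Y;
  Y_parity : forall p q a n b,
    parity p a -> parity q b -> parity (p (+) q) (Y a n b);
  vac_even : parity false vac;
  Y_vac : forall n b, Y vac n b = if n == -1 then b else 0;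
  Y_create : forall a n, 0 <= n -> Y a n vac = 0;
  Y_create1 : forall a, Y a (-1) vac = a;
  transl_linear : linear transl;
  transl_parity : forall p a, parity p a -> parity p (transl a);
  transl_vac : transl vac = 0;
  transl_cov : forall a n b,
    transl (Y a n b) - Y a n (transl b) = - (n%:~R *: Y a (n - 1) b);
  Y_borcherds : forall p q a b c, parity p a -> parity q b ->
    borcherds_identity Y Y ((-1) ^+ (p && q)) a b c
}.

Record vertexAlgebra := VertexAlgebra {
  va_vsa :> vertexSuperalgebra;
  va_even : forall a : va_vsa, parity false a
}.

Record vertex_subalgebra (F : vertexSuperalgebra) (P : F -> Prop) : Prop := {
  vsub_subspace : subspace P;
  vsub_vac : P (vac F);
  vsub_transl : forall a, P a -> P (transl a);
  vsub_Y : forall a n b, P a -> P b -> P (Y a n b);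
  vsub_parity : forall v0 v1, parity false v0 -> parity true v1 ->
    P (v0 + v1) -> P v0 /\ P v1
}.

Record vsa_morphism (U F : vertexSuperalgebra) (f : U -> F) : Prop := {
  vmor_linear : linear f;
  vmor_parity : forall p a, parity p a -> parity p (f a);
  vmor_vac : f (vac U) = vac F;
  vmor_transl : forall a, f (transl a) = transl (f a);
  vmor_Y : forall a n b, f (Y a n b) = Y (f a) n (f b)
}.

Definition vsa_automorphism (F : vertexSuperalgebra) (f : F -> F) : Prop :=
  vsa_morphism f /\ bijective f.

Record va_module (V : vertexAlgebra) (M : lmodType K)
    (YM : V -> int -> M -> M) : Prop := {
  vmod_field : is_field_map YM;
  vmod_vac : forall n v, YM (vac V) n v = if n == -1 then v else 0;
  vmod_borcherds : forall a b v, borcherds_identity (@Y V) YM 1 a b v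
}.

Definition va_irreducible (V : vertexAlgebra) (M : lmodType K)
    (YM : V -> int -> M -> M) : Prop :=
  irreducible_family (fun an : V * int => YM an.1 an.2).

Definition dsum_Y (V : Type) (M N : lmodType K) (YM : V -> int -> M -> M)
    (YN : V -> int -> N -> N) (a : V) (n : int) (x : M * N) : M * N :=
  (YM a n x.1, YN a n x.2).

(* The V-module structure YM on a Dplus-module (M, rho) for which
   W^n_(-n-1)|0> acts by \sum_k W^n_k z^(-k-n-1); the Dplus-module structure on
   V itself is rhoV. *)
Definition W_compatible (V : vertexAlgebra) (rhoV : Dhat K -> V -> V)
    (M : lmodType K) (rho : Dhat K -> M -> M) (YM : V -> int -> M -> M) : Prop :=
  forall (n : nat) (k : int) (v : M), odd n ->
    YM (rhoV (W n (- n%:Z - 1)) (vac V)) (k + n%:Z) v = rho (W n k) v.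

(* (V, rhoV) is the vertex algebra V_c. *)
Record is_Vc (c : K) (V : vertexAlgebra) (rhoV : Dhat K -> V -> V) : Prop := {
  Vc_L : is_L [::] c rhoV (vac V);
  Vc_vacuum : forall (n : nat) (k : int), odd n -> 0 <= n%:Z + k ->
    rhoV (W n k) (vac V) = 0;
  Vc_transl : forall a, transl a = rhoV (W 1 (-1)) a;
  Vc_fields : W_compatible rhoV rhoV (@Y V)
}.

Section Fermions.
Variables (l : nat) (F : vertexSuperalgebra).
Variables (psi : bool -> 'I_l -> F) (phi : F).

(* psi^{+,1}, ..., psi^{+,l}, psi^{-,1}, ..., psi^{-,l}, phi *)
Definition fermion (i : 'I_(l + l + 1)) : F :=
  match split i with
  | inl j => match split j with
             | inl p => psi true p
             | inr p => psi false p
             end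
  | inr _ => phi
  end.

Definition fermion_form : 'M[K]_(l + l + 1) :=
  block_mx (block_mx 0 1%:M 1%:M 0) 0 0 1%:M.

(* The mode psi_n, n in 1/2 + Z, is the product by psi_(n - 1/2), so psi_m and
   psi_n with m + n = 0 correspond to products whose indices add up to -1.
   The Fock space is the module over the Clifford algebra of the modes generated
   by a nonzero vector killed by all positive modes. *)
Record fermionic_fock : Prop := {
  fermion_odd : forall i, parity true (fermion i);
  fermion_anticomm : forall i j (m n : int) (v : F),
    Y (fermion i) m (Y (fermion j) n v) + Y (fermion j) n (Y (fermion i) m v)
    = (if m + n == -1 then fermion_form i j else 0) *: v;
  fock_vac_neq0 : vac F != 0;
  fock_vac_killed : forall i n, 0 <= n -> Y (fermion i) n (vac F) = 0;
  fock_cyclic : forall P : F -> Prop, subspace P -> P (vac F) ->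
    (forall i n v, P v -> P (Y (fermion i) n v)) -> forall v, P v
}.

Definition SO (A : 'M[K]_(l + l + 1)) : Prop :=
  A^T *m fermion_form *m A = fermion_form /\ \det A = 1.

Record SO_action (act : 'M[K]_(l + l + 1) -> F -> F) : Prop := {
  act_aut : forall A, SO A -> vsa_automorphism (act A);
  act1 : forall v, act 1%:M v = v;
  actM : forall A B v, SO A -> SO B -> act (A *m B) v = act A (act B v);
  act_fermion : forall A i, SO A ->
    act A (fermion i) = \sum_j A j i *: fermion j
}.

End Fermions.

Definition WB (l : nat) (F : vertexSuperalgebra)
    (act : 'M[K]_(l + l + 1) -> F -> F) (v : F) : Prop :=
  forall A, SO A -> act A v = v.

Definition e_det (l : nat) : seq (K * K) := [:: (1, (2 * l + 1)%:R)].

Lemma WB_vertex_subalgebra (l : nat) (F : vertexSuperalgebra)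
    (psi : bool -> 'I_l -> F) (phi : F) (act : 'M[K]_(l + l + 1) -> F -> F) :
  SO_action psi phi act -> vertex_subalgebra (WB act).
Proof.
move=> actP; have mor A := fun hA => (act_aut actP (A := A) hA).1.
have actD A (hA : SO A) u v : act A (u + v) = act A u + act A v.
  by have := vmor_linear (mor A hA) 1 u v; rewrite !scale1r.
have act0 A (hA : SO A) : act A 0 = 0.
  by apply: (@addrI _ (act A 0)); rewrite -actD // !addr0.
split.
- split=> [A hA|a u v Pu Pv A hA]; first exact: act0.
  by rewrite (vmor_linear (mor A hA)) Pu // Pv.
- by move=> A hA; rewrite (vmor_vac (mor A hA)).
- by move=> a Pa A hA; rewrite (vmor_transl (mor A hA)) Pa.
- by move=> a n b Pa Pb A hA; rewrite (vmor_Y (mor A hA)) Pa // Pb.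
move=> v0 v1 v0e v1o Pv.
have subP p u v : @parity F p u -> parity p v -> parity p (u - v).
  move=> pu pv; rewrite addrC -scaleN1r.
  by have [_ H] := @parity_subspace F p; apply: H.
suff dec A (hA : SO A) : act A v0 = v0 by split=> A hA;
  [exact: dec | have := Pv A hA; rewrite actD // dec // => /addrI].
have E : act A v0 - v0 = v1 - act A v1.
  have := Pv A hA; rewrite actD // => E.
  by apply/eqP; rewrite subr_eq addrAC eq_sym subr_eq E addrC.
apply/eqP; rewrite -subr_eq0; apply/eqP/parity_direct.
  by apply: subP => //; apply: (vmor_parity (mor A hA)).
by rewrite E; apply: subP => //; apply: (vmor_parity (mor A hA)).
Qed.

End VertexAlgebras.

Arguments e_det {K} l.

(* Main.v *)
(* Write n = 2l+1, let e_i(m) be the modes of the n fermions, Q(p,q) the invariant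
   quadratic operators \sum_i e_i(p) e^i(q), and J_ij the generators of so(n).
   Dplus acts on the Fock space through normally ordered sums of the Q(p,q), with
   C acting by n/2.  An operator commuting with all modes is a scalar, which
   yields the commutation relations, the identification of the fields of V_c
   with the operators W^n_k, and T = W^1_(-1).

   No invariant theory is needed.  If v is killed by so(n), contracting the J_ij v
   with e_i(-1) e_j(0) gives a Casimir identity
     (N_0 (n - N_0) + \sum_(b > 0) N_b) v
       = \sum (lowering operator) (raising operator) v,
   where N_b counts the fermions of energy b + 1/2.  The operator on the left is
   diagonal with eigenvalues in nat, and its kernel is spanned by the vacuum and
   the vector det = e_1(-1) ... e_n(-1)|0>.  By induction on the energy, the
   so(n)-invariants are generated by these two vectors under the Q(p,q), hence
   (interpolation by odd polynomials) under Dplus; and a nonzero Dplus-submodule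
   of invariants contains a nonzero combination of them, so that the even and odd
   parts, generated by the vacuum and by det, are irreducible.  SO(n)-invariants
   are so(n)-invariants, by differentiating unipotent one-parameter subgroups,
   and det is SO(n)-invariant.  Irreducible highest weight modules with equal
   highest weights being isomorphic, these two parts are V_c and L(e(det)). *)

Require Import Defs.
From HB Require Import structures.
From mathcomp Require Import all_boot all_order all_algebra.
From mathcomp Require Import fingroup perm finmap.
From mathcomp.multinomials Require Import monalg.
From mathcomp Require Import boolp reals complex.
From mathcomp Require Import ring zify.

Set Implicit Arguments.
Unset Strict Implicit.
Unset Printing Implicit Defensive.

Import Order.TTheory GRing.Theory Num.Theory.
Local Open Scope ring_scope.

(** * Deciding equalities of linear combinations *)

(** [V] and [L] are arbitrary models, known only through irreducibility and highest weight, so each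
    must be mapped into the Fock space. The map is obtained from its graph: the submodule of the
    product generated by the pair of highest weight vectors. It is single valued because each
    nonzero submodule of the part of [F] generated by the vacuum, or by det, contains that vector
    again; this is what the Casimir identity supplies. Parity separates the two summands: 2l+1 is
    odd, so det is odd while the vacuum is even.

    Unipotent one-parameter groups, on which everything is polynomial in t, reach only the root
    vectors of so(2l+1). The Cartan generators are recovered as commutators of two root vectors that
    involve the self-dual direction [phi].

    The compatibility of [iota] with all fields is checked on the generators W^n only: the vectors
    whose fields [iota] intertwines are closed under all products, by the Borcherds identity in [V]
    and in [F], hence form a submodule of the irreducible [V]. The module structure on [L] is then
    pulled back from the fields of [F], which preserve the odd invariants. *)

Section LinearCombinations.
Variables (K : fieldType) (M : lmodType K).

Inductive lexp :=
  | LAtom of nat | LZero | LAdd of lexp & lexp | LOpp of lexp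
  | LScale of K & lexp.

Fixpoint leval (env : seq M) (t : lexp) : M :=
  match t with
  | LAtom i => nth 0 env i
  | LZero => 0
  | LAdd a b => leval env a + leval env b
  | LOpp a => - leval env a
  | LScale c a => c *: leval env a
  end.

(** Indices are compared with [eqn] and not [==], so that the [cbn] of [lincomb] evaluates the test
    on numerals and leaves expressions fit for [ring]. *)
Fixpoint lcoef (t : lexp) (i : nat) : K :=
  match t with
  | LAtom j => if eqn j i then 1 else 0
  | LZero => 0
  | LAdd a b => lcoef a i + lcoef b i
  | LOpp a => - lcoef a i
  | LScale c a => c * lcoef a i
  end.

Fixpoint lcoefs_eq (N : nat) (s t : lexp) : Prop :=
  if N is N'.+1 then lcoef s N' = lcoef t N' /\ lcoefs_eq N' s t else True.

Lemma levalE env t : leval env t = \sum_(i < size env) lcoef t i *: env`_i.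
Proof.
elim: t => [j||a IHa b IHb|a IH|c a IH] /=.
- have [jenv|jenv] := ltnP j (size env).
    rewrite (bigD1 (Ordinal jenv)) //= -[eqn _ _]/(j == j) eqxx scale1r.
    rewrite big1 ?addr0 // => i ij; rewrite -[eqn _ _]/(j == i).
    by rewrite eq_sym [_ == _](negPf ij) scale0r.
  rewrite nth_default // big1 // => i _; rewrite -[eqn _ _]/(j == i).
  by rewrite gtn_eqF ?scale0r // (leq_trans (ltn_ord i)).
- by rewrite big1 // => i _; rewrite scale0r.
- by rewrite IHa IHb -big_split; apply: eq_bigr => i _; rewrite scalerDl.
- by rewrite IH -sumrN; apply: eq_bigr => i _; rewrite scaleNr.
- by rewrite IH scaler_sumr; apply: eq_bigr => i _; rewrite scalerA.
Qed.

Lemma leval_eq env s t : lcoefs_eq (size env) s t -> leval env s = leval env t.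
Proof.
rewrite !levalE; elim: (size env) => [|N IH] /=; first by rewrite !big_ord0.
by move=> [E /IH E']; rewrite !big_ord_recr /= E E'.
Qed.

End LinearCombinations.

Ltac lc_atoms env t :=
  lazymatch t with
  | (?a + ?b)%R => let env' := lc_atoms env a in lc_atoms env' b
  | (- ?a)%R => lc_atoms env a
  | (_ *: ?a)%R => lc_atoms env a
  | 0%R => env
  | _ => lc_insert env env t
  end
with lc_insert env0 env t :=
  lazymatch env with
  | nil => constr:(t :: env0)
  | t :: _ => env0
  | _ :: ?env' => lc_insert env0 env' t
  end.

Ltac lc_index env t :=
  lazymatch env with
  | t :: _ => constr:(O)
  | _ :: ?env' => let i := lc_index env' t in constr:(S i)
  end.

Ltac lc_reify K env t :=
  lazymatch t with
  | (?a + ?b)%R => let a' := lc_reify K env a in let b' := lc_reify K env b in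
      constr:(@LAdd K a' b')
  | (- ?a)%R => let a' := lc_reify K env a in constr:(@LOpp K a')
  | (?c *: ?a)%R => let a' := lc_reify K env a in constr:(@LScale K c a')
  | 0%R => constr:(@LZero K)
  | _ => let i := lc_index env t in constr:(@LAtom K i)
  end.

(* Proves an equality of linear combinations in a module over [K], leaving the
   equalities of coefficients that [ring] does not solve. *)
Ltac lincomb K :=
  match goal with |- @eq ?T ?a ?b =>
    let env := lc_atoms (@nil T) a in
    let env := lc_atoms env b in
    let s := lc_reify K env a in
    let t := lc_reify K env b in
    apply: (@leval_eq _ _ env s t); cbn [size lcoefs_eq lcoef eqn nat_of_bool];
    do ?split => //; try ring
  end.

(** * Subspaces, eigenvectors and locally finite sums *)

Section Subspaces.
Variables (K : fieldType) (M : lmodType K) (P : M -> Prop).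
Hypothesis subP : subspace P.

Lemma subspace0 : P 0. Proof. by case: subP. Qed.

Lemma subspaceD u v : P u -> P v -> P (u + v).
Proof. by move=> Pu Pv; rewrite -[u]scale1r; case: subP => _; apply. Qed.

Lemma subspaceZ a u : P u -> P (a *: u).
Proof. by move=> Pu; rewrite -[_ *: _]addr0; case: subP => P0; apply. Qed.

Lemma subspaceN u : P u -> P (- u).
Proof. by rewrite -scaleN1r; apply: subspaceZ. Qed.

Lemma subspaceB u v : P u -> P v -> P (u - v).
Proof. by move=> Pu /subspaceN; apply: subspaceD. Qed.

Lemma subspace_sum I r (Q : pred I) (f : I -> M) :
  (forall i, Q i -> P (f i)) -> P (\sum_(i <- r | Q i) f i).
Proof. by move=> H; apply: big_ind => //; [exact: subspace0|exact: subspaceD]. Qed.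

End Subspaces.

Section LinearMaps.
Variables (K : fieldType) (M N : lmodType K) (f : M -> N).
Hypothesis fL : linear f.

Lemma linD u v : f (u + v) = f u + f v.
Proof. by have := fL 1 u v; rewrite !scale1r. Qed.

Lemma lin0 : f 0 = 0.
Proof. by apply: (@addrI _ (f 0)); rewrite -linD !addr0. Qed.

Lemma linZ a u : f (a *: u) = a *: f u.
Proof. by have := fL a u 0; rewrite lin0 !addr0. Qed.

Lemma linN u : f (- u) = - f u.
Proof. by rewrite -scaleN1r linZ scaleN1r. Qed.

Lemma linB u v : f (u - v) = f u - f v.
Proof. by rewrite linD linN. Qed.

Lemma lin_sum I r (Q : pred I) (g : I -> M) :
  f (\sum_(i <- r | Q i) g i) = \sum_(i <- r | Q i) f (g i).
Proof. by apply: (big_morph f linD lin0). Qed.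

Lemma subspace_preim P : subspace P -> subspace (fun v => P (f v)).
Proof.
move=> sP; split; first by rewrite lin0; case: sP.
by move=> a u v Pu Pv; rewrite fL; case: sP => _; apply.
Qed.

End LinearMaps.

Section SubspaceConstructions.
Variables (K : fieldType) (M N : lmodType K).

Lemma subspace_zero : subspace (fun v : M => v = 0).
Proof. by split=> // a u v -> ->; rewrite scaler0 addr0. Qed.

Lemma subspaceI (P Q : M -> Prop) :
  subspace P -> subspace Q -> subspace (fun v => P v /\ Q v).
Proof.
move=> [P0 PD] [Q0 QD]; split=> // a u v [Pu Qu] [Pv Qv].
by split; [apply: PD|apply: QD].
Qed.

Lemma subspace_forall (I : Type) (P : I -> M -> Prop) :
  (forall i, subspace (P i)) -> subspace (fun v => forall i, P i v).
Proof.
move=> sP; split=> [i|a u v Pu Pv i]; first by case: (sP i).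
by case: (sP i) => _; apply.
Qed.

Lemma subspace_eq (f g : M -> N) : linear f -> linear g ->
  subspace (fun v => f v = g v).
Proof.
move=> fL gL; split; first by rewrite (lin0 fL) (lin0 gL).
by move=> a u v Eu Ev; rewrite fL gL Eu Ev.
Qed.

Lemma linear_comp (L : lmodType K) (f : N -> L) (g : M -> N) :
  linear f -> linear g -> linear (fun v => f (g v)).
Proof. by move=> fL gL a u v; rewrite gL fL. Qed.

Lemma linear_add (f g : M -> N) : linear f -> linear g ->
  linear (fun v => f v + g v).
Proof. by move=> fL gL a u v; rewrite fL gL scalerDr addrACA. Qed.

Lemma linear_scale (c : K) (f : M -> N) : linear f ->
  linear (fun v => c *: f v).
Proof. by move=> fL a u v; rewrite fL scalerDr !scalerA mulrC. Qed.

Lemma linear_opp (f : M -> N) : linear f -> linear (fun v => - f v).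
Proof. by move=> fL a u v; rewrite fL opprD scalerN. Qed.

Lemma linear_sub (f g : M -> N) : linear f -> linear g ->
  linear (fun v => f v - g v).
Proof. by move=> fL gL; apply: linear_add => //; apply: linear_opp. Qed.

Lemma linear_big (I : Type) (r : seq I) (f : I -> M -> N) :
  (forall i, linear (f i)) -> linear (fun v => \sum_(i <- r) f i v).
Proof.
move=> fL a u v; rewrite scaler_sumr -big_split /=.
by apply: eq_bigr => i _; rewrite fL.
Qed.

Lemma linear_id : linear (fun v : M => v).
Proof. by []. Qed.

Lemma linear_zero : linear (fun _ : M => 0 : N).
Proof. by move=> a u v; rewrite scaler0 addr0. Qed.

End SubspaceConstructions.

Section EigenComponents.
Variables (K : numFieldType) (M : lmodType K).

(** The operator f - D kills the last eigenvector and multiplies the others by d - D, nonzero in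
    characteristic zero, so induction on D isolates them. *)
Lemma eigen_component (f : M -> M) (P : M -> Prop) :
  linear f -> subspace P -> (forall v, P v -> P (f v)) ->
  forall (D : nat) (w : nat -> M),
  (forall d, (d < D)%N -> f (w d) = d%:R *: w d) ->
  P (\sum_(d < D) w d) -> forall d, (d < D)%N -> P (w d).
Proof.
move=> fL sP Pf; elim=> [//|D IH] w fw Pw.
have H d : (d < D)%N -> P (w d).
  move=> dD; have nz : d%:R - D%:R != 0 :> K.
    by rewrite subr_eq0 eqr_nat neq_ltn dD.
  rewrite -[w d]scale1r -(mulVf nz) -scalerA; apply: (subspaceZ sP).
  apply: (IH (fun d => (d%:R - D%:R) *: w d)) => // [k kD|].
    by rewrite (linZ fL) fw ?ltnS 1?ltnW // !scalerA mulrC.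
  have := subspaceB sP (Pf _ Pw) (subspaceZ sP D%:R Pw).
  rewrite (lin_sum fL) scaler_sumr -sumrB big_ord_recr /= fw // subrr addr0.
  congr P; apply: eq_bigr => i _.
  by rewrite fw ?scalerBl // ltnS ltnW.
move=> d; rewrite ltnS leq_eqVlt => /orP[/eqP->|/H//].
have := Pw; rewrite big_ord_recr /= => Pw'.
rewrite -[w D](addKr (\sum_(i < D) w i)) addrC; apply: (subspaceB sP) => //.
by apply: (subspace_sum sP) => i _; apply: H.
Qed.

(** Evaluating at 2t and subtracting 2^D times the value at t removes the top term and multiplies
    the k-th one by 2^k - 2^D, which is nonzero. *)
Lemma poly_family_eq0 D (c : nat -> M) :
  (forall t : K, \sum_(k < D) t ^+ k *: c k = 0) ->
  forall k, (k < D)%N -> c k = 0.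
Proof.
elim: D c => [//|D IH] c Hc.
have H k : (k < D)%N -> c k = 0.
  move=> kD; have nz : 2 ^+ k - 2 ^+ D != 0 :> K.
    by rewrite subr_eq0 -!natrX eqr_nat neq_ltn ltn_exp2l ?kD.
  suff /eqP: (2 ^+ k - 2 ^+ D) *: c k = 0.
    by rewrite scaler_eq0 (negPf nz) => /eqP.
  apply: (IH (fun k => (2 ^+ k - 2 ^+ D) *: c k)) => // t.
  have := congr2 (fun x y => x - 2 ^+ D *: y) (Hc (2 * t)) (Hc t).
  rewrite scaler0 subr0 scaler_sumr -sumrB big_ord_recr /=.
  rewrite exprMn !scalerA subrr addr0 => E; rewrite -[RHS]E.
  apply: eq_bigr => i _; rewrite exprMn !scalerA -scalerBl.
  by congr (_ *: _); rewrite mulrBr mulrC (mulrC (t ^+ i) (2 ^+ D)).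
move=> k; rewrite ltnS leq_eqVlt => /orP[/eqP->|/H//].
have := Hc 1; rewrite big_ord_recr /= expr1n scale1r big1 ?add0r //.
by move=> i _; rewrite H // scaler0.
Qed.

End EigenComponents.

Section LocallyFiniteSums.
Variables (K : fieldType) (M N : lmodType K).
Implicit Types (T : nat -> M -> N) (v : M).

Definition vanishes_from T v B := forall b, (B <= b)%N -> T b v = 0.

Definition locally_finite T := forall v, exists B, vanishes_from T v B.

(** The bound is chosen classically, with value 0 when there is none; by [lsumE] every bound gives
    the same value. *)
Definition lsum T v : N :=
  if pselect (exists B, vanishes_from T v B) is left H
  then \sum_(b < sval (cid H)) T b v else 0.

Lemma lsumE T v B : vanishes_from T v B -> lsum T v = \sum_(b < B) T b v.
Proof.
move=> vB; rewrite /lsum; case: pselect => [H|[]]; last by exists B.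
case: cid => B' /= vB'.
have E C D : vanishes_from T v C -> (C <= D)%N ->
    \sum_(b < D) T b v = \sum_(b < C) T b v.
  move=> vC CD; rewrite -!(big_mkord xpredT (T ^~ v)).
  rewrite (big_cat_nat (n := C)) //= -[RHS]addr0; congr (_ + _).
  by rewrite big_nat_cond big1 // => b /andP[/andP[Cb _] _]; apply: vC.
by rewrite -(E _ (maxn B B') vB' (leq_maxr _ _)) (E B) // leq_maxl.
Qed.

Lemma lsum_linear T : (forall b, linear (T b)) -> locally_finite T ->
  linear (lsum T).
Proof.
move=> TL Tf a u v; have [B uB] := Tf u; have [C vC] := Tf v.
rewrite (@lsumE _ u (maxn B C)) => [|b]; last by rewrite geq_max => /andP[/uB].
rewrite (@lsumE _ v (maxn B C)) => [|b]; last first.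
  by rewrite geq_max => /andP[_ /vC].
rewrite (@lsumE _ _ (maxn B C)) => [|b]; last first.
  by rewrite geq_max => /andP[/uB Eu /vC Ev]; rewrite TL Eu Ev scaler0 addr0.
by rewrite scaler_sumr -big_split; apply: eq_bigr => b _; rewrite TL.
Qed.

End LocallyFiniteSums.

(** * Differential operators *)

Section DifferentialOperators.
Variable K : numFieldType.
Implicit Types (f g : {poly K}) (k r s : int) (x y : dop K) (X Y : Dhat K).

Lemma horner_ext f g : (forall z : K, f.[z] = g.[z]) -> f = g.
Proof.
move=> fg; apply/eqP; rewrite -subr_eq0; apply/eqP.
apply: (@roots_geq_poly_eq0 _ _ [seq i%:R | i <- iota 0 (size (f - g))]).
- by apply/allP => z _; rewrite rootE !hornerE fg subrr.
- by rewrite map_inj_uniq ?iota_uniq // => i j /eqP; rewrite eqr_nat => /eqP.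
- by rewrite size_map size_iota.
Qed.

Lemma odd_polynomialP g :
  odd_polynomial g <-> forall z, g.[- z] = - g.[z].
Proof.
split=> [og z|og n n_even].
  rewrite !horner_coef -sumrN; apply: eq_bigr => i _.
  case: (boolP (odd i)) => [oi|/og->]; last by rewrite !mul0r oppr0.
  by rewrite exprNn -signr_odd oi mulN1r mulrN.
have /(congr1 (fun p : {poly K} => p`_n)) : g \Po (- 'X) = - g.
  by apply: horner_ext => z; rewrite horner_comp !hornerE og.
rewrite comp_polyE coefN.
under eq_bigr => i _ do rewrite exprNn -polyC1 -polyCN -rmorphXn mul_polyC scalerA.
rewrite -(poly_def _ (fun i => g`_i * (-1) ^+ i)) coef_poly.
rewrite -signr_odd (negPf n_even) expr0 mulr1.
case: ltnP => [_|/(nth_default 0)->//] /eqP; rewrite -addr_eq0 -mulr2n.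
by rewrite mulrn_eq0 => /eqP.
Qed.

(** The oddness of g in f(w) = g(w + (k+1)/2), written as a reflection that sends integers to
    integers, so that it applies directly to the values of f at mode indices. *)
Definition antisym k f := forall z, f.[- (z + (k + 1)%:~R)] = - f.[z].

Lemma antisymP k f : antisym k f <->
  exists2 g, odd_polynomial g & f = g \Po ('X + ((k + 1)%:~R / 2%:R)%:P).
Proof.
have h2 : (2 : K) != 0 by rewrite pnatr_eq0.
split=> [af|[g /odd_polynomialP og ->] z]; last first.
  rewrite !horner_comp !hornerE -og; congr (g.[_]).
  by field.
exists (f \Po ('X - ((k + 1)%:~R / 2%:R)%:P)).
  apply/odd_polynomialP => z; rewrite !horner_comp !hornerE -af.
  by congr (f.[_]); field.
apply: horner_ext => z; rewrite !horner_comp !hornerE.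
by congr (f.[_]); ring.
Qed.

Lemma DplusP X : Dplus X <-> forall k, antisym k X.1@_k.
Proof. by split=> H k; apply/antisymP; apply: H. Qed.

Lemma antisym0 k : antisym k 0.
Proof. by move=> z; rewrite !horner0 oppr0. Qed.

Lemma antisym_lin k (a : K) f g :
  antisym k f -> antisym k g -> antisym k (a *: f + g).
Proof. by move=> af ag z; rewrite !hornerE af ag; ring. Qed.

Lemma mcoeff_dopZ (a : K) x k : (a *: x)@_k = a *: x@_k.
Proof. by rewrite -mul_polyC; exact: mcoeffZ. Qed.

Lemma dop_tmonZ (a : K) k f : a *: tmon k f = tmon k (a *: f).
Proof.
apply/malgP => i; rewrite mcoeff_dopZ !tmonE.
by case: eqP; rewrite ?scaler0.
Qed.

Lemma dop_tmonD k f g : tmon k f + tmon k g = tmon k (f + g).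
Proof. by apply/malgP => i; rewrite mcoeffD !tmonE; case: eqP; rewrite ?addr0. Qed.

Lemma Dplus_subspace : subspace (@Dplus K).
Proof.
split; first by apply/DplusP => k; rewrite mcoeff0; apply: antisym0.
move=> a X Y /DplusP pX /DplusP pY; apply/DplusP => k.
by rewrite /= mcoeffD mcoeff_dopZ; apply: antisym_lin.
Qed.

Lemma Dplus_tmon k f (a : K) : antisym k f -> Dplus (tmon k f, a).
Proof.
move=> af; apply/DplusP => i; rewrite /= tmonE.
by case: eqP => [->//|_]; apply: antisym0.
Qed.

Lemma Dplus_Cc : Dplus (@Cc K).
Proof. by apply/DplusP => k; rewrite /= mcoeff0; apply: antisym0. Qed.

Lemma DhatZ (a : K) x (b : K) : a *: ((x, b) : Dhat K) = (a *: x, a * b).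
Proof. by []. Qed.

Lemma dop_sum x : x = \sum_(k <- msupp x) tmon k x@_k.
Proof. exact: monalgE. Qed.

Lemma Dhat_sum (I : Type) (r : seq I) (F : I -> dop K) (a : K) :
  (\sum_(i <- r) F i, a) = \sum_(i <- r) ((F i, 0) : Dhat K) + a *: Cc.
Proof.
elim: r => [|i r IH]; first by rewrite !big_nil /Cc add0r DhatZ scaler0 mulr1.
by rewrite !big_cons -addrA -IH; congr pair; rewrite /= add0r.
Qed.

Lemma Dhat_dec X :
  X = \sum_(k <- msupp X.1) ((tmon k X.1@_k, 0) : Dhat K) + X.2 *: Cc.
Proof. by rewrite -Dhat_sum -dop_sum; case: X. Qed.

Lemma Dplus_ind (P : Dhat K -> Prop) :
  (forall a X Y, Dplus X -> Dplus Y -> P X -> P Y -> P (a *: X + Y)) ->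
  P Cc -> (forall k f, antisym k f -> P (tmon k f, 0)) ->
  forall X, Dplus X -> P X.
Proof.
move=> PD PC Pt X /DplusP pX; rewrite (Dhat_dec X).
have P0 : P (0 : Dhat K) by have := Pt 0 _ (antisym0 0); rewrite tmon0.
suff [H1 H2] : Dplus (\sum_(k <- msupp X.1) (tmon k X.1@_k, 0) : Dhat K) /\
    P (\sum_(k <- msupp X.1) (tmon k X.1@_k, 0)).
  by rewrite addrC; apply: PD => //; apply: Dplus_Cc.
apply: (big_ind (fun Z => Dplus Z /\ P Z)).
- by split=> //; apply: subspace0 Dplus_subspace.
- move=> Y Z [pY PY] [pZ PZ]; split; first exact: subspaceD Dplus_subspace _ _ _ _.
  by rewrite -[Y]scale1r; apply: PD.
- by move=> k _; split; [apply: Dplus_tmon|apply: Pt].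
Qed.

Definition bracket_poly r s f g : {poly K} :=
  (f \Po ('X + (s%:~R)%:P)) * g - f * (g \Po ('X + (r%:~R)%:P)).

Lemma bracket_polyE r s f g z :
  (bracket_poly r s f g).[z] = f.[z + s%:~R] * g.[z] - f.[z] * g.[z + r%:~R].
Proof. by rewrite /bracket_poly !hornerE !horner_comp !hornerE. Qed.

(** The reflection for degree r + s exchanges the two products of the commutator, each up to two
    signs that cancel. *)
Lemma antisym_bracket r s f g : antisym r f -> antisym s g ->
  antisym (r + s) (bracket_poly r s f g).
Proof.
move=> af ag z; rewrite !bracket_polyE.
have -> : - (z + (r + s + 1)%:~R) + s%:~R = - (z + (r + 1)%:~R) :> K.
  by rewrite !rmorphD /=; ring.
have -> : - (z + (r + s + 1)%:~R) + r%:~R = - (z + (s + 1)%:~R) :> K.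
  by rewrite !rmorphD /=; ring.
have -> : - (z + (r + s + 1)%:~R) = - (z + s%:~R + (r + 1)%:~R) :> K.
  by rewrite !rmorphD /=; ring.
rewrite !af; have -> : - (z + s%:~R + (r + 1)%:~R) =
   - (z + r%:~R + (s + 1)%:~R) :> K by rewrite !rmorphD /=; ring.
by rewrite ag ag; ring.
Qed.

Lemma Dbracket_sum X Y : Dbracket X Y =
  \sum_(r <- msupp X.1) \sum_(s <- msupp Y.1)
    ((tmon (r + s) (bracket_poly r s X.1@_r Y.1@_s),
      Psi_hom r s X.1@_r Y.1@_s) : Dhat K).
Proof.
have E2 (I : Type) (r : seq I) (A : I -> dop K) (B : I -> K) :
    \sum_(i <- r) ((A i, B i) : Dhat K) = (\sum_(i <- r) A i, \sum_(i <- r) B i).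
  by elim: r => [|i r IH]; rewrite ?big_nil // !big_cons IH.
under eq_bigr => r _ do rewrite E2.
rewrite E2 /Dbracket /dcomm; congr pair.
rewrite /dmul [X in _ - X]exchange_big /= -sumrB; apply: eq_bigr => r _.
rewrite -sumrB; apply: eq_bigr => s _.
apply/malgP => i; rewrite mcoeffB !tmonE (addrC s r) /bracket_poly.
by case: eqP => _; [rewrite [_ * X.1@_r]mulrC|rewrite subr0].
Qed.

Lemma Dplus_bracket X Y : Dplus X -> Dplus Y -> Dplus (Dbracket X Y).
Proof.
move=> /DplusP pX /DplusP pY; rewrite Dbracket_sum.
apply: (subspace_sum Dplus_subspace) => r _.
apply: (subspace_sum Dplus_subspace) => s _.
exact/Dplus_tmon/antisym_bracket.
Qed.

(** The falling factorial: the n-th power of d/dt is t^(-n) D(D-1)...(D-n+1). *)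
Definition ffp (n : nat) : {poly K} := \prod_(i < n) ('X - (i%:R)%:P).

Definition Wpoly (n : nat) k : {poly K} :=
  (- 2%:R^-1) *: (ffp n + (ffp n \Po ('X + ((k + n%:Z)%:~R)%:P))).

Lemma dexp_dtE n : dexp (dt K) n = tmon (- n%:Z) (ffp n).
Proof.
elim: n => [|n IH]; first by rewrite /dexp /= oppr0 /ffp big_ord0.
rewrite /dexp iterS -/(dexp _ _) IH /dt dmul_tmon /ffp big_ord_recr /=.
congr (tmon _ _); first by lia.
by rewrite comp_polyX mulrC rmorphN /= polyCN.
Qed.

Lemma W_E n k : odd n -> W n k = (tmon k (Wpoly n k), 0) :> Dhat K.
Proof.
move=> on; rewrite /W dexp_dtE !dmul_tmon /Wpoly; congr pair.
rewrite exprS -signr_odd on expr1 mulrNN mulr1 scale1r.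
have -> : k + n%:Z - n%:Z = k by rewrite addrK.
have -> : - n%:Z + (k + n%:Z) = k by lia.
by rewrite dop_tmonD dop_tmonZ comp_polyC mul1r mulr1.
Qed.

Lemma ffpE n z : (ffp n).[z] = \prod_(i < n) (z - i%:R).
Proof. by rewrite /ffp horner_prod; apply: eq_bigr => i _; rewrite !hornerE. Qed.

Lemma WpolyE n k z : (Wpoly n k).[z] =
  - (2%:R^-1 * ((ffp n).[z] + (ffp n).[z + k%:~R + n%:R])).
Proof.
rewrite /Wpoly !hornerE horner_comp !hornerE mulNr.
by rewrite rmorphD /= addrA.
Qed.

(** The map z -> n - 1 - z permutes the roots 0, ..., n-1. For odd n this is the source of the
    antisymmetry of [Wpoly]. *)
Lemma ffp_refl n z : (ffp n).[n%:R - 1 - z] = (-1) ^+ n * (ffp n).[z].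
Proof.
rewrite !ffpE (reindex_inj rev_ord_inj) /= -[X in (-1) ^+ X]card_ord.
rewrite -prodrN; apply: eq_bigr => i _.
rewrite natrB ?ltn_ord // -addn1 natrD; ring.
Qed.

Lemma antisym_Wpoly n k : odd n -> antisym k (Wpoly n k).
Proof.
move=> on z; rewrite !WpolyE.
have E w : (ffp n).[n%:R - 1 - w] = - (ffp n).[w].
  by rewrite ffp_refl -signr_odd on mulN1r.
have -> : - (z + (k + 1)%:~R) + k%:~R + n%:R = n%:R - 1 - z :> K.
  by rewrite rmorphD /=; ring.
have -> : - (z + (k + 1)%:~R) = n%:R - 1 - (z + k%:~R + n%:R) :> K.
  by rewrite rmorphD /=; ring.
by rewrite !E; ring.
Qed.

Lemma Dplus_W n k : odd n -> Dplus (W n k : Dhat K).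
Proof. by move=> on; rewrite W_E //; apply/Dplus_tmon/antisym_Wpoly. Qed.

Lemma size_ffp n : size (ffp n) = n.+1.
Proof. by rewrite /ffp -big_enum size_prod_XsubC size_enum_ord. Qed.

Lemma monic_ffp n : ffp n \is monic.
Proof. exact: monic_prod_XsubC. Qed.

Lemma size_Wpoly n k : (size (Wpoly n k) <= n.+1)%N.
Proof.
rewrite /Wpoly; apply: leq_trans (size_scale_leq _ _) _.
apply: leq_trans (size_polyD _ _) _; rewrite geq_max size_ffp leqnn /=.
by rewrite size_comp_poly2 ?size_ffp // size_XaddC.
Qed.

Lemma lead_Wpoly n k : (Wpoly n k)`_n = -1.
Proof.
have E (p : {poly K}) : size p = n.+1 -> lead_coef p = p`_n by rewrite lead_coefE => ->.
have h2 : (2 : K) != 0 by rewrite pnatr_eq0.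
rewrite /Wpoly coefZ coefD -(E (ffp n)) ?size_ffp // -(E (_ \Po _)); last first.
  by rewrite size_comp_poly2 ?size_ffp // size_XaddC.
rewrite lead_coef_comp ?size_XaddC // (monicP (monic_ffp n)).
rewrite lead_coefXaddC expr1n mulr1; by field.
Qed.

Lemma antisym_lead k f : antisym k f -> f != 0 -> odd (size f).-1.
Proof.
move=> af f0; have E : f \Po (- 'X - ((k + 1)%:~R)%:P) = - f.
  by apply: horner_ext => z; rewrite horner_comp !hornerE -af opprD.
have sz : size (- 'X - ((k + 1)%:~R)%:P : {poly K}) = 2.
  by rewrite -opprD size_polyN size_XaddC.
have := congr1 lead_coef E; rewrite lead_coef_comp ?sz // lead_coefN.
rewrite -opprD lead_coefN lead_coefXaddC -signr_odd; case: (odd _) => //.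
rewrite expr0 mulr1 => /eqP; rewrite -addr_eq0 -mulr2n mulrn_eq0 /=.
by rewrite lead_coef_eq0 (negPf f0).
Qed.

(** A nonzero f in degree k has odd degree d by [antisym_lead], and [Wpoly d k] has leading
    coefficient -1, so adding [lead_coef f] times it lowers the degree. *)
Lemma Dplus_W_ind (P : Dhat K -> Prop) : subspace P -> P Cc ->
  (forall n k, odd n -> P (W n k)) -> forall X, Dplus X -> P X.
Proof.
move=> sP PC PW; apply: Dplus_ind => //.
  by move=> a X Y _ _ PX PY; case: sP => _; apply.
move=> k f; have [m] := ubnP (size f); elim: m f => [//|m IH] f fm af.
have [->|f0] := eqVneq f 0; first by rewrite tmon0; exact: (subspace0 sP).
set d := (size f).-1; have od : odd d by apply: antisym_lead af f0.
have sf : size f = d.+1 by rewrite /d prednK // size_poly_gt0.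
set g := lead_coef f *: Wpoly d k + f.
have ag : antisym k g by apply: antisym_lin => //; apply: antisym_Wpoly.
have gm : (size g < m)%N.
  rewrite -ltnS; apply: leq_trans fm; rewrite sf !ltnS.
  apply/leq_sizeP => j; rewrite leq_eqVlt => /orP[/eqP<-|dj].
    by rewrite coefD coefZ lead_Wpoly lead_coefE sf mulrN1 addNr.
  rewrite coefD coefZ (leq_sizeP _ _ (size_Wpoly d k)) //.
  by rewrite mulr0 add0r nth_default // sf.
have -> : (tmon k f, 0) = - lead_coef f *: W d k + (tmon k g, 0) :> Dhat K.
  have Ef : f = (- lead_coef f *: Wpoly d k) + g.
    by rewrite /g addrA -scalerDl addNr scale0r add0r.
  rewrite W_E // DhatZ dop_tmonZ mulr0 [in LHS]Ef -dop_tmonD.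
  by congr pair; rewrite add0r.
case: sP => _; apply; [exact: PW|exact: IH].
Qed.

(** Translation covariance of the field W^n(z) in terms of modes, with W^1_(-1), that is -t^(-1)D,
    as translation operator. *)
Lemma bracket_W1 n k : odd n ->
  Dbracket (W 1 (-1)) (W n k) = - (k + n%:Z)%:~R *: W n (k - 1) :> Dhat K.
Proof.
move=> on; rewrite !W_E // Dbracket_tmon DhatZ mulr0 dop_tmonZ.
have W1 z : (Wpoly 1 (-1)).[z] = - z.
  rewrite WpolyE !ffpE !big_ord1 rmorphN /=.
  have h2 : (2 : K) != 0 by rewrite pnatr_eq0.
  by field.
congr pair; last first.
  rewrite /Psi_hom; case: eqP => // /eqP; rewrite addrC subr_eq0 => /eqP ->.
  by rewrite /= /psi_sum big_nat1 W1 subrr oppr0 mulr0 oppr0.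
rewrite [-1 + k]addrC; congr (tmon _ _).
rewrite -/(bracket_poly _ _ _ _).
apply: horner_ext => z; rewrite bracket_polyE !W1 [RHS]hornerZ !WpolyE.
have -> : z + k%:~R + n%:R = z + (k - 1)%:~R + n%:R + 1.
  by rewrite rmorphB /=; ring.
have -> : z + (-1)%:~R + k%:~R + n%:R = z + (k - 1)%:~R + n%:R.
  by rewrite rmorphB rmorphN /=; ring.
case: n on => [//|n] _.
set u := z + (k - 1)%:~R + n.+1%:R.
(* The four falling factorials involved share the length n products based at z - 1 and at u; once
   these are factored out, only linear factors remain. *)
have S w : (ffp n.+1).[w] = (\prod_(i < n) (w - i%:R)) * (w - n%:R).
  by rewrite ffpE big_ord_recr.
have S1 w : (ffp n.+1).[w + 1] = (\prod_(i < n) (w - i%:R)) * (w + 1).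
  rewrite ffpE big_ord_recl /= subr0 mulrC; congr (_ * _).
  by apply: eq_bigr => i _; rewrite /bump /= add1n -addn1 natrD; ring.
have -> : z + (-1)%:~R = z - 1 by rewrite rmorphN.
have -> : (ffp n.+1).[z] = (\prod_(i < n) (z - 1 - i%:R)) * z.
  by rewrite -{1}[z](subrK 1) S1 subrK.
rewrite (S (z - 1)) (S1 u) (S u).
have Ek : k%:~R = u - z - n%:R :> K by rewrite /u rmorphB /= -addn1 natrD; ring.
rewrite rmorphD /= Ek -pmulrn -addn1 natrD. ring.
Qed.

End DifferentialOperators.

(** * Highest weight modules *)

Section Graded.
Variables (K : numFieldType) (M : lmodType K).
Implicit Types (f : M -> M) (Z : M -> Prop).

(** A finite decomposition into eigenvectors with natural eigenvalues in which only the component of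
    eigenvalue 0 is constrained. Proved on generators, it yields ker f inside Z by [graded_ker]. *)
Definition graded f Z (u : M) : Prop := exists D (w : nat -> M),
  [/\ Z (w 0%N), forall d, f (w d) = d%:R *: w d,
      forall d, (D <= d)%N -> w d = 0 & u = \sum_(d < D) w d].

Lemma gradedP f Z u : graded f Z u -> exists D0, forall D, (D0 <= D)%N ->
  exists w : nat -> M,
  [/\ Z (w 0%N), forall d, f (w d) = d%:R *: w d,
      forall d, (D <= d)%N -> w d = 0 & u = \sum_(d < D) w d].
Proof.
move=> [D0 [w [Zw fw w0 ->]]]; exists D0 => D DD0; exists w; split=> //.
  by move=> d /(leq_trans DD0)/w0.
rewrite -!(big_mkord xpredT w) [RHS](big_cat_nat (n := D0)) //= -[LHS]addr0.
congr (_ + _); rewrite big_nat_cond big1 // => d.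
by move=> /andP[/andP[/w0]].
Qed.

Lemma graded_subspace f Z : linear f -> subspace Z -> subspace (graded f Z).
Proof.
move=> fL sP; split.
  exists 0%N, (fun _ => 0); split=> //; rewrite ?big_ord0 //.
    exact: subspace0 sP.
  by move=> d; rewrite (lin0 fL) scaler0.
move=> a u v /gradedP[Du Hu] /gradedP[Dv Hv].
have [wu [Pu fu u0 ->]] := Hu _ (leq_maxl Du Dv).
have [wv [Pv fv v0 ->]] := Hv _ (leq_maxr Du Dv).
exists (maxn Du Dv), (fun d => a *: wu d + wv d); split=> //.
- by case: sP => _; apply.
- by move=> d; rewrite fL fu fv scalerDr !scalerA mulrC.
- by move=> d dD; rewrite u0 // v0 // scaler0 addr0.
by rewrite scaler_sumr -big_split.
Qed.

Lemma graded_eigen f Z (d : nat) u : linear f -> Z 0 -> (d = 0%N -> Z u) ->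
  f u = d%:R *: u -> graded f Z u.
Proof.
move=> fL Z0 Pu fu; exists d.+1, (fun i => if i == d then u else 0); split.
- by case: eqP => // /esym/Pu.
- by move=> i; case: eqP => [->//|_]; rewrite (lin0 fL) scaler0.
- by move=> i di; case: eqP di => // ->; rewrite ltnn.
rewrite big_ord_recr /= eqxx big1 ?add0r // => i _.
by rewrite ltn_eqF.
Qed.

Lemma graded_ker f Z u : linear f -> Z 0 -> graded f Z u -> f u = 0 -> Z u.
Proof.
move=> fL Z0 [D [w [Zw fw w0 uE]]] fu.
have E d : (d < D)%N -> f (w d) = 0.
  apply: (@eigen_component _ _ f (fun v => f v = 0)) => //.
  - split; first exact: lin0.
    by move=> a x y fx fy; rewrite fL fx fy scaler0 addr0.
  - by move=> v ->; apply: lin0.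
  - by rewrite -uE.
have wS d : w d.+1 = 0.
  have [/w0//|dD] := leqP D d.+1; have := E _ dD.
  by rewrite fw => /eqP; rewrite scaler_eq0 pnatr_eq0 => /eqP.
case: D => [|D] in E w0 uE *; first by rewrite uE big_ord0.
rewrite uE big_ord_recl big1 ?addr0 // => i _; exact: wS.
Qed.

(** As m > 0, the image under g has no component of eigenvalue 0, so Z need not be stable under
    g. *)
Lemma graded_shift f Z (g : M -> M) (m : nat) u : linear f -> linear g ->
  Z 0 -> (0 < m)%N -> (forall v, f (g v) = g (f v) + m%:R *: g v) ->
  graded f Z u -> graded f Z (g u).
Proof.
move=> fL gL Z0 m0 fg [D [w [Zw fw w0 ->]]].
exists (m + D)%N, (fun d => if (m <= d)%N then g (w (d - m)%N) else 0); split.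
- by rewrite leqNgt m0.
- move=> d; case: leqP => [md|_]; last by rewrite (lin0 fL) scaler0.
  by rewrite fg fw (linZ gL) -scalerDl -natrD subnK.
- move=> d dD; rewrite w0 ?(lin0 gL) ?if_same //.
  by rewrite leq_subRL // (leq_trans _ dD) // leq_addr.
rewrite [RHS]big_split_ord /= [X in _ = X + _]big1 ?add0r => [|i _]; last first.
  by rewrite leqNgt ltn_ord.
rewrite (lin_sum gL); apply: eq_bigr => i _.
by rewrite leq_addr addKn.
Qed.

End Graded.

Section Representations.
Variables (K : numFieldType).
Local Notation Dhat := (Dhat K).

Definition stable (M : lmodType K) (rho : Dhat -> M -> M) (P : M -> Prop) :=
  forall X v, Dplus X -> P v -> P (rho X v).

Definition generated (M : lmodType K) (rho : Dhat -> M -> M) (v u : M) :=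
  forall P, subspace P -> stable rho P -> P v -> P u.

(** The grading element D + 1/2: its bracket with t^k f(D) is k t^k f(D), with no central term. *)
Definition H0 : Dhat := (tmon 0 ('X + (2%:R^-1)%:P), 0).

Lemma antisym_H0 : @antisym K 0 ('X + (2%:R^-1)%:P).
Proof.
move=> z; rewrite !hornerE.
have h2 : (2 : K) != 0 by rewrite pnatr_eq0.
by field.
Qed.

Lemma Dplus_H0 : Dplus H0.
Proof. exact: Dplus_tmon antisym_H0. Qed.

Lemma bracket_H0 k (f : {poly K}) :
  Dbracket H0 (tmon k f, 0) = k%:~R *: (tmon k f, 0).
Proof.
rewrite /H0 Dbracket_tmon add0r DhatZ mulr0 dop_tmonZ; congr pair; last first.
  by rewrite /Psi_hom add0r; case: eqP => // ->; rewrite /= /psi_sum big_geq.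
congr (tmon _ _); rewrite -/(bracket_poly _ _ _ _); apply: horner_ext => z.
rewrite bracket_polyE [RHS]hornerZ !hornerE /=; ring.
Qed.

Section Rep.
Variables (M : lmodType K) (rho : Dhat -> M -> M).
Hypothesis rep : Dplus_rep rho.

Lemma repE X Y v : Dplus X -> Dplus Y ->
  rho X (rho Y v) = rho Y (rho X v) + rho (Dbracket X Y) v.
Proof. by move=> pX pY; rewrite (rep_bracket rep) // addrC subrK. Qed.

Lemma rep0 v : rho 0 v = 0.
Proof.
have p0 := subspace0 (Dplus_subspace K).
have := rep_linearl rep 1 v p0 p0; rewrite !scale1r addr0 => E.
by apply: (@addrI _ (rho 0 v)); rewrite -E addr0.
Qed.

Lemma repZ a X v : Dplus X -> rho (a *: X) v = a *: rho X v.
Proof.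
move=> pX; have := rep_linearl rep a v pX (subspace0 (Dplus_subspace K)).
by rewrite rep0 !addr0.
Qed.

Lemma rep_ind_stable P : subspace P -> (forall v, P v -> P (rho Cc v)) ->
  (forall k f v, antisym k f -> P v -> P (rho (tmon k f, 0) v)) -> stable rho P.
Proof.
move=> sP PC Pt X v pX Pv; move: X pX; apply: Dplus_ind; last 2 first.
- exact: PC.
- by move=> k f af; apply: Pt.
move=> a X Y pX pY PX PY; rewrite (rep_linearl rep) //.
by case: sP => _; apply.
Qed.

Lemma rep_W_stable P : subspace P -> (forall v, P v -> P (rho Cc v)) ->
  (forall n k v, odd n -> P v -> P (rho (W n k) v)) -> stable rho P.
Proof.
move=> sP PC PW X v pX Pv.
suff [] : Dplus X /\ P (rho X v) by [].
move: X pX; apply: (@Dplus_W_ind K (fun X => Dplus X /\ P (rho X v))).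
- split; first by split; [exact: subspace0 (Dplus_subspace K)|
    rewrite rep0; exact: subspace0 sP].
  move=> a X Y [pX PX] [pY PY]; split.
    by case: (Dplus_subspace K) => _; apply.
  by rewrite (rep_linearl rep) //; case: sP => _; apply.
- by split; [exact: Dplus_Cc|exact: PC].
- by move=> n k on; split; [exact: Dplus_W|exact: PW].
Qed.

Record hw_line (v : M) : Prop := {
  hw_pos : forall k f, antisym k f -> 0 < k -> rho (tmon k f, 0) v = 0;
  hw_zero : forall f, antisym 0 f -> exists c, rho (tmon 0 f, 0) v = c *: v;
  hw_central : exists c, rho Cc v = c *: v
}.

Lemma generated_subspace v : subspace (generated rho v).
Proof.
split=> [P sP _ _|a u w gu gw P sP rP Pv]; first exact: subspace0 sP.
by case: (sP) => _; apply; [exact: gu|exact: gw].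
Qed.

Lemma generated_stable v : stable rho (generated rho v).
Proof. by move=> X u pX gu P sP rP Pv; apply: (rP _ _ pX); apply: (gu P). Qed.

(* The span of the words in strictly negative homogeneous elements applied to
   [v] is already a submodule. *)
Lemma generated_neg v P : hw_line v -> subspace P -> P v ->
  (forall k f w, k < 0 -> antisym k f -> P w -> P (rho (tmon k f, 0) w)) ->
  forall u, generated rho v u -> P u.
Proof.
move=> hv sP Pv Pneg u gu.
(* The span of the words in negative elements applied to v, as the intersection of all suitable
   subspaces. *)
pose T u := forall Q, subspace Q -> Q v ->
  (forall k f w, k < 0 -> antisym k f -> Q w -> Q (rho (tmon k f, 0) w)) -> Q u.
suff Tu : T u by apply: Tu.
have sT : subspace T.
  split=> [Q sQ _ _|a x y Tx Ty Q sQ Qv Qn]; first exact: subspace0 sQ.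
  by case: (sQ) => _; apply; [exact: Tx|exact: Ty].
have Tv : T v by [].
have Tneg k f w : k < 0 -> antisym k f -> T w -> T (rho (tmon k f, 0) w).
  by move=> k0 af Tw Q sQ Qv Qn; apply: (Qn _ _ _ k0 af); apply: (Tw Q).
(* Stability of T under all of Dplus is proved by induction on words, from X Y w = Y X w + [X, Y] w
   with Y negative; the induction needs the claim for every X at once. *)
pose T' u := T u /\ forall X, Dplus X -> T (rho X u).
have sT' : subspace T'.
  apply: subspaceI => //; split=> [X pX|a x y Tx Ty X pX].
    by rewrite (lin0 (rep_linear rep pX)); apply: subspace0 sT.
  by rewrite (rep_linear rep pX); case: (sT) => _; apply; [exact: Tx|exact: Ty].
have T'v : T' v.
  split=> //; apply: Dplus_ind.
  - move=> a X Y pX pY TX TY; rewrite (rep_linearl rep) //.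
    by case: (sT) => _; apply.
  - by have [c ->] := hw_central hv; apply: (subspaceZ sT).
  move=> k f af; case: (ltgtP k 0) => [k0|k0|k0].
  - exact: Tneg.
  - by rewrite (hw_pos hv) //; apply: subspace0 sT.
  by rewrite k0 in af *; have [c ->] := hw_zero hv af; apply: (subspaceZ sT).
have T'neg k f w : k < 0 -> antisym k f -> T' w -> T' (rho (tmon k f, 0) w).
  move=> k0 af [Tw Tw']; split; first exact: Tneg.
  move=> X pX; have pk : Dplus (tmon k f, 0 : K^o) by apply: Dplus_tmon.
  rewrite (repE _ pX pk); apply: (subspaceD sT).
    by apply: (Tneg _ _ _ k0 af); apply: (Tw' _ pX).
  by apply: (Tw' _ (Dplus_bracket pX pk)).
have TT' w : T w -> T' w by move=> Tw; apply: Tw.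
by apply: gu => // X w pX /TT'[_]; apply.
Qed.

(** On the generated module h - [H0] has natural eigenvalues, since each negative element raises
    them strictly; eigenvalue 0 occurs only on the line of v. *)
Lemma generated_top v u h : hw_line v -> rho H0 v = h *: v ->
  generated rho v u -> rho H0 u = h *: u -> exists c, u = c *: v.
Proof.
move=> hv Hv gu Hu; pose g w := h *: w - rho H0 w.
have HL := rep_linear rep Dplus_H0.
have gL : linear g by apply: linear_sub => //; apply: linear_scale.
apply: (@graded_ker _ _ g (fun w => exists c, w = c *: v)) => //; last 2 first.
- move: u gu {Hu}; apply: generated_neg => //.
  + apply: graded_subspace => //; split; first by exists 0; rewrite scale0r.
    move=> a _ _ [c ->] [d ->]; exists (a * c + d).
    by rewrite scalerA -scalerDl.
  + apply: (@graded_eigen _ _ _ _ 0) => //.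
    * by exists 0; rewrite scale0r.
    * by move=> _; exists 1; rewrite scale1r.
    * by rewrite /g Hv subrr scale0r.
  move=> k f w k0 af; have pk : Dplus (tmon k f, 0 : K^o) by apply: Dplus_tmon.
  apply: (@graded_shift _ _ _ _ _ `|k|%N) => //.
  + exact: rep_linear.
  + by exists 0; rewrite scale0r.
  + by rewrite absz_gt0 lt_eqF.
  move=> x; rewrite /g (linB (rep_linear rep pk)) (linZ (rep_linear rep pk)).
  rewrite repE //; last exact: Dplus_H0.
  rewrite bracket_H0 repZ // opprD addrA; congr (_ + _); rewrite -scaleNr.
  by congr (_ *: _); rewrite -rmorphN pmulrn; congr intmul; lia.
- by rewrite /g Hu subrr.
- by exists 0; rewrite scale0r.
Qed.

End Rep.

Section Embedding.
Variables (M1 M2 : lmodType K) (rho1 : Dhat -> M1 -> M1) (rho2 : Dhat -> M2 -> M2).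
Hypotheses (rep1 : Dplus_rep rho1) (rep2 : Dplus_rep rho2).

Definition rho12 (X : Dhat) (x : M1 * M2) : M1 * M2 := (rho1 X x.1, rho2 X x.2).

Lemma rep12 : @Dplus_rep _ (M1 * M2)%type rho12.
Proof.
split=> [X pX a [u u'] [v v']|a X Y [v v'] pX pY|X Y [v v'] pX pY].
- by congr pair; [apply: (rep_linear rep1 pX)|apply: (rep_linear rep2 pX)].
- by congr pair; [apply: (rep_linearl rep1)|apply: (rep_linearl rep2)].
- by congr pair; [apply: (rep_bracket rep1)|apply: (rep_bracket rep2)].
Qed.

Variables (v1 : M1) (v2 : M2).
Hypotheses (irr1 : Dplus_irreducible rho1) (v1_neq0 : v1 != 0) (v2_neq0 : v2 != 0).
Hypothesis hw12 : @hw_line (M1 * M2)%type rho12 (v1, v2).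
Hypothesis sub2 : forall P : M2 -> Prop, subspace P -> stable rho2 P ->
  (forall w, P w -> generated rho2 v2 w) -> (exists2 w, P w & w != 0) -> P v2.

(* The submodule of [M1 * M2] generated by [(v1, v2)] is the graph of the map. *)
Lemma hw_embedding : exists phi : M1 -> M2,
  [/\ linear phi, injective phi, phi v1 = v2,
      forall X u, Dplus X -> phi (rho1 X u) = rho2 X (phi u)
    & forall u, generated rho2 v2 (phi u)].
Proof.
have irrP P : subspace P -> stable rho1 P ->
    (forall v, P v -> v = 0) \/ (forall v, P v).
  move=> sP rP; have [_ H] := irr1; apply: (H P sP) => -[X pX] v Pv.
  exact: rP.
pose N : (M1 * M2)%type -> Prop := @generated (M1 * M2)%type rho12 (v1, v2).
have sN : subspace N by apply: generated_subspace.
have rN : stable rho12 N by apply: generated_stable.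
have Nv : N (v1, v2) by [].
(* The projection of N to [M1] is a submodule containing [v1], hence everything by
   irreducibility. *)
have N_ex u : exists w, N (u, w).
  have [||H|//] := irrP (fun u => exists w, N (u, w)).
  - split; first by exists 0; apply: (subspace0 sN).
    move=> a x y [w Nw] [z Nz]; exists (a *: w + z).
    by case: sN => _ /(_ a _ _ Nw Nz).
  - by move=> X x pX [w Nw]; exists (rho2 X w); apply: (rN _ _ pX Nw).
  by move: v1_neq0; rewrite (H v1) ?eqxx //; exists v2.
have N_gen u w : N (u, w) -> generated rho2 v2 w.
  pose P (x : (M1 * M2)%type) := generated rho2 v2 x.2.
  move=> Nuw; apply: (Nuw P) => //.
  - have [g0 gD] := generated_subspace rho2 v2; split=> [|a x y].
      exact: g0.
    exact: gD.
  - by move=> X x pX; apply: generated_stable.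
(* The fibre of N over 0 is a submodule of [M2]. If it is nonzero, it contains [v2] by [sub2]; then
   (0, v2) has the weight of (v1, v2) in the module N, so it is a multiple of (v1, v2),
   contradicting that both vectors are nonzero. *)
have N0 w : N (0, w) -> w = 0.
  move=> Nw; apply/eqP; apply: contraT => w0.
  have N2 : N (0, v2).
    apply: (sub2 (P := fun w => N (0, w))).
    - split; first exact: (subspace0 sN).
      move=> a x y Nx Ny; case: sN => _ /(_ a _ _ Nx Ny).
      by congr N; congr pair; rewrite /= scaler0 addr0.
    - move=> X x pX /(rN _ _ pX); rewrite /rho12 /=.
      by rewrite (lin0 (rep_linear rep1 pX)).
    - by move=> x; apply: N_gen.
    - by exists w.
  have [h Hh] := hw_zero hw12 antisym_H0.
  have Hh2 : rho12 H0 (0, v2) = h *: ((0, v2) : (M1 * M2)%type).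
    case: Hh => _ E2; congr pair; last exact: E2.
    by rewrite (lin0 (rep_linear rep1 Dplus_H0)) scaler0.
  have [c [/esym/eqP Ec E2]] := generated_top rep12 hw12 Hh N2 Hh2.
  move: Ec; rewrite scaler_eq0 (negPf v1_neq0) orbF => /eqP c0.
  by move: v2_neq0; rewrite E2 c0 scale0r eqxx.
have N_uniq u w w' : N (u, w) -> N (u, w') -> w = w'.
  move=> Nw Nw'; apply/eqP; rewrite -subr_eq0; apply/eqP/N0.
  by have := subspaceB sN Nw Nw'; congr N; congr pair; apply: subrr.
pose phi u := sval (cid (N_ex u)).
have phiP u : N (u, phi u) by apply: svalP (cid (N_ex u)).
have phiL : linear phi.
  move=> a x y; apply: (N_uniq (a *: x + y)) => //.
  by case: sN => _ /(_ a _ _ (phiP x) (phiP y)).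
have phiX X u : Dplus X -> phi (rho1 X u) = rho2 X (phi u).
  by move=> pX; apply: (N_uniq (rho1 X u)) => //; apply: (rN _ _ pX (phiP u)).
have phiv : phi v1 = v2 by apply: (N_uniq v1).
exists phi; split=> // [x y E|u]; last exact: N_gen (phiP u).
have [||H|H] := irrP (fun u => phi u = 0).
- by apply: subspace_eq => //; apply: linear_zero.
- by move=> X u pX Eu; rewrite phiX // Eu (lin0 (rep_linear rep2 pX)).
- by apply/eqP; rewrite -subr_eq0; apply/eqP/H; rewrite (linB phiL) E subrr.
- by move: v2_neq0; rewrite -phiv H eqxx.
Qed.

End Embedding.
End Representations.

(** * The Fock space *)

Section FieldMaps.
Variables (K : numFieldType) (F : vertexSuperalgebra K).

Lemma Y_linear (a : F) m : linear (Y a m).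
Proof. by case: (@Y_field _ F). Qed.

Lemma Y_linearl m (v : F) : linear (fun a => Y a m v).
Proof. by case: (@Y_field _ F). Qed.

HB.instance Definition _ (a : F) (m : int) :=
  GRing.isLinear.Build K F F *:%R (Y a m) (Y_linear a m).

Lemma YD a m u v : Y (a : F) m (u + v) = Y a m u + Y a m v.
Proof. exact: linearD. Qed.

Lemma YB a m u v : Y (a : F) m (u - v) = Y a m u - Y a m v.
Proof. exact: linearB. Qed.

Lemma YN a m u : Y (a : F) m (- u) = - Y a m u.
Proof. exact: linearN. Qed.

Lemma YZ a m c u : Y (a : F) m (c *: u) = c *: Y a m u.
Proof. exact: linearZ. Qed.

Lemma Y0 a m : Y (a : F) m 0 = 0.
Proof. exact: linear0. Qed.

(** The Fock space in a basis whose dual basis is the permuted basis [e (st i)], so that [psi] and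
    [phi] are treated uniformly. Product indices are shifted by 1/2 from mode numbers, whence the
    condition m + k = -1. *)
Record clifford (n : nat) (e : 'I_n -> F) (st : 'I_n -> 'I_n) : Prop := {
  cliff_inv : involutive st;
  cliff_odd : forall i, parity true (e i);
  cliff_CAR : forall i j (m k : int) v,
    Y (e i) m (Y (e j) k v) + Y (e j) k (Y (e i) m v)
    = (if m + k == -1 then (j == st i)%:R else 0) *: v;
  cliff_vac_neq0 : vac F != 0;
  cliff_kill : forall i m, 0 <= m -> Y (e i) m (vac F) = 0;
  cliff_cyclic : forall P : F -> Prop, subspace P -> P (vac F) ->
    (forall i m v, P v -> P (Y (e i) m v)) -> forall v, P v
}.

End FieldMaps.

Section Fock.
Variables (K : numFieldType) (F : vertexSuperalgebra K).
Variables (n : nat) (e : 'I_n -> F) (st : 'I_n -> 'I_n).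
Hypothesis cl : clifford e st.
Local Notation psi i := (Y (e i)).

Let stK : involutive st := cliff_inv cl.

Lemma st_eq i j : (j == st i) = (i == st j).
Proof. by apply/eqP/eqP => ->; rewrite stK. Qed.

Lemma CAR i j m k v : psi i m (psi j k v) =
  (if m + k == -1 then (j == st i)%:R else 0) *: v - psi j k (psi i m v).
Proof. by rewrite -(cliff_CAR cl) addrK. Qed.

Lemma CAR0 i j m k v : m + k != -1 -> psi i m (psi j k v) = - psi j k (psi i m v).
Proof. by move=> mk; rewrite CAR (negPf mk) scale0r add0r. Qed.

Lemma field_bound v : exists B : nat, forall i m, B%:Z <= m -> psi i m v = 0.
Proof.
have H i : exists B : nat, forall m, B%:Z <= m -> psi i m v = 0.
  have [_ _ /(_ (e i) v)[N HN]] := @Y_field _ F.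
  by exists `|N|%N => m Bm; apply: HN; apply: le_trans Bm; lia.
pose B i := sval (cid (H i)).
exists (\max_i B i)%N => i m Bm; apply: (svalP (cid (H i))).
by apply: le_trans Bm; rewrite lez_nat; apply: (leq_bigmax i).
Qed.

Definition quad (p q : int) (v : F) : F := \sum_i psi i p (psi (st i) q v).

Lemma quad_linear p q : linear (quad p q).
Proof. by apply: linear_big => i; apply: linear_comp; apply: Y_linear. Qed.

HB.instance Definition _ p q :=
  GRing.isLinear.Build K F F *:%R (quad p q) (quad_linear p q).

Lemma quad_e p q j r v : quad p q (psi j r v) = psi j r (quad p q v)
  + (if q + r == -1 then psi j p v else 0) - (if p + r == -1 then psi j q v else 0).
Proof.
rewrite /quad linear_sum /=.
have E i : psi i p (psi (st i) q (psi j r v)) = psi j r (psi i p (psi (st i) q v))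
  + (if q + r == -1 then (j == i)%:R *: psi i p v else 0)
  - (if p + r == -1 then (j == st i)%:R *: psi (st i) q v else 0).
  rewrite (CAR (st i) j) linearB /= linearZ /= (CAR i j) stK opprB addrCA addrA.
  by congr (_ + _ - _); case: ifP => _; rewrite ?scale0r.
under eq_bigr => i _ do rewrite E.
rewrite sumrB big_split /=; congr (_ + _ - _).
  case: eqP => _; last by rewrite big1.
  rewrite (bigD1 j) //= eqxx scale1r big1 ?addr0 // => i.
  by rewrite eq_sym => /negPf->; rewrite scale0r.
case: eqP => _; last by rewrite big1.
rewrite (bigD1 (st j)) //= stK eqxx scale1r big1 ?addr0 // => i.
by rewrite st_eq => /negPf->; rewrite scale0r.
Qed.

(** Each of the n dual pairs contributes a contraction 1; this n is the origin of the central charge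
    n/2. *)
Lemma quad_swap p q v : quad p q v = (if p + q == -1 then n%:R else 0) *: v - quad q p v.
Proof.
rewrite /quad [in RHS](reindex_inj (inv_inj stK)) /=.
under [in LHS]eq_bigr => i _ do rewrite CAR eqxx.
rewrite sumrB; congr (_ - _); last by apply: eq_bigr => i _; rewrite stK.
case: eqP => _; last by rewrite scale0r big1 // => i _; rewrite scale0r.
by rewrite sumr_const card_ord scale1r scaler_nat.
Qed.

Lemma quad_vac p q : 0 <= q -> quad p q (vac F) = 0.
Proof.
by move=> q0; apply: big1 => i _; rewrite (cliff_kill cl) // linear0.
Qed.

Implicit Types (s t : seq ('I_n * nat)) (x : 'I_n * nat).

(** A pair (i, b) stands for the creation mode of [e i] of energy b + 1/2. Repetition-free lists
    span the Fock space, by [mono_ind]. *)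
Definition mono (s : seq ('I_n * nat)) : F :=
  foldr (fun x v => psi (x.1) (-1 - x.2%:Z) v) (vac F) s.

Lemma mono_dup x s : x \in s -> psi (x.1) (-1 - x.2%:Z) (mono s) = 0.
Proof.
have N (b c : nat) : -1 - b%:Z + (-1 - c%:Z) != -1 by lia.
elim: s => [//|y s IH] /=; rewrite inE; case: (eqVneq x y) => [<- _|_ /= /IH E].
  have := cliff_CAR cl x.1 x.1 (-1 - x.2%:Z) (-1 - x.2%:Z) (mono s).
  rewrite (negPf (N _ _)) scale0r -mulr2n -scaler_nat => /eqP.
  by rewrite scaler_eq0 pnatr_eq0 /= => /eqP.
by rewrite CAR0 // E linear0 oppr0.
Qed.

Lemma annih_notin i (b : nat) s : (st i, b) \notin s -> psi i b%:Z (mono s) = 0.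
Proof.
elim: s => [_|x s IH] /=; first exact: (cliff_kill cl).
rewrite inE negb_or => /andP[xi /IH E]; rewrite CAR E linear0 subr0.
case: ifP => [bx|_]; last by rewrite scale0r.
suff /negPf-> : x.1 != st i by rewrite scale0r.
apply: contra xi => /eqP xi; have /eqP xb : x.2 == b by lia.
by apply/eqP; case: x xi xb {bx} => /= ? ? -> ->.
Qed.

Lemma annih_mono i (b : nat) s : uniq s ->
  exists c t, subseq t s /\ psi i b%:Z (mono s) = c *: mono t.
Proof.
elim: s => [_|x s IH] /=.
  by exists 0, [::]; rewrite (cliff_kill cl) // scale0r.
move=> /andP[xs us]; rewrite CAR; case: ((st i, b) =P x) => [ix|ix].
  rewrite annih_notin ?ix // linear0 subr0.
  by eexists; exists s; split; [exact: subseq_cons|reflexivity].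
have -> : (if b%:Z + (-1 - x.2%:Z) == -1 then (x.1 == st i)%:R else 0 : K) = 0.
  case: ifP => // bx; case: eqP => // xi; case: ix.
  have /eqP xb : x.2 == b by lia.
  by rewrite -xi -xb; case: (x).
have [c [t [ts ->]]] := IH us.
exists (- c), (x :: t); split; first by rewrite /= eqxx.
by rewrite scale0r add0r linearZ scaleNr.
Qed.

Lemma mono_ind (P : F -> Prop) : subspace P ->
  (forall s, uniq s -> P (mono s)) -> forall v, P v.
Proof.
move=> sP Pm v; pose T u := forall P : F -> Prop, subspace P ->
  (forall s, uniq s -> P (mono s)) -> P u.
suff : T v by apply.
have sT : subspace T.
  split=> [R [R0 _] _ //|a x y Tx Ty R sR Rm].
  by case: (sR) => _; apply; [exact: Tx|exact: Ty].
apply: (cliff_cyclic cl) => //; first by move=> R _ /(_ [::]); apply.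
move=> i m w Tw R sR Rm; apply: (Tw (fun w => R (psi i m w))).
  by apply: subspace_preim => //; apply: Y_linear.
move=> s us; have [m0|m0] := leP 0 m.
  have [c [t [ts]]] := annih_mono i `|m|%N us.
  rewrite gez0_abs // => ->; apply: (subspaceZ sR); apply: Rm.
  exact: subseq_uniq ts us.
pose x := (i, `|(m + 1)%R|%N).
have -> : m = -1 - x.2%:Z by rewrite /=; lia.
have [xs|xs] := boolP (x \in s); last by apply: (Rm (x :: s)); rewrite /= xs.
by rewrite (mono_dup xs); apply: subspace0.
Qed.

Lemma mono_neq0 s : uniq s -> mono s != 0.
Proof.
elim: s => [_|[i b] s IH /= /andP[xs us]]; first exact: (cliff_vac_neq0 cl).
apply: contra (IH us) => /eqP E; apply/eqP.
have := congr1 (psi (st i) b%:Z) E; rewrite linear0 CAR annih_notin ?stK //.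
have -> : b%:Z + (-1 - b%:Z) = -1 by lia.
by rewrite linear0 subr0 !eqxx scale1r.
Qed.

Lemma perm_mono s t : perm_eq s t -> exists c, mono s = c *: mono t.
Proof.
have N (b c : nat) : -1 - b%:Z + (-1 - c%:Z) != -1 by lia.
have move_front x s1 s2 : exists c, mono (s1 ++ x :: s2) = c *: mono (x :: s1 ++ s2).
  elim: s1 => [|y s1 [c IH]]; first by exists 1; rewrite scale1r.
  exists (- c); rewrite /= in IH *; rewrite IH linearZ /= scaleNr -scalerN.
  by rewrite CAR0.
elim: t s => [|x t IH] s.
  by move=> /perm_nilP->; exists 1; rewrite scale1r.
move=> Est; have xs : x \in s by rewrite (perm_mem Est) mem_head.
case/splitPr: xs Est => s1 s2 Est.
have [c ->] := move_front x s1 s2.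
have [|d /= ->] := IH (s1 ++ s2).
  by move: Est; rewrite perm_catC /= perm_cons perm_catC.
by exists (c * d); rewrite linearZ /= scalerA.
Qed.

(* The operator counting the fermions of energy [b + 1/2] with weight [w b]. *)
Definition numop (w : nat -> K) : F -> F :=
  lsum (fun b v => w b *: quad (-1 - b%:Z) b%:Z v).

Lemma quad_bound v : exists B : nat, forall p q, B%:Z <= q -> quad p q v = 0.
Proof.
have [B HB] := field_bound v; exists B => p q Bq.
by apply: big1 => i _; rewrite HB // linear0.
Qed.

Lemma numop_bound w v : exists B, vanishes_from
  (fun b v => w b *: quad (-1 - b%:Z) b%:Z v) v B.
Proof.
have [B HB] := quad_bound v; exists B => b Bb.
by rewrite HB ?lez_nat // scaler0.
Qed.

Lemma numop_linear w : linear (numop w).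
Proof.
apply: lsum_linear => [b|v]; last exact: numop_bound.
by apply: linear_scale; apply: quad_linear.
Qed.

Lemma numop_vac w : numop w (vac F) = 0.
Proof.
rewrite /numop (@lsumE _ _ _ _ _ 0) ?big_ord0 // => b _.
by rewrite quad_vac // scaler0.
Qed.

Lemma quad_creation b j (c : nat) v :
  quad (-1 - b%:Z) b%:Z (psi j (-1 - c%:Z) v) =
  psi j (-1 - c%:Z) (quad (-1 - b%:Z) b%:Z v)
  + (b == c :> nat)%:R *: psi j (-1 - c%:Z) v.
Proof.
rewrite quad_e; have -> : (-1 - b%:Z + (-1 - c%:Z) == -1) = false by lia.
rewrite subr0; congr (_ + _); have -> : (b%:Z + (-1 - c%:Z) == -1) = (b == c) by lia.
by case: eqP => [->|_]; rewrite ?scale1r ?scale0r.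
Qed.

Lemma numop_creation w j (c : nat) v :
  numop w (psi j (-1 - c%:Z) v) = psi j (-1 - c%:Z) (numop w v)
  + w c *: psi j (-1 - c%:Z) v.
Proof.
have [B1 H1] := numop_bound w v; have [B2 H2] := numop_bound w (psi j (-1 - c%:Z) v).
pose B := (maxn (maxn B1 B2) c.+1).
rewrite /numop (@lsumE _ _ _ _ v B) => [|b]; last first.
  by rewrite !geq_max => /andP[/andP[/H1]].
rewrite (@lsumE _ _ _ _ _ B) => [|b]; last first.
  by rewrite !geq_max => /andP[/andP[_ /H2]].
under eq_bigr => b _ do rewrite quad_creation scalerDr.
rewrite big_split linear_sum /=; congr (_ + _).
  by apply: eq_bigr => b _; rewrite linearZ.
have cB : (c < B)%N by rewrite leq_max leqnn orbT.
rewrite (bigD1 (Ordinal cB)) //= eqxx scale1r big1 ?addr0 // => b bc.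
by rewrite [_ == _ :> nat](negPf bc) scale0r scaler0.
Qed.

Lemma numop_mono w s : numop w (mono s) = (\sum_(x <- s) w x.2) *: mono s.
Proof.
elim: s => [|x s IH]; first by rewrite numop_vac big_nil scale0r.
by rewrite [mono _]/= numop_creation IH linearZ -scalerDl big_cons addrC.
Qed.

(** Such a v is killed by the operator counting all fermions, whose eigenvalue on a monomial is its
    length; only the empty monomial has length 0. *)
Lemma vac_unique v : (forall i m, 0 <= m -> psi i m v = 0) ->
  exists c, v = c *: vac F.
Proof.
move=> Hv; have sV : subspace (fun u : F => exists c, u = c *: vac F).
  split; first by exists 0; rewrite scale0r.
  by move=> a _ _ [c ->] [d ->]; exists (a * c + d); rewrite scalerA -scalerDl.
apply: (graded_ker (Z := fun u : F => exists c, u = c *: vac F)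
  (numop_linear (fun=> 1))).
- exact: subspace0 sV.
- move: v {Hv}; apply: mono_ind.
    by apply: graded_subspace => //; apply: numop_linear.
  move=> s us; apply: (@graded_eigen _ _ _ _ (size s)).
  + exact: numop_linear.
  + exact: subspace0 sV.
  + by move=> /size0nil->; exists 1; rewrite scale1r.
  by rewrite numop_mono -sum1_size natr_sum.
rewrite /numop (@lsumE _ _ _ _ _ 0) ?big_ord0 // => b _.
by rewrite /quad big1 ?scaler0 // => i _; rewrite Hv // linear0.
Qed.

Lemma eq_on_vac (f g : F -> F) : linear f -> linear g ->
  (forall i m v, f v = g v -> f (psi i m v) = g (psi i m v)) ->
  f (vac F) = g (vac F) -> forall v, f v = g v.
Proof.
move=> fL gL fg fgv; apply: (cliff_cyclic cl) => //.
exact: subspace_eq.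
Qed.

(** The image of the vacuum is again killed by all annihilation modes, hence is a multiple c of it,
    and the scalar c propagates by cyclicity. *)
Lemma commutant_scalar (f : F -> F) : linear f ->
  (forall i m v, f (psi i m v) = psi i m (f v)) -> exists c, forall v, f v = c *: v.
Proof.
move=> fL fe; have [|c Ec] := @vac_unique (f (vac F)).
  by move=> i m m0; rewrite -fe (cliff_kill cl) // (lin0 fL).
exists c; apply: eq_on_vac => //; first exact/linear_scale/linear_id.
by move=> i m v E; rewrite fe E linearZ.
Qed.

Definition gam (v : F) : F :=
  n%:R *: quad (-1) 0 v - quad (-1) 0 (quad (-1) 0 v) + numop (fun b => (b != 0%N)%:R) v.

Lemma gam_linear : linear gam.
Proof.
apply: linear_add; last exact: numop_linear.
apply: linear_sub; first by apply: linear_scale; apply: quad_linear.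
by apply: linear_comp; apply: quad_linear.
Qed.

Lemma quad00_mono s : quad (-1) 0 (mono s) = (count (fun x => x.2 == 0%N) s)%:R *: mono s.
Proof.
elim: s => [|x s IH]; first by rewrite quad_vac // scale0r.
have := quad_creation 0 x.1 x.2 (mono s); rewrite subr0 => E; rewrite [mono _]/= {}E.
by rewrite IH linearZ /= -scalerDl natrD eq_sym addrC.
Qed.

Definition detv : F := mono [seq (i, 0%N) | i <- enum 'I_n].

(** With c factors of level 0 the eigenvalue is c(n - c) plus the number of factors of higher level.
    It vanishes only if all factors have level 0 and c is 0 or n. *)
Lemma gam_mono s : uniq s -> exists2 d : nat, gam (mono s) = d%:R *: mono s &
  d = 0%N -> exists a b, mono s = a *: vac F + b *: detv.
Proof.
move=> us; pose lvl0 (x : 'I_n * nat) := x.2 == 0%N.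
(* Factors of level 0 differ in their fermion index, so c is at most n and the subtraction n - c in
   nat is exact. *)
have inj0 : {in filter lvl0 s &, injective (fun x : 'I_n * nat => x.1)}.
  move=> [i b] [j c]; rewrite !mem_filter /lvl0 /=.
  by move=> /andP[/eqP-> _] /andP[/eqP-> _] ->.
have u0 : uniq [seq x.1 | x <- filter lvl0 s].
  by rewrite map_inj_in_uniq // filter_uniq.
have c0n : (count lvl0 s <= n)%N.
  by rewrite -size_filter -(size_map fst) -(card_uniqP u0)
    -[X in (_ <= X)%N]card_ord max_card.
exists (count lvl0 s * (n - count lvl0 s) + count (predC lvl0) s)%N.
  rewrite /gam !quad00_mono [quad _ _ (_ *: _)]linearZ /= quad00_mono numop_mono.
  rewrite !scalerA -scalerBl -scalerDl.
  congr (_ *: _); rewrite natrD natrM natrB // mulrBr mulrC; congr (_ + _).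
  elim: (s) => [|x t IH]; first by rewrite big_nil.
  by rewrite big_cons IH /= natrD.
move=> /eqP; rewrite addn_eq0 muln_eq0 subn_eq0 => /andP[/orP c0 /eqP c1].
have all0 : all lvl0 s by rewrite all_count -(count_predC lvl0) c1 addn0.
have sz : count lvl0 s = size s by apply/eqP; rewrite -all_count.
case: c0 => [/eqP|nc0].
  rewrite sz => /size0nil->; exists 1, 0.
  by rewrite scale1r scale0r addr0.
suff /perm_mono[c ->] : perm_eq s [seq (i, 0%N) | i <- enum 'I_n].
  by exists 0, c; rewrite scale0r add0r.
rewrite (all_filterP all0) in u0.
have -> : s = [seq (i, 0%N) | i <- [seq x.1 | x <- s]].
  rewrite -map_comp -[LHS]map_id; apply/eq_in_map => -[i b] /(allP all0).
  by rewrite /lvl0 /= => /eqP->.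
apply: perm_map; apply: uniq_perm => //; first exact: enum_uniq.
have [||//] := @uniq_min_size _ _ (enum 'I_n) u0.
  by move=> i _; rewrite mem_enum.
by rewrite size_enum_ord size_map -sz.
Qed.

Lemma gam_ker v : gam v = 0 -> exists a b, v = a *: vac F + b *: detv.
Proof.
have sV : subspace (fun u : F => exists a b, u = a *: vac F + b *: detv).
  split; first by exists 0, 0; rewrite !scale0r addr0.
  move=> k _ _ [a [b ->]] [c [d ->]]; exists (k * a + c), (k * b + d).
  by rewrite scalerDr !scalerA !scalerDl addrACA.
apply: (graded_ker (Z := fun u : F => exists a b, u = a *: vac F + b *: detv)
  gam_linear); first exact: subspace0 sV.
apply: (mono_ind (graded_subspace gam_linear sV)) => s us.
have [d Ed d0] := gam_mono us.
by apply: (graded_eigen gam_linear _ d0 Ed); exact: subspace0 sV.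
Qed.

End Fock.

(** * The action of differential operators on the Fock space *)

Section FockRepresentation.
Variables (K : numFieldType) (F : vertexSuperalgebra K).
Variables (n : nat) (e : 'I_n -> F) (st : 'I_n -> 'I_n).
Hypothesis cl : clifford e st.
Local Notation psi i := (Y (e i)).
Local Notation Q := (quad e st).
Local Notation ind b := (GRing.natmul (1 : K) (nat_of_bool b)).
Implicit Types (f g : {poly K}) (k r s : int).

(** The second summand is the normally ordered form of [Q (k + b) (-1 - b)]; reversing the order of
    two fermions accounts for its sign. *)
Definition rterm k f (b : nat) (v : F) : F :=
  2%:R^-1 *: (f.[(-1 - b%:Z)%:~R] *: Q (k - 1 - b%:Z) b%:Z v
              - f.[b%:R] *: Q (-1 - b%:Z) (k + b%:Z) v).

(* The operator by which [t^k f(D)] acts; each pair [Q p q] with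
   [p + q = k - 1] occurs, in normal order, with coefficient [f(-1 - q) / 2]. *)
Definition rq k f : F -> F := lsum (rterm k f).

Lemma rterm_linear k f b : linear (rterm k f b).
Proof.
by apply: linear_scale; apply: linear_sub; apply: linear_scale; apply: quad_linear.
Qed.

Lemma rterm_bound k v : exists B, forall f, vanishes_from (rterm k f) v B.
Proof.
have [B HB] := quad_bound e st v; exists (B + `|k|)%N => f b Bb.
by rewrite /rterm !HB ?scaler0 ?subr0 ?scaler0 //; lia.
Qed.

Lemma rq_linear k f : linear (rq k f).
Proof.
apply: lsum_linear => [b|v]; first exact: rterm_linear.
by have [B HB] := rterm_bound k v; exists B.
Qed.

HB.instance Definition _ k f :=
  GRing.isLinear.Build K F F *:%R (rq k f) (rq_linear k f).

Lemma rq_lin_poly k (a : K) f g v :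
  rq k (a *: f + g) v = a *: rq k f v + rq k g v.
Proof.
have [B HB] := rterm_bound k v; rewrite /rq !(lsumE (HB _)).
rewrite scaler_sumr -big_split; apply: eq_bigr => b _ /=.
by rewrite /rterm !hornerE; lincomb K.
Qed.

Lemma rq0 k v : rq k 0 v = 0.
Proof. by have := rq_lin_poly k (-1) 0 0 v; rewrite scaler0 addr0 scaleN1r addNr. Qed.

Lemma rqN k f v : rq k (- f) v = - rq k f v.
Proof. by have := rq_lin_poly k (-1) f 0 v; rewrite rq0 !addr0 !scaleN1r. Qed.

Lemma sum_pick (B : nat) (c : int) : c < B%:Z ->
  \sum_(b < B) ind ((b : nat)%:Z == c) = ind (0 <= c).
Proof.
case: c => c cB; last by rewrite big1.
rewrite (bigD1 (Ordinal cB)) //= eqxx big1 ?addr0 // => b bc.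
by rewrite [_ == _ :> int](negPf bc).
Qed.

Lemma antisym_int k f (p q : int) : antisym k f -> p + q = - (k + 1) ->
  f.[p%:~R] = - f.[q%:~R].
Proof.
move=> af pq; rewrite -af; congr (f.[_]).
by rewrite -rmorphD -rmorphN; congr intmul; lia.
Qed.

Lemma rterm_e k f b j r v : antisym k f ->
  rterm k f b (psi j r v) = psi j r (rterm k f b v)
  + (2%:R^-1 * (ind (b%:Z == -1 - r) + ind (b%:Z == k + r)
                + ind (b%:Z == - 1 - k - r) + ind (b%:Z == r)))
    *: (f.[r%:~R] *: psi j (r + k) v).
Proof.
move=> af; rewrite /rterm !(quad_e cl) !YZ YB !YZ.
rewrite !(scalerBr, scalerDr).
have -> : f.[(-1 - b%:Z)%:~R] *: (if b%:Z + r == -1 then psi j (k - 1 - b%:Z) v else 0)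
    = ind (b%:Z == -1 - r) *: (f.[r%:~R] *: psi j (r + k) v).
  have -> : (b%:Z + r == -1) = (b%:Z == -1 - r) by lia.
  case: eqP => [->|_]; last by rewrite scale0r scaler0.
  by rewrite scale1r; congr (f.[_%:~R] *: psi j _ v); lia.
have -> : f.[(-1 - b%:Z)%:~R] *: (if k - 1 - b%:Z + r == -1 then psi j b%:Z v else 0)
    = - (ind (b%:Z == k + r) *: (f.[r%:~R] *: psi j (r + k) v)).
  have -> : (k - 1 - b%:Z + r == -1) = (b%:Z == k + r) by lia.
  case: eqP => [->|_]; last by rewrite scale0r scaler0 oppr0.
  rewrite scale1r -scaleNr (@antisym_int k _ _ r) //; last by lia.
  by congr (_ *: psi j _ v); lia.
have -> : f.[b%:R] *: (if k + b%:Z + r == -1 then psi j (-1 - b%:Z) v else 0)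
    = - (ind (b%:Z == -1 - k - r) *: (f.[r%:~R] *: psi j (r + k) v)).
  have -> : (k + b%:Z + r == -1) = (b%:Z == -1 - k - r) by lia.
  case: eqP => [bE|_]; last by rewrite scale0r scaler0 oppr0.
  rewrite scale1r -scaleNr -[b%:R]/(b%:Z%:~R) (@antisym_int k _ _ r) //; last by lia.
  by congr (_ *: psi j _ v); lia.
have -> : f.[b%:R] *: (if -1 - b%:Z + r == -1 then psi j (k + b%:Z) v else 0)
    = ind (b%:Z == r) *: (f.[r%:~R] *: psi j (r + k) v).
  have -> : (-1 - b%:Z + r == -1) = (b%:Z == r) by lia.
  case: eqP => [<-|_]; last by rewrite scale0r scaler0.
  by rewrite scale1r addrC.
lincomb K.
Qed.

(** The modes transform as the functions t^r do: t^k f(D) sends t^r to f(r) t^(r+k). *)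
Lemma rq_e k f j r v : antisym k f ->
  rq k f (psi j r v) = psi j r (rq k f v) + f.[r%:~R] *: psi j (r + k) v.
Proof.
move=> af; have [B1 H1] := rterm_bound k v.
have [B2 H2] := rterm_bound k (psi j r v).
pose B := (maxn (maxn B1 B2) (`|k| + `|r| + 1))%N.
have HB1 : vanishes_from (rterm k f) v B.
  by move=> b; rewrite !geq_max => /andP[/andP[/H1]].
have HB2 : vanishes_from (rterm k f) (psi j r v) B.
  by move=> b; rewrite !geq_max => /andP[/andP[_ /H2]].
have kr : (`|k| + `|r| + 1 <= B)%N by apply: leq_maxr.
rewrite /rq (lsumE HB1) (lsumE HB2).
under eq_bigr => b _ do rewrite rterm_e //.
rewrite big_split linear_sum /=; congr (_ + _).
rewrite -scaler_suml -mulr_sumr !big_split /= !sum_pick; [|lia..].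
(* The four contractions form two complementary pairs, so exactly two occur, cancelling the factor
   1/2 of [rterm]. *)
have -> : ind (0 <= -1 - r) + ind (0 <= k + r) + ind (0 <= -1 - k - r)
    + ind (0 <= r) = 2 :> K.
  have -> : (0 <= -1 - r) = ~~ (0 <= r) by lia.
  have -> : (0 <= -1 - k - r) = ~~ (0 <= k + r) by lia.
  by case: (0 <= r); case: (0 <= k + r); rewrite /=; ring.
by rewrite mulVf ?pnatr_eq0 // scale1r.
Qed.

Lemma rq_vac k f : 0 <= k -> rq k f (vac F) = 0.
Proof.
move=> k0; rewrite /rq (@lsumE _ _ _ _ _ 0) ?big_ord0 // => b _.
by rewrite /rterm !(quad_vac cl) ?scaler0 ?subr0 ?scaler0 //; lia.
Qed.

Definition Hop : F -> F := rq 0 ('X + (2%:R^-1)%:P).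

Lemma Hop_linear : linear Hop. Proof. exact: rq_linear. Qed.

Lemma Hop_vac : Hop (vac F) = 0. Proof. exact: rq_vac. Qed.

Lemma Hop_e j r v :
  Hop (psi j r v) = psi j r (Hop v) + (r%:~R + 2%:R^-1) *: psi j r v.
Proof. by rewrite /Hop rq_e ?addr0 ?hornerE //; apply: antisym_H0. Qed.

Lemma Hop_Q p q v :
  Hop (Q p q v) = Q p q (Hop v) + (p + q + 1)%:~R *: Q p q v.
Proof.
have h2 : (2 : K) != 0 by rewrite pnatr_eq0.
rewrite /quad (lin_sum Hop_linear) scaler_sumr -big_split /=.
apply: eq_bigr => i _; rewrite !Hop_e YD YZ -addrA -scalerDl.
by congr (_ + _ *: _); rewrite !rmorphD /=; field.
Qed.

(** The defect of the relation commutes with all modes, so it is a scalar; on the vacuum it vanishes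
    because [rq k f] is built from [Q p q] with p + q = k - 1. *)
Lemma Hop_rq k f v : antisym k f ->
  Hop (rq k f v) = rq k f (Hop v) + k%:~R *: rq k f v.
Proof.
move=> af; pose Z w := Hop (rq k f w) - rq k f (Hop w) - k%:~R *: rq k f w.
have ZL : linear Z.
  apply: linear_sub; last by apply: linear_scale; apply: rq_linear.
  by apply: linear_sub; apply: linear_comp; apply: rq_linear.
have [|c Zc] := commutant_scalar cl ZL.
  move=> i m w; rewrite /Z Hop_e rq_e // (linD Hop_linear) (linZ Hop_linear).
  rewrite !Hop_e (linD (rq_linear _ _)) (linZ (rq_linear _ _)) !rq_e // !YB !YZ.
  rewrite !rmorphD /=.
  lincomb K.
suff c0 : c = 0.
  have := Zc v; rewrite c0 scale0r => /eqP; rewrite subr_eq0 => /eqP <-.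
  by rewrite addrC subrK.
have sP : subspace (fun u => Hop u = k%:~R *: u).
  by apply: subspace_eq; [exact: rq_linear|exact/linear_scale/linear_id].
have HQ p q : p + q = k - 1 -> Hop (Q p q (vac F)) = k%:~R *: Q p q (vac F).
  move=> pq; rewrite Hop_Q Hop_vac linear0 add0r; congr (_%:~R *: _); lia.
have : Z (vac F) = 0.
  have [B HB] := rterm_bound k (vac F); rewrite /Z Hop_vac linear0 subr0.
  apply/eqP; rewrite subr_eq0; apply/eqP; rewrite /rq (lsumE (HB f)).
  apply: (subspace_sum sP) => b _; apply: (subspaceZ sP).
  by apply: (subspaceB sP); apply: (subspaceZ sP); apply: HQ; lia.
by rewrite Zc => /eqP; rewrite scaler_eq0 (negPf (cliff_vac_neq0 cl)) orbF => /eqP.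
Qed.


Lemma rq_vac_creation k f (r : nat) : k = - r%:Z ->
  rq k f (vac F) =
  - (2%:R^-1 *: \sum_(b < r) f.[b%:R] *: Q (-1 - b%:Z) (b%:Z - r%:Z) (vac F)).
Proof.
move=> ->; rewrite /rq (@lsumE _ _ _ _ _ r) => [|b rb]; last first.
  by rewrite /rterm !(quad_vac cl) ?scaler0 ?subr0 ?scaler0 //; lia.
rewrite scaler_sumr -sumrN; apply: eq_bigr => b _.
by rewrite /rterm (quad_vac cl) // scaler0 sub0r scalerN [in LHS](addrC (- r%:Z)).
Qed.

(** The origin of the cocycle: f can act only on the left factor of each created pair, since it
    turns the right one into an annihilator of the vacuum; contracting the result gives n f(-1-b)
    for the b-th pair. *)
Lemma rq_rq_vac (r : nat) f g : antisym r f -> antisym (- r%:Z) g ->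
  rq r f (rq (- r%:Z) g (vac F)) = (n%:R / 2%:R * psi_sum r f g) *: vac F.
Proof.
move=> af ag; have h2 : (2 : K) != 0 by rewrite pnatr_eq0.
rewrite (rq_vac_creation g (erefl _)) linearN linearZ linear_sum /=.
have E (b : 'I_r) : rq r f (g.[b%:R] *: Q (-1 - b%:Z) (b%:Z - r%:Z) (vac F)) =
    (g.[b%:R] * f.[(-1 - b%:Z)%:~R] * n%:R) *: vac F.
  have br := ltn_ord b.
  rewrite linearZ /= -!scalerA; congr (_ *: _).
  have [p0 q0] : 0 <= r%:Z - 1 - b%:Z /\ 0 <= b%:Z by lia.
  have -> : rq r f (Q (-1 - b%:Z) (b%:Z - r%:Z) (vac F)) =
      f.[(-1 - b%:Z)%:~R] *: Q (r%:Z - 1 - b%:Z) (b%:Z - r%:Z) (vac F).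
    rewrite /quad [LHS]linear_sum scaler_sumr; apply: eq_bigr => i _ /=.
    rewrite !rq_e // rq_vac // Y0 add0r YZ.
    rewrite (_ : b%:Z - r%:Z + r%:Z = b%:Z); last by lia.
    rewrite (cliff_kill cl) // Y0 scaler0 add0r.
    by congr (_ *: psi i _ _); lia.
  rewrite (quad_swap cl) (quad_vac cl _ p0) subr0.
  by rewrite ifT //; lia.
under eq_bigr => b _ do rewrite E.
rewrite -scaler_suml scalerA -scaleNr; congr (_ *: _).
rewrite /psi_sum big_add1 big_mkord /= !mulr_sumr -sumrN.
apply: eq_bigr => b _.
have -> : g.[r%:R - b.+1%:R] = - g.[b%:R].
  rewrite -[_ - _]/(r%:Z%:~R - (b.+1)%:Z%:~R) -rmorphB /=.
  by apply: (@antisym_int _ g _ b%:Z ag); lia.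
have -> : - b.+1%:R = (-1 - b%:Z)%:~R :> K.
  by rewrite rmorphB rmorphN /= -addn1 natrD opprD addrC.
by field.
Qed.

(** The commutator minus its expected operator part commutes with every mode, by the Jacobi
    computation on modes, so only its value on the vacuum is to be found. *)
Lemma rq_bracket r s f g v : antisym r f -> antisym s g ->
  rq r f (rq s g v) - rq s g (rq r f v) =
  rq (r + s) (bracket_poly r s f g) v + (n%:R / 2%:R * Psi_hom r s f g) *: v.
Proof.
pose Z r s f g w := rq r f (rq s g w) - rq s g (rq r f w)
  - rq (r + s) (bracket_poly r s f g) w.
have ZL r' s' f' g' : linear (Z r' s' f' g').
  by apply: linear_sub; [apply: linear_sub; apply: linear_comp|];
    apply: rq_linear.
have Zc r' s' f' g' : antisym r' f' -> antisym s' g' ->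
    exists c, forall w, Z r' s' f' g' w = c *: w.
  move=> af ag; apply: (commutant_scalar cl) => // i m w.
  rewrite /Z !rq_e //; last exact: antisym_bracket.
  rewrite !(linD (rq_linear _ _)) !(linZ (rq_linear _ _)) !rq_e // !YB.
  rewrite bracket_polyE !rmorphD /=.
  have -> : m + s' + r' = m + r' + s' by lia.
  have -> : m + (r' + s') = m + r' + s' by lia.
  lincomb K.
(* A scalar multiple of the vacuum has weight 0 under [Hop], while Z shifts the weight by r' +
   s'. *)
have Zoff r' s' f' g' : antisym r' f' -> antisym s' g' -> r' + s' != 0 ->
    Z r' s' f' g' (vac F) = (n%:R / 2%:R * Psi_hom r' s' f' g') *: vac F.
  move=> af ag rs; rewrite /Psi_hom (negPf rs) mulr0 scale0r.
  have [c cE] := Zc r' s' f' g' af ag.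
  have : Hop (Z r' s' f' g' (vac F)) = (r' + s')%:~R *: Z r' s' f' g' (vac F).
    rewrite /Z !(linB Hop_linear) !Hop_rq //; last exact: antisym_bracket.
    rewrite Hop_vac !linear0 add0r !(linD (rq_linear _ _)) !(linZ (rq_linear _ _)).
    rewrite !linear0 !rmorphD /=; lincomb K.
  rewrite cE (linZ Hop_linear) Hop_vac scaler0 => /esym/eqP.
  by rewrite scaler_eq0 intr_eq0 (negPf rs) => /eqP.
have Znonneg r' s' f' g' : antisym r' f' -> antisym s' g' -> 0 <= r' ->
    Z r' s' f' g' (vac F) = (n%:R / 2%:R * Psi_hom r' s' f' g') *: vac F.
  move=> af ag r0; have [rs|] := eqVneq (r' + s') 0; last exact: Zoff.
  case: r' r0 => // r' _ in af rs *.
  have s'E : s' = - r'%:Z by lia.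
  rewrite s'E in ag *; rewrite /Z subrr rq_rq_vac // !rq_vac // linear0 !subr0.
  by rewrite /Psi_hom subrr eqxx.
have Zvac r' s' f' g' : antisym r' f' -> antisym s' g' ->
    Z r' s' f' g' (vac F) = (n%:R / 2%:R * Psi_hom r' s' f' g') *: vac F.
  move=> af ag; have [r0|r0] := leP 0 r'; first exact: Znonneg.
  have [rs|] := eqVneq (r' + s') 0; last exact: Zoff.
  have s0 : 0 <= s' by lia.
  (* Antisymmetry reduces a negative first degree to the nonnegative case. *)
  have -> : Z r' s' f' g' (vac F) = - Z s' r' g' f' (vac F).
    have Ea : s' + r' = r' + s' by lia.
    rewrite /Z Ea -[bracket_poly s' r' g' f']opprK rqN.
    have -> : - bracket_poly s' r' g' f' = bracket_poly r' s' f' g'.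
      by rewrite /bracket_poly opprB mulrC [X in _ - X]mulrC.
    lincomb K.
  rewrite (Znonneg s' r' g' f') // -scaleNr -mulrN; congr (_ * _ *: _).
  by rewrite /Psi_hom addrC rs eqxx s0 leNgt r0.
move=> af ag; have [c cE] := Zc r s f g af ag.
have := cE (vac F); rewrite Zvac // => /eqP; rewrite -subr_eq0 -scalerBl.
rewrite scaler_eq0 (negPf (cliff_vac_neq0 cl)) orbF subr_eq0 => /eqP ->.
by rewrite -cE /Z [RHS]addrC subrK.
Qed.

Definition rhoF (X : Dhat K) (v : F) : F :=
  (n%:R / 2%:R * (X.2 : K)) *: v + \sum_(k <- msupp X.1) rq k X.1@_k v.

Lemma rhoF_superset (X : Dhat K) (d : {fset int}) v : (msupp X.1 `<=` d)%fset ->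
  rhoF X v = (n%:R / 2%:R * (X.2 : K)) *: v + \sum_(k <- d) rq k X.1@_k v.
Proof.
move=> Xd; congr (_ + _); apply: big_fset_incl => // k _.
by move=> /mcoeff_outdom->; rewrite rq0.
Qed.

Lemma rhoF_tmon k f (a : K) v :
  rhoF (tmon k f, a) v = (n%:R / 2%:R * a) *: v + rq k f v.
Proof.
rewrite (@rhoF_superset _ [fset k]%fset) /= ?msuppU; last first.
  by case: ifP => _; rewrite ?fsub0set.
by rewrite big_seq_fset1 tmonE eqxx.
Qed.

Lemma rhoF_Cc v : rhoF Cc v = (n%:R / 2%:R) *: v.
Proof.
by rewrite /rhoF /= msupp0 big_nil addr0 mulr1.
Qed.

Lemma rhoF_linear X : linear (rhoF X).
Proof.
apply: linear_add; first exact/linear_scale/linear_id.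
by apply: linear_big => k; apply: rq_linear.
Qed.

Lemma rhoF_linearl (a : K) X X' v :
  rhoF (a *: X + X') v = a *: rhoF X v + rhoF X' v.
Proof.
set d := (msupp X.1 `|` msupp X'.1 `|` msupp (a *: X + X')%R.1)%fset.
have dX : (msupp X.1 `<=` d)%fset by rewrite /d -fsetUA fsubsetUl.
have dX' : (msupp X'.1 `<=` d)%fset.
  by rewrite /d -fsetUA fsetUCA fsubsetUl.
rewrite (rhoF_superset _ dX) (rhoF_superset _ dX') (@rhoF_superset _ d); last first.
  exact: fsubsetUr.
pose S (Z : Dhat K) := \sum_(k <- d) rq k Z.1@_k v.
rewrite -/(S X) -/(S X') -/(S (a *: X + X')).
have -> : S (a *: X + X') = a *: S X + S X'.
  rewrite /S scaler_sumr -big_split; apply: eq_bigr => k _ /=.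
  by rewrite mcoeffD mcoeff_dopZ rq_lin_poly.
have -> : (a *: X + X').2 = a * (X.2 : K) + (X'.2 : K) :> K by [].
lincomb K.
Qed.

Lemma rhoF_sum (I : Type) (r : seq I) (A : I -> Dhat K) v :
  rhoF (\sum_(i <- r) A i) v = \sum_(i <- r) rhoF (A i) v.
Proof.
apply: (lin_sum (f := fun X => rhoF X v)) => a X X'.
exact: rhoF_linearl.
Qed.

Lemma rhoF_rep : Dplus_rep rhoF.
Proof.
split=> [X _|a X Y v _ _|X Y v /DplusP pX /DplusP pY].
- exact: rhoF_linear.
- exact: rhoF_linearl.
rewrite Dbracket_sum rhoF_sum.
under eq_bigr => r _ do rewrite rhoF_sum.
under eq_bigr => r _ do under eq_bigr => s _ do
  rewrite rhoF_tmon addrC -rq_bracket //.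
rewrite /rhoF; set x := (n%:R / _ * (X.2 : K)); set y := (n%:R / _ * (Y.2 : K)).
set SX := fun w => \sum_(k <- msupp X.1) rq k X.1@_k w.
set SY := fun w => \sum_(k <- msupp Y.1) rq k Y.1@_k w.
have SXL : linear SX by apply: linear_big => k; apply: rq_linear.
have SYL : linear SY by apply: linear_big => k; apply: rq_linear.
rewrite -/(SX v) -/(SY v) -/(SX (y *: v + SY v)) -/(SY (x *: v + SX v)).
rewrite (linD SXL) (linZ SXL) (linD SYL) (linZ SYL).
have -> : \sum_(r <- msupp X.1) \sum_(s <- msupp Y.1)
    (rq r X.1@_r (rq s Y.1@_s v) - rq s Y.1@_s (rq r X.1@_r v)) =
    SX (SY v) - SY (SX v).
  under eq_bigr => r _ do rewrite sumrB.
  rewrite sumrB /SX /SY; congr (_ - _).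
    by apply: eq_bigr => r _; rewrite linear_sum.
  by rewrite exchange_big; apply: eq_bigr => s _; rewrite linear_sum.
lincomb K.
Qed.

Lemma rhoF_stable (P : F -> Prop) : subspace P ->
  (forall k f v, antisym k f -> P v -> P (rq k f v)) -> stable rhoF P.
Proof.
move=> sP Prq; apply: rep_ind_stable => //; first exact: rhoF_rep.
  by move=> v Pv; rewrite rhoF_Cc; apply: (subspaceZ sP).
move=> k f v af Pv; rewrite rhoF_tmon mulr0 scale0r add0r; exact: Prq.
Qed.

Lemma rhoF_quad_stable (P : F -> Prop) : subspace P ->
  (forall p q v, P v -> P (Q p q v)) -> stable rhoF P.
Proof.
move=> sP PQ; apply: rhoF_stable => // k f v _ Pv.
have [B HB] := rterm_bound k v; rewrite /rq (lsumE (HB f)).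
apply: (subspace_sum sP) => b _; apply: (subspaceZ sP).
by apply: (subspaceB sP); apply: (subspaceZ sP); apply: PQ.
Qed.

Lemma rhoF_parity p : stable rhoF (@parity _ F p).
Proof.
apply: rhoF_quad_stable; first exact: parity_subspace.
move=> q r v pv; apply: (subspace_sum (@parity_subspace _ F p)) => i _.
have := Y_parity q (cliff_odd cl i) (Y_parity r (cliff_odd cl (st i)) pv).
by case: p {pv}.
Qed.

(* Interpolation: on a given vector only finitely many [Q p q] with given
   [p + q] act nontrivially, so an odd polynomial isolates one of them. *)
Lemma stable_quad (P : F -> Prop) p q v : subspace P -> stable rhoF P -> p < q ->
  P v -> P (Q p q v).
Proof.
move=> sP rP pq Pv; pose k := p + q + 1.
have [B0 HB0] := rterm_bound k v.
pose B := (B0 + `|p| + `|q| + 1)%N.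
have HB f : vanishes_from (rterm k f) v B.
  by move=> b Bb; apply: HB0; apply: leq_trans Bb; rewrite /B; lia.
pose pts := [seq (i%:Z - B%:Z) | i <- iota 0 (2 * B)].
pose bad := [seq y <- pts | (y != -1 - q) && (y != -1 - p)].
(* The linear factor is antisymmetric, and each root y is accompanied by its reflection -(k+1+y) so
   that the product is symmetric. Within the window [-B, B) only -1-q and its reflection -1-p are
   spared. *)
pose h : {poly K} := (2%:R *: 'X + ((k + 1)%:~R)%:P) *
  \prod_(y <- bad) (('X - (y%:~R)%:P) * ('X + ((k + 1 + y)%:~R)%:P)).
have hE z : h.[z] = (2%:R * z + (k + 1)%:~R) *
    \prod_(y <- bad) ((z - y%:~R) * (z + (k + 1 + y)%:~R)).
  rewrite /h !hornerE horner_prod; congr (_ * _).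
  by apply: eq_bigr => y _; rewrite !hornerE.
have ah : antisym k h.
  move=> z; rewrite !hE -mulNr; congr (_ * _); first by ring.
  apply: eq_bigr => y _; rewrite !rmorphD /=; ring.
have h_bad y : (- B%:Z <= y < B%:Z) -> y != -1 - q -> y != -1 - p ->
    h.[y%:~R] = 0.
  move=> yB yq yp; rewrite hE (_ : \prod_(_ <- _) _ = 0) ?mulr0 //.
  apply/eqP; rewrite prodf_seq_eq0; apply/hasP; exists y; last first.
    by rewrite /= subrr mul0r.
  rewrite mem_filter yq yp /=; apply/mapP; exists `|(y + B%:Z)%R|%N.
    by rewrite mem_iota; lia.
  by lia.
set c := h.[(-1 - q)%:~R].
(* At -1-q the linear factor equals p - q, which is where p < q enters. *)
have c_neq0 : c != 0.
  rewrite /c hE mulf_neq0 //.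
    have -> : 2%:R * (-1 - q)%:~R + (k + 1)%:~R = (p - q)%:~R :> K.
      by rewrite /k !rmorphD /=; ring.
    by rewrite intr_eq0; lia.
  rewrite prodf_seq_eq0; apply/hasPn => y; rewrite mem_filter => /andP[/andP[yq yp] _].
  rewrite -rmorphB -rmorphD /= -rmorphM /= intr_eq0 mulf_neq0 //; first by lia.
  by rewrite /k; lia.
have cp : h.[(-1 - p)%:~R] = - c.
  by apply: antisym_int ah _; rewrite /k; lia.
have bnd b : (b < B)%N -> - B%:Z <= -1 - b%:Z < B%:Z /\ - B%:Z <= b%:Z < B%:Z.
  by lia.
(* As p < q, a reversal is only called for when p and q are both nonnegative or both negative; then
   p + q is not -1 and no central term arises. *)
have swap : p + q != -1 -> Q q p v = - Q p q v.
  by move=> pq1; rewrite (quad_swap cl) ifF ?scale0r ?sub0r //; lia.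
have E (b : 'I_B) : rterm k h b v =
    (2%:R^-1 * (ind (b%:Z == q) + ind (b%:Z == p) + ind (b%:Z == -1 - q)
                + ind (b%:Z == -1 - p))) *: (c *: Q p q v).
  have [b1 b2] := bnd b (ltn_ord b); rewrite /rterm -scalerA; congr (_ *: _).
  have -> : h.[(-1 - b%:Z)%:~R] *: Q (k - 1 - b%:Z) b%:Z v =
      (ind (b%:Z == q) + ind (b%:Z == p)) *: (c *: Q p q v).
    have [bq|bq] := eqVneq b%:Z q.
      have -> : (b%:Z == p) = false by lia.
      rewrite addr0 scale1r bq -/c; congr (_ *: Q _ _ _).
      by rewrite /k; lia.
    have [bp|bp] := eqVneq b%:Z p; last first.
      by rewrite h_bad ?addr0 ?scale0r //; lia.
    have -> : k - 1 - b%:Z = q by rewrite /k; lia.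
    rewrite bp cp swap ?add0r ?scale1r; last by lia.
    lincomb K.
  have -> : h.[b%:R] *: Q (-1 - b%:Z) (k + b%:Z) v =
      - ((ind (b%:Z == -1 - q) + ind (b%:Z == -1 - p)) *: (c *: Q p q v)).
    rewrite -[b%:R]/(b%:Z%:~R).
    have [bq|bq] := eqVneq b%:Z (-1 - q).
      have -> : (b%:Z == -1 - p) = false by lia.
      have -> : -1 - b%:Z = q by lia.
      have -> : k + b%:Z = p by rewrite /k; lia.
      rewrite bq -/c swap ?addr0 ?scale1r; last by lia.
      lincomb K.
    have [bp|bp] := eqVneq b%:Z (-1 - p); last first.
      by rewrite h_bad ?addr0 ?scale0r ?oppr0.
    have -> : -1 - b%:Z = p by lia.
    have -> : k + b%:Z = q by rewrite /k; lia.
    rewrite bp cp add0r scale1r; lincomb K.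
  lincomb K.
have rqE : rq k h v = c *: Q p q v.
  rewrite /rq (lsumE (HB h)).
  under eq_bigr => b _ do rewrite E.
  rewrite -scaler_suml -mulr_sumr !big_split /= !sum_pick; [|rewrite /B; lia..].
  have -> : ind (0 <= q) + ind (0 <= p) + ind (0 <= -1 - q) + ind (0 <= -1 - p) = 2.
    have -> : (0 <= -1 - p) = ~~ (0 <= p) by lia.
    have -> : (0 <= -1 - q) = ~~ (0 <= q) by lia.
    by case: (0 <= p); case: (0 <= q); rewrite /=; ring.
  by rewrite mulVf ?pnatr_eq0 // scale1r.
have : P (rhoF (tmon k h, 0) v) by apply: rP => //; apply: Dplus_tmon.
rewrite rhoF_tmon mulr0 scale0r add0r rqE => /(subspaceZ sP c^-1).
by rewrite scalerA mulVf // scale1r.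
Qed.

End FockRepresentation.

(** * The Casimir identity *)

Section Casimir.
Variables (K : numFieldType) (F : vertexSuperalgebra K).
Variables (n : nat) (e : 'I_n -> F) (st : 'I_n -> 'I_n).
Hypothesis cl : clifford e st.
Local Notation psi i := (Y (e i)).
Local Notation Q := (quad e st).
Local Notation rhoF := (rhoF e st).
Local Notation ind b := (GRing.natmul (1 : K) (nat_of_bool b)).

Definition Jterm i j (b : nat) (v : F) : F :=
  psi i (-1 - b%:Z) (psi j b%:Z v) - psi j (-1 - b%:Z) (psi i b%:Z v).

(* The zero mode of the current [e_i e_j], generating the action of so(n). *)
Definition Jop i j : F -> F := lsum (Jterm i j).

Lemma Jterm_linear i j b : linear (Jterm i j b).
Proof. by apply: linear_sub; apply: linear_comp; apply: Y_linear. Qed.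

Lemma Jterm_bound v : exists B, forall i j, vanishes_from (Jterm i j) v B.
Proof.
have [B HB] := field_bound e v; exists B => i j b Bb.
by rewrite /Jterm !HB ?Y0 ?subr0 ?lez_nat.
Qed.

Lemma Jop_linear i j : linear (Jop i j).
Proof.
apply: lsum_linear => [b|v]; first exact: Jterm_linear.
by have [B HB] := Jterm_bound v; exists B.
Qed.

Lemma Jop_vac i j : Jop i j (vac F) = 0.
Proof.
rewrite /Jop (@lsumE _ _ _ _ _ 0) ?big_ord0 // => b _.
by rewrite /Jterm !(cliff_kill cl) // !Y0 subr0.
Qed.

Lemma Jterm_e i j b k r v :
  Jterm i j b (psi k r v) = psi k r (Jterm i j b v)
  + (ind (b%:Z == -1 - r) + ind (b%:Z == r)) *:
     (ind (k == st j) *: psi i r v - ind (k == st i) *: psi j r v).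
Proof.
rewrite /Jterm; have E i' j' : psi i' (-1 - b%:Z) (psi j' b%:Z (psi k r v)) =
    psi k r (psi i' (-1 - b%:Z) (psi j' b%:Z v))
    + ind (b%:Z == -1 - r) *: (ind (k == st j') *: psi i' r v)
    - ind (b%:Z == r) *: (ind (k == st i') *: psi j' r v).
  rewrite (CAR cl j' k) YB YZ (CAR cl i' k).
  have -> : (b%:Z + r == -1) = (b%:Z == -1 - r) by lia.
  have -> : (-1 - b%:Z + r == -1) = (b%:Z == r) by lia.
  have [b1|_] := eqVneq b%:Z (-1 - r); have [b2|_] := eqVneq b%:Z r.
  - by lia.
  - by rewrite b1 (_ : -1 - (-1 - r) = r) ?scale1r ?scale0r; [lincomb K|lia].
  - by rewrite b2; lincomb K.
  - by lincomb K.
rewrite !E YB; lincomb K.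
Qed.

(** For each r exactly one of r and -1-r is a level b >= 0, so creation and annihilation modes
    transform by the same matrix of so(n). *)
Lemma Jop_e i j k r v : Jop i j (psi k r v) = psi k r (Jop i j v)
  + (ind (k == st j) *: psi i r v - ind (k == st i) *: psi j r v).
Proof.
have [B1 H1] := Jterm_bound v; have [B2 H2] := Jterm_bound (psi k r v).
pose B := (maxn (maxn B1 B2) (`|r| + 1))%N.
rewrite /Jop (@lsumE _ _ _ _ v B) => [|b]; last first.
  by rewrite !geq_max => /andP[/andP[/H1]].
rewrite (@lsumE _ _ _ _ _ B) => [|b]; last first.
  by rewrite !geq_max => /andP[/andP[_ /H2]].
have rB : (`|r| + 1 <= B)%N by apply: leq_maxr.
under eq_bigr => b _ do rewrite Jterm_e.
rewrite big_split linear_sum /=; congr (_ + _).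
rewrite -scaler_suml big_split /= !sum_pick; [|lia..].
have -> : (0 <= -1 - r) = ~~ (0 <= r) by lia.
by case: (0 <= r); rewrite ?addr0 ?add0r scale1r.
Qed.

Definition so_inv (v : F) : Prop := forall i j, Jop i j v = 0.

Lemma so_inv_subspace : subspace so_inv.
Proof.
apply: subspace_forall => i; apply: subspace_forall => j.
by apply: subspace_eq; [exact: Jop_linear|exact: linear_zero].
Qed.

Lemma sum_ind a (G : 'I_n -> F) : \sum_k ind (k == a) *: G k = G a.
Proof.
rewrite (bigD1 a) //= eqxx scale1r big1 ?addr0 // => k /negPf->.
by rewrite scale0r.
Qed.

(** The invariance of the form: the four correction terms cancel in pairs once summed over dual
    bases. *)
Lemma Jop_quad i j p q v : Jop i j (Q p q v) = Q p q (Jop i j v).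
Proof.
rewrite /quad (lin_sum (Jop_linear i j)).
have E k : Jop i j (psi k p (psi (st k) q v)) = psi k p (psi (st k) q (Jop i j v))
    + (ind (k == j) *: psi k p (psi i q v) - ind (k == i) *: psi k p (psi j q v)
       + ind (k == st j) *: psi i p (psi (st k) q v)
       - ind (k == st i) *: psi j p (psi (st k) q v)).
  rewrite !Jop_e YD YB !YZ !(inj_eq (inv_inj (cliff_inv cl))); lincomb K.
under eq_bigr => k _ do rewrite E.
rewrite big_split sumrB big_split sumrB /= !sum_ind !(cliff_inv cl).
rewrite -[RHS]addr0; congr (_ + _); lincomb K.
Qed.

Lemma so_inv_quad p q v : so_inv v -> so_inv (Q p q v).
Proof. by move=> Jv i j; rewrite Jop_quad Jv linear0. Qed.

Lemma so_inv_stable : stable rhoF so_inv.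
Proof.
apply: (rhoF_quad_stable cl); first exact: so_inv_subspace.
exact: so_inv_quad.
Qed.

(* Expanding [0 = \sum_i \sum_j e_i(-1) e_j(0) J v], where [J] is [Jop (st j)
   (st i)], expresses the diagonal operator [gam] on so(n)-invariants as a sum
   of products of a raising operator followed by a lowering one. *)
Lemma casimir v : so_inv v -> exists B, gam e st v =
  \sum_(b < B) (ind (b != 0 :> nat) *: Q (-1 - b%:Z) 0 (Q (-1) b%:Z v)
                - Q (-1) (-1 - b%:Z) (Q 0 b%:Z v)).
Proof.
move=> Jv; have [B1 H1] := Jterm_bound v.
have [B2 H2] := numop_bound e st (fun b => (b != 0%N)%:R) v.
pose B := (maxn B1 B2).+1; exists B.
have HJ i j : vanishes_from (Jterm i j) v B.
  by move=> b /ltnW; rewrite geq_max => /andP[/H1].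
rewrite /gam /numop (@lsumE _ _ _ _ v B) => [|b]; last first.
  by move=> /ltnW; rewrite geq_max => /andP[_ /H2].
(* In the first half of [Jterm] the sum over j closes up to [Q 0 (-1 - b)], which is then moved past
   the creation mode of [e i]. The term n N_0 is the contraction at b = 0. *)
have t1 (b : nat) : \sum_i \sum_j
    psi i (-1) (psi j 0 (psi (st j) (-1 - b%:Z) (psi (st i) b%:Z v))) =
    if b == 0%N then n%:R *: Q (-1) 0 v - Q (-1) 0 (Q (-1) 0 v) + Q (-1) 0 v
    else Q (-1 - b%:Z) b%:Z v - Q (-1 - b%:Z) 0 (Q (-1) b%:Z v).
  transitivity (\sum_i psi i (-1) (Q 0 (-1 - b%:Z) (psi (st i) b%:Z v))).
    by apply: eq_bigr => i _; rewrite /quad linear_sum.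
  case: (eqVneq b 0%N) => [->|b0].
    rewrite -[0%N%:Z]/(0 : int) subr0.
    have E i : psi i (-1) (Q 0 (-1) (psi (st i) 0 v)) =
        n%:R *: psi i (-1) (psi (st i) 0 v) - psi i (-1) (psi (st i) 0 (Q (-1) 0 v))
        + psi i (-1) (psi (st i) 0 v).
      rewrite (quad_swap cl) (quad_e cl) !add0r ?addr0 eqxx /= !(YD, YB, YN, YZ).
      lincomb K.
    under eq_bigr => i _ do rewrite E.
    by rewrite big_split sumrB /= -scaler_sumr.
  have E i : psi i (-1) (Q 0 (-1 - b%:Z) (psi (st i) b%:Z v)) =
      psi i (-1 - b%:Z) (psi (st i) b%:Z v)
      - Q (-1 - b%:Z) 0 (psi i (-1) (psi (st i) b%:Z v)).
    rewrite (quad_swap cl) (quad_e cl _ _ i (-1)).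
    have -> : (0 + (-1 - b%:Z) == -1) = false by lia.
    have -> : (-1 - b%:Z + -1 == -1) = false by lia.
    rewrite /= scale0r sub0r YN; lincomb K.
  under eq_bigr => i _ do rewrite E.
  by rewrite sumrB -(lin_sum (quad_linear _ _ _ _)).
(* In the second half the two inner operators are exchanged instead. Their contraction at b = 0 is a
   copy of N_0 that cancels the extra one of [t1]. *)
have t2 (b : nat) : \sum_i \sum_j
    psi i (-1) (psi j 0 (psi (st i) (-1 - b%:Z) (psi (st j) b%:Z v))) =
    ind (b == 0%N) *: Q (-1) 0 v - Q (-1) (-1 - b%:Z) (Q 0 b%:Z v).
  have E i j : psi i (-1) (psi j 0 (psi (st i) (-1 - b%:Z) (psi (st j) b%:Z v))) =
      (if b == 0%N then ind (i == j) *: psi i (-1) (psi (st j) 0 v) else 0)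
      - psi i (-1) (psi (st i) (-1 - b%:Z) (psi j 0 (psi (st j) b%:Z v))).
    rewrite (CAR cl j (st i)) YB YZ; congr (_ - _).
    rewrite (inj_eq (inv_inj (cliff_inv cl))).
    have -> : (0 + (-1 - b%:Z) == -1) = (b == 0%N) by lia.
    by case: eqP => [->|_]; rewrite ?scale0r.
  under eq_bigr => i _ do under eq_bigr => j _ do rewrite E.
  under eq_bigr => i _ do rewrite sumrB.
  rewrite sumrB; congr (_ - _).
    case: eqP => [b0|_]; last by rewrite scale0r big1 // => i _; rewrite big1.
    rewrite scale1r; apply: eq_bigr => i _.
    rewrite (bigD1 i) //= eqxx scale1r big1 ?addr0 // => j.
    by rewrite eq_sym => /negPf->; rewrite scale0r.
  rewrite /quad; apply: eq_bigr => i _; rewrite !linear_sum /=.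
  by [].
have : \sum_i \sum_j psi i (-1) (psi j 0 (Jop (st j) (st i) v)) = 0.
  by apply: big1 => i _; apply: big1 => j _; rewrite Jv !Y0.
have -> : \sum_i \sum_j psi i (-1) (psi j 0 (Jop (st j) (st i) v)) =
  \sum_(b < B)
   (\sum_i \sum_j
      psi i (-1) (psi j 0 (psi (st j) (-1 - b%:Z) (psi (st i) b%:Z v)))
    - \sum_i \sum_j
      psi i (-1) (psi j 0 (psi (st i) (-1 - b%:Z) (psi (st j) b%:Z v)))).
  have E i j : psi i (-1) (psi j 0 (Jop (st j) (st i) v)) = \sum_(b < B)
      (psi i (-1) (psi j 0 (psi (st j) (-1 - b%:Z) (psi (st i) b%:Z v)))
      - psi i (-1) (psi j 0 (psi (st i) (-1 - b%:Z) (psi (st j) b%:Z v)))).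
    rewrite /Jop (lsumE (HJ _ _)) !linear_sum /=; apply: eq_bigr => b _.
    by rewrite /Jterm !YB.
  under eq_bigr => i _ do under eq_bigr => j _ do rewrite E.
  under eq_bigr => i _ do rewrite exchange_big /=.
  rewrite exchange_big /=; apply: eq_bigr => b _.
  under eq_bigr => i _ do rewrite sumrB.
  by rewrite sumrB.
under eq_bigr => b _ do rewrite t1 t2.
(* The only off-diagonal term left at b = 0 is a multiple of [Q 0 0], which is its own negative. *)
have Q00 : Q 0 0 v = 0.
  have := quad_swap cl 0 0 v; rewrite /= scale0r sub0r => /eqP.
  by rewrite -addr_eq0 -mulr2n -scaler_nat scaler_eq0 pnatr_eq0 => /eqP.
rewrite !big_ord_recl -![ord0 == 0%N :> nat]/true /=.
rewrite -[0%N%:Z]/(0 : int) Q00 linear0.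
pose N b := Q (-1 - b%:Z) b%:Z v.
pose R b := Q (-1 - b%:Z) 0 (Q (-1) b%:Z v).
pose L b := Q (-1) (-1 - b%:Z) (Q 0 b%:Z v).
pose S (G : nat -> F) := \sum_(i < maxn B1 B2) G (bump 0 i).
have -> : \sum_(i < maxn B1 B2) (N (bump 0 i) - R (bump 0 i)
    - (0%:R *: Q (-1) 0 v - L (bump 0 i))) = S N - S R + S L.
  rewrite /S -sumrB -big_split; apply: eq_bigr => i _ /=; lincomb K.
have -> : \sum_(i < maxn B1 B2) (1%:R *: N (bump 0 i)) = S N.
  by apply: eq_bigr => i _; rewrite scale1r.
have -> : \sum_(i < maxn B1 B2) (1%:R *: R (bump 0 i) - L (bump 0 i)) = S R - S L.
  by rewrite /S -sumrB; apply: eq_bigr => i _; rewrite scale1r.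
move=> E0; apply: subr0_eq; rewrite -[RHS]E0; lincomb K.
Qed.

(* Twice the energy, so that its eigenvalues are natural numbers. *)
Definition energy (v : F) : F := (- 2%:R) *: Hop e st v.

Lemma energy_linear : linear energy.
Proof. by apply: linear_scale; apply: Hop_linear. Qed.

Lemma energy_mono s : energy (mono e s) = (\sum_(x <- s) x.2.*2.+1)%:R *: mono e s.
Proof.
have h2 : (2 : K) != 0 by rewrite pnatr_eq0.
elim: s => [|x s IH]; first by rewrite /energy (Hop_vac cl) scaler0 big_nil scale0r.
rewrite big_cons natrD scalerDl.
have -> : energy (mono e (x :: s)) = psi x.1 (-1 - x.2%:Z) (energy (mono e s))
    + (x.2.*2.+1)%:R *: mono e (x :: s).
  rewrite /energy /= (Hop_e cl) scalerDr YZ scalerA; congr (_ + _ *: _).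
  have -> : (x.2.*2.+1)%:R = x.2%:R * 2%:R + 1 :> K.
    by rewrite -addn1 natrD -muln2 natrM.
  by rewrite rmorphB rmorphN /= -pmulrn; field.
by rewrite IH YZ addrC.
Qed.

Lemma energy_graded v : graded energy (fun=> True) v.
Proof.
move: v; apply: (mono_ind cl) => [|s us].
  by apply: graded_subspace => //; exact: energy_linear.
by apply: (graded_eigen energy_linear _ _ (energy_mono s)).
Qed.

Lemma energy_component P v : subspace P -> (forall u, P u -> P (energy u)) ->
  P v -> exists D (w : nat -> F), [/\ forall d, P (w d),
    forall d, energy (w d) = d%:R *: w d & v = \sum_(d < D) w d].
Proof.
move=> sP PE Pv; have [D [w [_ Ew w0 vE]]] := energy_graded v.
exists D, w; split=> // d; have [dD|dD] := ltnP d D; last first.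
  by rewrite w0 //; apply: (subspace0 sP).
by apply: (eigen_component energy_linear sP PE) dD; rewrite -?vE.
Qed.

Lemma energy_ge0 (d : int) v : d < 0 -> energy v = d%:~R *: v -> v = 0.
Proof.
move=> d0 Ev; have sP : subspace (fun u => energy u = d%:~R *: u).
  by apply: subspace_eq; [exact: energy_linear|exact/linear_scale/linear_id].
have [|D [w [Pw Ew ->]]] := energy_component sP _ Ev.
  by move=> u Eu; rewrite Eu (linZ energy_linear) Eu.
apply: big1 => i _; have := Pw i; rewrite Ew => /eqP.
rewrite -subr_eq0 -scalerBl scaler_eq0 pmulrn -rmorphB intr_eq0 => /orP[|/eqP//].
by case: i => /= *; lia.
Qed.

Lemma energy_quad (d : int) p q v : energy v = d%:~R *: v ->
  energy (Q p q v) = (d - 2%:Z * (p + q + 1))%:~R *: Q p q v.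
Proof.
move=> Ev; have -> : energy (Q p q v) = Q p q (energy v)
    - (2%:Z * (p + q + 1))%:~R *: Q p q v.
  rewrite /energy (Hop_Q cl) scalerDr -linearZ scalerA rmorphM /=.
  by congr (_ + _); rewrite mulNr scaleNr.
by rewrite Ev linearZ -scalerBl -rmorphB.
Qed.

Lemma gam_closed P v : subspace P ->
  (forall b u, P u -> P (Q (-1 - b%:Z) b%:Z u)) -> P v -> P (gam e st v).
Proof.
move=> sP PQ Pv; rewrite /gam; have P0 u : P u -> P (Q (-1) 0 u).
  by move/(PQ 0%N); rewrite subr0.
apply: (subspaceD sP).
  apply: (subspaceB sP); first exact/(subspaceZ sP)/P0.
  exact/P0/P0.
have [B HB] := numop_bound e st (fun b => (b != 0%N)%:R) v.
rewrite /numop (lsumE HB); apply: (subspace_sum sP) => b _.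
by apply: (subspaceZ sP); apply: PQ.
Qed.

Lemma stable_quad_neq P p q v : subspace P -> stable rhoF P -> p != q ->
  p + q != -1 -> P v -> P (Q p q v).
Proof.
move=> sP rP; case: (ltgtP p q) => // pq _ pq1 Pv; first exact: (stable_quad cl).
rewrite (quad_swap cl) (negPf pq1) scale0r sub0r; apply: (subspaceN sP).
exact: (stable_quad cl).
Qed.

Lemma quad_diag p v : Q p p v = 0.
Proof.
have := quad_swap cl p p v; have -> : (p + p == -1) = false by lia.
rewrite scale0r sub0r => /eqP.
by rewrite -addr_eq0 -mulr2n -scaler_nat scaler_eq0 pnatr_eq0 => /eqP.
Qed.

(** The outer factors in [casimir] preserve P by interpolation, so it suffices that the inner ones,
    which strictly lower the energy, land in P. This serves both generation and, with P = 0, the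
    search for singular vectors. *)
Lemma casimir_closed P v : subspace P -> stable rhoF P -> so_inv v ->
  (forall b : nat, (0 < b)%N -> P (Q (-1) b%:Z v)) ->
  (forall b : nat, (0 < b)%N -> P (Q 0 b%:Z v)) -> P (gam e st v).
Proof.
move=> sP rP Jv P1 P2; have [B ->] := casimir Jv.
apply: (subspace_sum sP) => -[[|b] /= _] _.
  by rewrite scale0r (quad_diag 0 v) (lin0 (quad_linear _ _ _ _)) subr0;
    apply: (subspace0 sP).
apply: (subspaceB sP).
  by apply: (subspaceZ sP); apply: (stable_quad cl sP rP); [lia|exact: P1].
by apply: (stable_quad_neq sP rP); [lia|lia|exact: P2].
Qed.

Lemma so_inv_generated P : subspace P -> stable rhoF P -> P (vac F) ->
  P (detv e) -> forall v, so_inv v -> P v.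
Proof.
move=> sP rP Pvac Pdet.
have H (m : nat) (d : int) v : d < m%:Z -> so_inv v -> energy v = d%:~R *: v -> P v.
  elim: m d v => [|m IH] d v dm Jv Ev.
    by rewrite (energy_ge0 dm Ev); apply: (subspace0 sP).
  (* The operator [gam] preserves T, so v splits into eigenvectors of [gam] that are still invariant
     and of the same energy. *)
  pose T u := so_inv u /\ energy u = d%:~R *: u.
  have sT : subspace T.
    apply: subspaceI; first exact: so_inv_subspace.
    by apply: subspace_eq; [exact: energy_linear|exact/linear_scale/linear_id].
  have Tgam u : T u -> T (gam e st u).
    apply: gam_closed => // b {}u [Ju Eu]; split; first exact: so_inv_quad.
    rewrite (energy_quad _ _ Eu); congr (_%:~R *: _); lia.
  have [D [w [_ gw w0 vE]]] : graded (gam e st) (fun=> True) v.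
    move: v {Jv Ev}; apply: (mono_ind cl) => [|s us].
      by apply: graded_subspace => //; exact: gam_linear.
    have [c Ec _] := gam_mono cl us.
    by apply: (graded_eigen (gam_linear e st) _ _ Ec).
  have Tw c : (c < D)%N -> T (w c).
    apply: (eigen_component (gam_linear e st) sT Tgam) => //.
    by rewrite -vE.
  rewrite vE; apply: (subspace_sum sP) => c _; have [Jc Ec] := Tw _ (ltn_ord c).
  have [c0|c0] := eqVneq (c : nat) 0%N.
    have [|a [b ->]] := gam_ker cl (v := w c); first by rewrite gw c0 scale0r.
    by apply: (subspaceD sP); apply: (subspaceZ sP).
  (* For eigenvalue c > 0 the vector is c^-1 times its image, which lies in P by the induction on
     energy. *)
  have : P (gam e st (w c)).
    apply: casimir_closed => // b b0.
      apply: IH (so_inv_quad _ _ Jc) (energy_quad _ _ Ec); lia.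
    apply: IH (so_inv_quad _ _ Jc) (energy_quad _ _ Ec); lia.
  rewrite gw => /(subspaceZ sP c%:R^-1); rewrite scalerA mulVf ?scale1r //.
  by rewrite pnatr_eq0.
move=> v Jv; have [|D [w [Jw Ew ->]]] := energy_component so_inv_subspace _ Jv.
  move=> u Ju; apply: (subspaceZ so_inv_subspace).
  have := so_inv_stable (Dplus_H0 K) Ju.
  by rewrite rhoF_tmon mulr0 scale0r add0r.
apply: (subspace_sum sP) => d _.
by apply: (H d.+1 d%:Z); [lia|exact: Jw|rewrite Ew].
Qed.

(** Descent on the energy: as long as some [Q (-1) b] or [Q 0 b] with b > 0 does not kill the
    vector, its image is a nonzero vector of P of smaller energy. *)
Lemma so_inv_singular P : subspace P -> stable rhoF P ->
  (forall v, P v -> so_inv v) -> (exists2 v, P v & v != 0) ->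
  exists a b, P (a *: vac F + b *: detv e) /\ a *: vac F + b *: detv e != 0.
Proof.
move=> sP rP Pso [v Pv v0].
have PE u : P u -> P (energy u).
  move=> Pu; apply: (subspaceZ sP); have := rP _ _ (Dplus_H0 K) Pu.
  by rewrite rhoF_tmon mulr0 scale0r add0r.
have H (m : nat) (d : int) u : d < m%:Z -> P u -> u != 0 ->
    energy u = d%:~R *: u ->
    exists a b, P (a *: vac F + b *: detv e) /\ a *: vac F + b *: detv e != 0.
  elim: m d u => [|m IH] d u dm Pu u0 Eu.
    by rewrite (energy_ge0 dm Eu) eqxx in u0.
  have red p (b : nat) : p < b%:Z -> 0 <= p + 1 -> (0 < b)%N ->
      Q p b%:Z u != 0 -> exists a b,
      P (a *: vac F + b *: detv e) /\ a *: vac F + b *: detv e != 0.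
    move=> pb p0 b0 Q0; apply: IH Q0 (energy_quad _ _ Eu); first by lia.
    exact: (stable_quad cl).
  have [[b b0 Q0]|no1] := pselect (exists2 b : nat, (0 < b)%N & Q (-1) b%:Z u != 0).
    by apply: (red (-1) b).
  have [[b b0 Q0]|no2] := pselect (exists2 b : nat, (0 < b)%N & Q 0 b%:Z u != 0).
    by apply: (red 0 b); rewrite ?ltz_nat.
  (* All energy lowering factors vanish on u, so the Casimir identity is applied with the zero
     subspace. *)
  have gu : gam e st u = 0.
    apply: (casimir_closed (subspace_zero F)).
    - by move=> X w _ ->; apply: (lin0 (rhoF_linear _ _ _)).
    - exact: Pso.
    - by move=> b b0; apply/eqP; apply: contraPT no1 => Q0; apply; exists b.
    - by move=> b b0; apply/eqP; apply: contraPT no2 => Q0; apply; exists b.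
  have [a [b uE]] := gam_ker cl gu.
  by exists a, b; rewrite -uE.
have [D [w [Pw Ew vE]]] := energy_component sP PE Pv.
have [[d d0]|no] := pselect (exists d, w d != 0).
  by apply: (H d.+1 d%:Z (w d)) => //; lia.
have v00 : v = 0.
  by rewrite vE big1 // => i _; apply/eqP; apply: contraPT no => ?; apply; exists i.
by rewrite v00 eqxx in v0.
Qed.

End Casimir.

(** * Invariants of the orthogonal group *)

Section Expansions.
Variables (K : numFieldType) (M N : lmodType K).

(** Polynomial dependence on t with coefficients c. Allowing every large truncation D makes it
    possible to add expansions with different degree bounds. *)
Definition expands (V : lmodType K) (f : K -> V) (c : nat -> V) : Prop :=
  exists D0 : nat, forall D, (D0 <= D)%N ->
    forall t, f t = \sum_(d < D) t ^+ d *: c d.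

Lemma expands_lin (f g : K -> M) c d (a : K) : expands f c -> expands g d ->
  expands (fun t => a *: f t + g t) (fun k => a *: c k + d k).
Proof.
move=> [D1 H1] [D2 H2]; exists (maxn D1 D2) => D.
rewrite geq_max => /andP[h1 h2] t; rewrite (H1 _ h1) (H2 _ h2).
rewrite scaler_sumr -big_split; apply: eq_bigr => k _ /=; lincomb K.
Qed.

Lemma expands_add (f g : K -> M) c d : expands f c -> expands g d ->
  expands (fun t => f t + g t) (fun k => c k + d k).
Proof.
move=> [D1 H1] [D2 H2]; exists (maxn D1 D2) => D.
rewrite geq_max => /andP[h1 h2] t; rewrite (H1 _ h1) (H2 _ h2).
by rewrite -big_split; apply: eq_bigr => k _; rewrite scalerDr.
Qed.

Lemma expands_map (f : K -> M) c (g : M -> N) : linear g -> expands f c ->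
  expands (fun t => g (f t)) (fun k => g (c k)).
Proof.
move=> gL [D0 H]; exists D0 => D hD t; rewrite (H _ hD) (lin_sum gL).
by apply: eq_bigr => k _; rewrite (linZ gL).
Qed.

Definition shift (c : nat -> M) (k : nat) : M := if k is k'.+1 then c k' else 0.

Lemma expands_shift (f : K -> M) c : expands f c ->
  expands (fun t => t *: f t) (shift c).
Proof.
move=> [D0 H]; exists D0.+1 => -[//|D] hD t; rewrite (H D) //.
rewrite big_ord_recl /= scaler0 add0r scaler_sumr; apply: eq_bigr => k _.
by rewrite scalerA -exprS.
Qed.

Lemma expands_cst (v : M) :
  expands (fun=> v) (fun k => if k == 0%N then v else 0).
Proof.
exists 1%N => -[//|D] _ t; rewrite big_ord_recl /= scale1r big1 ?addr0 //.
by move=> i _; rewrite scaler0.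
Qed.

Lemma expands_ext (f g : K -> M) c : f =1 g -> expands f c -> expands g c.
Proof. by move=> fg [D0 H]; exists D0 => D hD t; rewrite -fg; apply: H. Qed.

(** The algebraic form of differentiating an invariance relation at t = 0. *)
Lemma expands_const (v : M) c : expands (fun=> v) c -> c 1%N = 0.
Proof.
move=> [D0 H]; pose d k := c k - (if k == 0%N then v else 0).
suff : d 1%N = 0 by rewrite /d /= subr0.
apply: (@poly_family_eq0 _ _ D0.+2 d) => // t.
rewrite /d; under eq_bigr => k _ do rewrite scalerBr.
rewrite sumrB -H; last by apply: leq_trans (leqnSn _) _.
rewrite big_ord_recl /= scale1r big1 ?addr0 ?subrr //.
by move=> i _; rewrite scaler0.
Qed.

End Expansions.

(** * The dual basis and the unipotent elements of SO(2l+1) *)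

Section Reflection.
Variable l : nat.
Local Notation n := (l + l + 1)%N.

Definition dual (i : 'I_n) : 'I_n :=
  match split i with
  | inl j => lshift 1 (match split j with
                       | inl p => rshift l p
                       | inr p => lshift l p
                       end)
  | inr _ => i
  end.

Definition mid : 'I_n := rshift (l + l) ord0.

Lemma dual_plus p : dual (lshift 1 (lshift l p)) = lshift 1 (rshift l p).
Proof. by rewrite /dual (unsplitK (inl _)) (unsplitK (inl _)). Qed.

Lemma dual_minus p : dual (lshift 1 (rshift l p)) = lshift 1 (lshift l p).
Proof. by rewrite /dual (unsplitK (inl _)) (unsplitK (inr _)). Qed.

Lemma dual_mid : dual mid = mid.
Proof. by rewrite /dual (unsplitK (inr _)). Qed.

Lemma indexP (P : 'I_n -> Prop) : (forall p, P (lshift 1 (lshift l p))) ->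
  (forall p, P (lshift 1 (rshift l p))) -> P mid -> forall i, P i.
Proof.
move=> P1 P2 P3 i; case: (split_ordP i) => [j ->|z ->].
  by case: (split_ordP j) => p ->.
by rewrite (ord1 z).
Qed.

Lemma dualK : involutive dual.
Proof.
by elim/indexP => [p|p|]; rewrite !(dual_plus, dual_minus, dual_mid).
Qed.

Lemma dual_fixed i : dual i = i -> i = mid.
Proof.
elim/indexP: i => [p|p|//]; rewrite ?dual_plus ?dual_minus => /lshift_inj /eqP.
  by rewrite eq_rlshift.
by rewrite eq_lrshift.
Qed.

Lemma fermion_formE (K : fieldType) i j :
  fermion_form K l i j = (j == dual i)%:R.
Proof.
rewrite /fermion_form.
elim/indexP: i => [p|p|]; elim/indexP: j => [q|q|];
  rewrite ?dual_plus ?dual_minus ?dual_mid ?block_mxEul ?block_mxEur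
    ?block_mxEdl ?block_mxEdr ?mxE ?eq_lshift ?eq_rshift ?eq_lrshift ?eq_rlshift //.
- by rewrite eq_sym.
- by rewrite eq_sym.
Qed.

End Reflection.

Section Unipotent.
Variables (K : numFieldType) (l : nat).
Local Notation n := (l + l + 1)%N.
Local Notation form := (fermion_form K l).

Lemma form_tr : form^T = form.
Proof.
apply/matrixP => i j; rewrite mxE !fermion_formE.
by rewrite -(inv_eq (@dualK l)) eq_sym.
Qed.

Lemma form_delta (i j : 'I_n) : form *m delta_mx i j = delta_mx (dual i) j.
Proof.
apply/matrixP => x y; rewrite mxE (bigD1 i) //= big1 ?addr0 => [|k ki].
  rewrite fermion_formE !mxE eqxx -(inv_eq (@dualK l)) eq_sym -natrM mulnb.
  by rewrite (eq_sym x).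
by rewrite !mxE (negPf ki) mulr0.
Qed.

Lemma form_sq : form *m form = 1%:M.
Proof.
apply/matrixP => x y; rewrite mxE (bigD1 (dual x)) //= big1 => [|k kx].
  by rewrite !fermion_formE eqxx mul1r addr0 dualK mxE eq_sym.
by rewrite fermion_formE (negPf kx) mul0r.
Qed.

(** The invariance of the quadratic operators concerns the form on the dual space, hence A form A^T;
    a left inverse of a square matrix is also a right inverse. *)
Lemma orthogonal_tr (A : 'M[K]_n) : A^T *m form *m A = form ->
  A *m form *m A^T = form.
Proof.
move=> oA; have : A^T *m (form *m A *m form) = 1%:M.
  by rewrite !mulmxA oA form_sq.
move=> /mulmx1C E; have := congr1 (mulmx form) E.
by rewrite mulmx1 !mulmxA form_sq mul1mx.
Qed.

Section Root.
Variables i j : 'I_n.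
Hypotheses (i_iso : i != dual i) (jdi : j != dual i).

(** The matrix by which [Jop e i j] acts on the fermions. The hypotheses say that [e i] is isotropic
    and orthogonal to [e j]. *)
Definition rootmx : 'M[K]_n := delta_mx i (dual j) - delta_mx j (dual i).

(** The exponential of t [rootmx], which stops at degree 2 because the cube vanishes. *)
Definition unimx (t : K) : 'M[K]_n :=
  1%:M + t *: rootmx + (t ^+ 2 / 2%:R) *: (rootmx *m rootmx).

Lemma rootmx_cube : rootmx *m rootmx *m rootmx = 0.
Proof.
have di : dual j != i by rewrite (inv_eq (@dualK l)).
have dd : dual i != j by rewrite eq_sym.
have ii : dual i != i by rewrite eq_sym.
have Z (a b c d : 'I_n) : b != c -> delta_mx a b *m delta_mx c d = 0 :> 'M[K]_n.
  by move=> bc; rewrite mul_delta_mx_0.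
have -> : rootmx *m rootmx = - (delta_mx i (dual j) *m delta_mx j (dual i)).
  rewrite /rootmx !(mulmxBl, mulmxBr) !(Z _ _ i) // !(Z _ (dual i) j) //.
  by rewrite !subr0 sub0r.
by rewrite mulNmx -mulmxA /rootmx mulmxBr !(Z _ (dual i)) // subrr mulmx0 oppr0.
Qed.

Lemma unimxM s t : unimx s *m unimx t = unimx (s + t).
Proof.
rewrite /unimx; set X := rootmx; set X2 := X *m X.
have X3 : X *m X2 = 0 by rewrite /X2 mulmxA rootmx_cube.
have X3' : X2 *m X = 0 by rewrite /X2 rootmx_cube.
have X4 : X2 *m X2 = 0 by rewrite {2}/X2 mulmxA X3' mul0mx.
rewrite !(mulmxDl, mulmxDr, mul1mx, mulmx1) -!(scalemxAl, scalemxAr).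
rewrite -/X2 X3 X3' X4.
have h2 : (2 : K) != 0 by rewrite pnatr_eq0.
by lincomb K; field.
Qed.

Lemma rootmx_skew : rootmx^T *m form = - (form *m rootmx).
Proof.
have dT (a b : 'I_n) : delta_mx a b *m form = delta_mx a (dual b).
  by rewrite -[LHS]trmxK trmx_mul form_tr trmx_delta form_delta trmx_delta.
rewrite /rootmx linearB /= !trmx_delta mulmxBl mulmxBr !dT !form_delta.
by rewrite opprB.
Qed.

Lemma skew_exp (X : 'M[K]_n) a b : X^T *m form = - (form *m X) ->
  (1%:M + a *: X + b *: (X *m X))^T *m form =
  form *m (1%:M + (- a) *: X + b *: (X *m X)).
Proof.
move=> sX; rewrite !linearD !linearZ /= trmx1 trmx_mul.
rewrite !(mulmxDl, mulmxDr) mul1mx mulmx1 -!(scalemxAl, scalemxAr) -!mulmxA sX.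
by rewrite mulmxN !mulmxA sX mulNmx opprK scalerN -scaleNr.
Qed.

Lemma unimx_ortho t : (unimx t)^T *m form *m unimx t = form.
Proof.
have E : (unimx t)^T *m form = form *m unimx (- t).
  by rewrite /unimx skew_exp ?sqrrN //; apply: rootmx_skew.
by rewrite E -mulmxA unimxM addNr /unimx expr0n /= mul0r !scale0r !addr0 mulmx1.
Qed.

Lemma unimx_SO t : SO (unimx t).
Proof.
split; first exact: unimx_ortho.
(* Orthogonality only gives determinant of square 1; being the square of an orthogonal matrix
   excludes -1. *)
have -> : unimx t = unimx (t / 2%:R) *m unimx (t / 2%:R).
  have h2 : (2 : K) != 0 by rewrite pnatr_eq0.
  by rewrite unimxM; congr unimx; field.
have := congr1 determinant (unimx_ortho (t / 2%:R)).
rewrite !det_mulmx det_tr mulrAC => /(congr1 (fun x => x * \det form)).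
by rewrite -!det_mulmx -mulmxA form_sq mulmx1 det1.
Qed.

End Root.
End Unipotent.

(** * The product of all level 0 creation modes and the determinant *)

Section TopForm.
Variables (K : numFieldType) (F : vertexSuperalgebra K).
Variables (n : nat) (e : 'I_n -> F) (st : 'I_n -> 'I_n).
Hypothesis cl : clifford e st.
Implicit Types (s t : seq ('I_n * nat)) (x y : 'I_n * nat).

Lemma creation_anticomm i j (b c : nat) v :
  Y (e i) (-1 - b%:Z) (Y (e j) (-1 - c%:Z) v)
  = - Y (e j) (-1 - c%:Z) (Y (e i) (-1 - b%:Z) v).
Proof. by rewrite (CAR0 cl) //; lia. Qed.

Lemma mono_notuniq s : ~~ uniq s -> mono e s = 0.
Proof.
elim: s => [//|x s IH] /=; rewrite negb_and negbK => /orP[/(mono_dup cl)->//|/IH->].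
by rewrite Y0.
Qed.

Lemma mono_catZ c s s1 t : mono e s = c *: mono e t ->
  mono e (s1 ++ s) = c *: mono e (s1 ++ t).
Proof. by move=> E; elim: s1 => [//|x s1 IH] /=; rewrite IH YZ. Qed.

Lemma mono_front x s1 s2 :
  mono e (s1 ++ x :: s2) = (-1) ^+ size s1 *: mono e (x :: s1 ++ s2).
Proof.
elim: s1 => [|y s1 IH]; first by rewrite scale1r.
by rewrite /= in IH *; rewrite IH YZ creation_anticomm exprS mulN1r scaleNr scalerN.
Qed.

Lemma mono_swap x y s1 s2 s3 :
  mono e (s1 ++ x :: s2 ++ y :: s3) = - mono e (s1 ++ y :: s2 ++ x :: s3).
Proof.
rewrite -scaleN1r; apply: mono_catZ; rewrite /= !mono_front /= !YZ.
by rewrite creation_anticomm scalerN scaleN1r.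
Qed.

Lemma mono_tperm (g : 'I_n -> 'I_n * nat) (i j : 'I_n) : i != j ->
  mono e [seq g (tperm i j k) | k <- enum 'I_n] = - mono e [seq g k | k <- enum 'I_n].
Proof.
have main (a b : 'I_n) (s1 s2 s3 r : seq 'I_n) : r = s1 ++ a :: s2 ++ b :: s3 ->
    uniq r -> mono e [seq g (tperm a b k) | k <- r] = - mono e [seq g k | k <- r].
  move=> rE; rewrite rE => us.
  have {}us : uniq (a :: b :: s1 ++ s2 ++ s3).
    have pe : perm_eq (s1 ++ a :: s2 ++ b :: s3) (a :: b :: s1 ++ s2 ++ s3).
      by apply/seq.permP => P; do 3!rewrite /= ?count_cat; lia.
    by rewrite -(perm_uniq pe).
  have fixr q : {subset q <= s1 ++ s2 ++ s3} ->
      [seq g (tperm a b k) | k <- q] = [seq g k | k <- q].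
    move=> qs; apply/eq_in_map => k /qs kq; congr g; apply: tpermD.
      by apply: contraTneq us => ->; rewrite /= inE kq orbT.
    by apply: contraTneq us => ->; rewrite /= kq andbF.
  have f1 : [seq g (tperm a b k) | k <- s1] = [seq g k | k <- s1].
    by apply: fixr => k kq; rewrite mem_cat kq.
  have f2 : [seq g (tperm a b k) | k <- s2] = [seq g k | k <- s2].
    by apply: fixr => k kq; rewrite !mem_cat kq orbT.
  have f3 : [seq g (tperm a b k) | k <- s3] = [seq g k | k <- s3].
    by apply: fixr => k kq; rewrite !mem_cat kq !orbT.
  rewrite map_cat map_cons map_cat map_cons.
  rewrite map_cat map_cons map_cat map_cons f1 f2 f3 tpermL tpermR.
  exact: mono_swap.
move=> ij; have ie := mem_enum 'I_n i; have je := mem_enum 'I_n j.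
have ue := enum_uniq 'I_n; move: (enum 'I_n) ie je ue => r ir jr ur.
move: (jr); rewrite inE; case/splitPr: ir jr main ur => s1 s2.
rewrite mem_cat inE (eq_sym j) (negPf ij) /= => /orP[js|js] main ur _.
  case/splitPr: js main ur => t1 t2 main ur.
  by rewrite tpermC; apply: main ur; rewrite -catA.
by case/splitPr: js main ur => t1 t2 main ur; apply: main ur.
Qed.

Lemma mono_perm (s : {perm 'I_n}) :
  mono e [seq (s i, 0%N) | i <- enum 'I_n] = (-1) ^+ s *: detv e.
Proof.
have [ts -> dts] := prod_tpermP s; elim: ts dts => [_|[x y] ts IH] /=.
  rewrite big_nil odd_perm1 scale1r; congr (mono e _).
  by apply: eq_map => i; rewrite perm1.
move=> /andP[xy dts]; rewrite big_cons odd_permM odd_tperm xy /=.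
set p := (\prod_(t <- ts) _)%g in IH *.
transitivity (mono e [seq (p (tperm x y i), 0%N) | i <- enum 'I_n]).
  by congr (mono e _); apply: eq_map => i; rewrite permM.
rewrite (mono_tperm (fun i => (p i, 0%N)) xy) IH //.
by rewrite signrN scaleNr.
Qed.

Lemma mono_expand (A : 'M[K]_n) (r : seq 'I_n) :
  foldr (fun i v => Y (\sum_j A j i *: e j) (-1 - 0%N%:Z) v) (vac F) r =
  \sum_(t : (size r).-tuple 'I_n)
    (\prod_(p <- zip r t) A p.2 p.1) *: mono e [seq (j, 0%N) | j <- t].
Proof.
elim: r => [|i r IH] /=.
  rewrite (big_pred1 [tuple]) => [|t]; last by apply/esym/eqP/tuple0.
  by rewrite big_nil scale1r.
rewrite (reindex (fun p : 'I_n * (size r).-tuple 'I_n => [tuple of p.1 :: p.2])) /=.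
  rewrite -(pair_big xpredT xpredT (fun j (t : (size r).-tuple 'I_n) =>
    (\prod_(p <- zip (i :: r) (j :: t)) A p.2 p.1)
      *: mono e [seq (j, 0%N) | j <- j :: t])) /=.
  rewrite IH (lin_sum (Y_linearl _ _)); apply: eq_bigr => j _.
  rewrite (linZ (Y_linearl _ _)) linear_sum scaler_sumr.
  by apply: eq_bigr => t _; rewrite /= YZ scalerA big_cons.
exists (fun t : (size r).+1.-tuple 'I_n => (thead t, [tuple of behead t])).
  by move=> [j t] _; congr pair; apply: val_inj.
by move=> t _; rewrite [t in RHS]tuple_eta; apply: val_inj.
Qed.

(** Level 0 creation modes generate an exterior algebra, so the multilinear expansion is the Leibniz
    formula: repeated indices vanish and permutations contribute their sign. *)
Lemma mono_det (A : 'M[K]_n) :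
  foldr (fun i v => Y (\sum_j A j i *: e j) (-1 - 0%N%:Z) v) (vac F) (enum 'I_n) =
  \det A *: detv e.
Proof.
rewrite mono_expand.
pose G (u : seq 'I_n) := (\prod_(p <- zip (enum 'I_n) u) A p.2 p.1)
  *: mono e [seq (j, 0%N) | j <- u].
have -> : \sum_(t : (size (enum 'I_n)).-tuple 'I_n) G t =
    \sum_(t : n.-tuple 'I_n) G t by rewrite size_enum_ord.
rewrite (reindex (fun f : {ffun 'I_n -> 'I_n} => [tuple f i | i < n])) /=; last first.
  exists (fun u : n.-tuple 'I_n => [ffun i => tnth u i]) => [f _|u _].
    by apply/ffunP => i; rewrite ffunE tnth_mktuple.
  by apply: eq_from_tnth => i; rewrite tnth_mktuple ffunE.
have GE (f : {ffun 'I_n -> 'I_n}) : G [tuple f i | i < n] =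
    (\prod_i A (f i) i) *: mono e [seq (f i, 0%N) | i <- enum 'I_n].
  rewrite /G /= -map_comp; congr (_ *: _).
  have -> : zip (enum 'I_n) [seq f i | i <- enum 'I_n] =
      [seq (i, f i) | i <- enum 'I_n] by elim: (enum _) => //= i r ->.
  by rewrite big_map big_enum.
under eq_bigr => f _ do rewrite GE.
rewrite (bigID (fun f : {ffun 'I_n -> 'I_n} => injectiveb f)) /=.
rewrite [X in _ + X]big1 ?addr0 => [|f nf]; last first.
  rewrite mono_notuniq ?scaler0 //; apply: contra nf => u.
  rewrite /injectiveb /dinjectiveb; apply: (@map_uniq _ _ (fun j => (j, 0%N))).
  by rewrite -map_comp.
rewrite (reindex (@pval _)) /=; last first.
  pose in_Sn := insubd (1%g : 'S_n).
  by exists in_Sn => /= f Uf; first apply: val_inj; apply: insubdK.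
rewrite -det_tr /determinant scaler_suml; apply: eq_big => [s|s _].
  by rewrite (valP s).
rewrite pvalE mono_perm scalerA mulrC; congr (_ * _ *: _).
by apply: eq_bigr => i _; rewrite mxE.
Qed.

End TopForm.

(** * From invariants of the group to invariants of the Lie algebra *)

Section Invariants.
Variables (K : numFieldType) (F : vertexSuperalgebra K) (l : nat).
Variables (psi : bool -> 'I_l -> F) (phi : F).
Variable act : 'M[K]_(l + l + 1) -> F -> F.
Hypothesis fock : fermionic_fock psi phi.
Hypothesis actSO : SO_action psi phi act.
Local Notation n := (l + l + 1)%N.
Local Notation e := (fermion psi phi).
Local Notation st := (@dual l).
Local Notation Q := (quad e st).
Local Notation ind b := (GRing.natmul (1 : K) (nat_of_bool b)).

Lemma fock_clifford : clifford e st.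
Proof.
split.
- exact: dualK.
- exact: fermion_odd fock.
- by move=> i j m k v; rewrite (fermion_anticomm fock) fermion_formE.
- exact: fock_vac_neq0 fock.
- exact: fock_vac_killed fock.
- exact: fock_cyclic fock.
Qed.

Let cl := fock_clifford.

Lemma act_mor A : SO A -> vsa_morphism (act A).
Proof. by move=> oA; case: (act_aut actSO oA). Qed.

Lemma act_linear A : SO A -> linear (act A).
Proof. by move=> /act_mor/vmor_linear. Qed.

Lemma act_e A i m v : SO A ->
  act A (Y (e i) m v) = Y (\sum_j A j i *: e j) m (act A v).
Proof. by move=> oA; rewrite (vmor_Y (act_mor oA)) (act_fermion actSO). Qed.

Lemma Y_sum_coef (A : 'M[K]_n) i m v :
  Y (\sum_j A j i *: e j) m v = \sum_j A j i *: Y (e j) m v.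
Proof.
rewrite (lin_sum (Y_linearl m v)); apply: eq_bigr => j _.
exact: linZ (Y_linearl m v) _ _.
Qed.

Lemma orthogonal_entries (A : 'M[K]_n) a b : SO A ->
  \sum_i A a i * A b (st i) = ind (b == st a).
Proof.
move=> oA; have := congr1 (fun M : 'M[K]_n => M a b) (orthogonal_tr oA.1).
rewrite /= fermion_formE mxE => <-; rewrite (reindex_inj (inv_inj (@dualK l))).
apply: eq_bigr => k _; rewrite dualK !mxE; congr (_ * _).
rewrite (bigD1 (st k)) //= fermion_formE dualK eqxx mulr1 big1 ?addr0 // => j jk.
by rewrite fermion_formE -(inv_eq (@dualK l)) eq_sym (negPf jk) mulr0.
Qed.

Lemma act_quad A p q v : SO A -> act A (Q p q v) = Q p q (act A v).
Proof.
move=> oA; rewrite /quad (lin_sum (act_linear oA)).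
have E i : act A (Y (e i) p (Y (e (st i)) q v)) = \sum_a \sum_b
    (A a i * A b (st i)) *: Y (e a) p (Y (e b) q (act A v)).
  rewrite !act_e // !Y_sum_coef; apply: eq_bigr => a _.
  rewrite linear_sum scaler_sumr; apply: eq_bigr => b _ /=.
  by rewrite YZ scalerA.
under eq_bigr => i _ do rewrite E.
rewrite exchange_big /=; apply: eq_bigr => a _.
rewrite exchange_big /= -[RHS](sum_ind (st a) (fun b =>
  Y (e a) p (Y (e b) q (act A v)))).
by apply: eq_bigr => b _; rewrite -scaler_suml orthogonal_entries.
Qed.

Lemma WB_subspace : subspace (WB act).
Proof. by case: (WB_vertex_subalgebra actSO). Qed.

Lemma WB_vac : WB act (vac F).
Proof. by case: (WB_vertex_subalgebra actSO). Qed.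

Lemma WB_stable : stable (rhoF e st) (WB act).
Proof.
apply: (rhoF_quad_stable cl WB_subspace) => p q v Wv A oA.
by rewrite act_quad // Wv.
Qed.

Section RootInvariance.
Variables i j : 'I_n.
Hypotheses (i_iso : i != st i) (jdi : j != st i).
Let A (t : K) := unimx i j t.
Let X : 'M[K]_n := rootmx K i j.
Let x1 k := \sum_a X a k *: e a.
Let x2 k := \sum_a (X *m X) a k *: e a.

Lemma root_e k : x1 k = ind (k == st j) *: e i - ind (k == st i) *: e j.
Proof.
rewrite /x1 -[e i](sum_ind i) -[e j](sum_ind j) !scaler_sumr -sumrB.
apply: eq_bigr => a _; rewrite /X /rootmx !mxE scalerBl !scalerA -!natrM !mulnb.
by rewrite ![(a == _) && _]andbC.
Qed.

Lemma act_unimx t k m v : act (A t) (Y (e k) m v) =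
  Y (e k) m (act (A t) v) + t *: Y (x1 k) m (act (A t) v)
  + t *: (t *: (2%:R^-1 *: Y (x2 k) m (act (A t) v))).
Proof.
rewrite act_e; last exact: unimx_SO.
set u := act _ v; rewrite /x1 /x2 !Y_sum_coef.
rewrite -[Y (e k) m u](sum_ind k (fun a => Y (e a) m u)).
rewrite !scaler_sumr -!big_split /=; apply: eq_bigr => a _.
rewrite /A /unimx !mxE -/X; lincomb K.
Qed.

(** Polynomiality in t spreads from the vacuum to each vector by cyclicity, since [act] is
    multiplicative and [unimx] is quadratic in t; the linear coefficient obeys the same derivation
    rule as [Jop]. *)
Lemma act_expands v : exists c, [/\ expands (fun t => act (A t) v) c,
  c 0%N = v & c 1%N = Jop e i j v].
Proof.
move: v; apply: (cliff_cyclic cl).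
- split.
    exists (fun k => if k == 0%N then 0 else 0); split=> //.
      apply: expands_ext (expands_cst 0) => t.
      by rewrite (lin0 (act_linear (unimx_SO i_iso jdi t))).
    by rewrite (lin0 (Jop_linear e i j)).
  move=> a u v [c [cu c0 c1]] [d [dv d0 d1]].
  exists (fun k => a *: c k + d k); split; last 2 first.
  + by rewrite c0 d0.
  + by rewrite c1 d1 (Jop_linear e i j).
  apply: expands_ext (expands_lin a cu dv) => t.
  by rewrite (act_linear (unimx_SO i_iso jdi t)).
- exists (fun k => if k == 0%N then vac F else 0); split=> //.
    apply: expands_ext (expands_cst (vac F)) => t.
    by rewrite (vmor_vac (act_mor (unimx_SO i_iso jdi t))).
  by rewrite (Jop_vac cl).
move=> k m v [c [cv c0 c1]].
(* The product of the expansion c with 1 + tX + t^2 X^2 / 2; each factor t shifts the coefficients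
   by one. *)
exists (fun d => Y (e k) m (c d) + shift (fun d => Y (x1 k) m (c d)) d
  + shift (shift (fun d => 2%:R^-1 *: Y (x2 k) m (c d))) d); split.
- apply: (@expands_ext _ _ (fun t => Y (e k) m (act (A t) v)
    + t *: Y (x1 k) m (act (A t) v)
    + t *: (t *: (2%:R^-1 *: Y (x2 k) m (act (A t) v))))).
    by move=> t; rewrite act_unimx.
  have EY (a : F) : expands (fun t => Y a m (act (A t) v)) (fun d => Y a m (c d)).
    by apply: expands_map => //; apply: Y_linear.
  apply: expands_add; first by apply: expands_add => //; apply: expands_shift.
  do 2!apply: expands_shift.
  by apply: (expands_map (g := fun u => 2%:R^-1 *: u)) => //;
    apply/linear_scale/linear_id.
- by rewrite /= !addr0 c0.
rewrite /= addr0 c0 c1 (Jop_e cl) root_e (linB (Y_linearl m v)).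
by rewrite !(linZ (Y_linearl m v)).
Qed.

Lemma WB_root v : WB act v -> Jop e i j v = 0.
Proof.
move=> Wv; have [c [cv _ <-]] := act_expands v.
apply: (@expands_const _ _ v); apply: expands_ext cv => t.
by rewrite Wv //; apply: unimx_SO.
Qed.

End RootInvariance.

Lemma Jop_antisym i j v : Jop e j i v = - Jop e i j v.
Proof.
have [B HB] := Jterm_bound e v; rewrite /Jop !(lsumE (HB _ _)) -sumrN.
by apply: eq_bigr => b _; rewrite /Jterm opprB.
Qed.

(** [WB_root] covers isotropic [e i] orthogonal to [e j]. A first index [mid] is exchanged by
    antisymmetry, leaving the Cartan generators j = st i. *)
Lemma WB_so_inv v : WB act v -> so_inv e v.
Proof.
move=> Wv i j.
have iso k : k != mid l -> k != st k.
  by apply: contraNneq => /esym/dual_fixed->.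
have Jmid k : k != mid l -> Jop e k (mid l) v = 0.
  move=> km; apply: WB_root => //; first exact: iso.
  by apply: contra km => /eqP E; rewrite -(dualK k) -E dual_mid.
have [->|ij] := eqVneq j i.
  have /eqP := Jop_antisym i i v; rewrite -addr_eq0 -mulr2n -scaler_nat.
  by rewrite scaler_eq0 pnatr_eq0 => /eqP.
have [im|im] := eqVneq i (mid l).
  by rewrite Jop_antisym im Jmid ?oppr0 // -im.
have [jdi|jdi] := eqVneq j (st i); last by apply: WB_root => //; apply: iso.
have dm : st i != mid l by apply: contra im => /eqP E; rewrite -(dualK i) E dual_mid.
have JL a b := Jop_linear e a b.
(* A Cartan generator is the commutator of the two root vectors joining [e i] and its dual to [phi];
   both sides act alike on modes and kill the vacuum. *)
have E : forall u, Jop e i (st i) u =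
    Jop e (st i) (mid l) (Jop e i (mid l) u) - Jop e i (mid l) (Jop e (st i) (mid l) u).
  apply: (eq_on_vac cl).
  - exact: JL.
  - by apply: linear_sub; apply: linear_comp.
  - move=> k m u IH; rewrite !(Jop_e cl) !(linD (JL _ _)) !(linN (JL _ _)).
    rewrite !(linZ (JL _ _)) !(Jop_e cl) IH YB !dualK !dual_mid.
    rewrite !eqxx !(eq_sym (mid l)) (negPf im) (negPf dm).
    lincomb K.
  - by rewrite !(Jop_vac cl) !(lin0 (JL _ _)) subrr.
by rewrite jdi E !Jmid // !(lin0 (JL _ _)) subrr.
Qed.

Lemma WB_detv : WB act (detv e).
Proof.
move=> A oA; rewrite -[RHS]scale1r -oA.2 -(mono_det cl) /detv /mono.
elim: (enum _) => [|i r IH] /=; first exact: (vmor_vac (act_mor oA)).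
by rewrite act_e // IH.
Qed.

End Invariants.

(** * The fields of the vertex algebra *)

Section BorcherdsConsequences.
Variables (K : numFieldType).

Lemma ibinom0r (j : nat) : ibinom K 0 j = (j == 0%N)%:R.
Proof.
case: j => [|j]; rewrite /ibinom; first by rewrite big_ord0 divr1.
by rewrite big_ord_recl /= subrr mul0r mul0r.
Qed.

Lemma ibinomr0 (m : int) : ibinom K m 0 = 1.
Proof. by rewrite /ibinom big_ord0 divr1. Qed.

Lemma ibinom_ffp (m : int) (j : nat) :
  ibinom K m j * j`!%:R = (ffp K j).[m%:~R].
Proof.
rewrite /ibinom mulfVK ?pnatr_eq0 -?lt0n ?fact_gt0 // ffpE.
by apply: eq_bigr => i _; rewrite rmorphB.
Qed.

Lemma ibinomS (m : int) (j : nat) :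
  j.+1%:R * ibinom K m j.+1 = m%:~R * ibinom K (m - 1) j.
Proof.
rewrite /ibinom big_ord_recl /= subr0 factS natrM invfM.
have -> : \prod_(i < j) (m - (bump 0 i)%:Z)%:~R = \prod_(i < j) (m - 1 - i%:Z)%:~R :> K.
  by apply: eq_bigr => i _; congr (_%:~R); rewrite /bump /=; lia.
have nz : j.+1%:R != 0 :> K by rewrite pnatr_eq0.
have fz : j`!%:R != 0 :> K by rewrite pnatr_eq0 -lt0n fact_gt0.
by field; rewrite fz addrC natr1 nz.
Qed.

Lemma ibinomN2 (j : nat) : ibinom K (- 2%:Z) j = (-1) ^+ j * j.+1%:R.
Proof.
have fz i : i`!%:R != 0 :> K by rewrite pnatr_eq0 -lt0n fact_gt0.
apply: (mulIf (fz j)); rewrite -[RHS]mulrA -natrM -factS ibinom_ffp ffpE.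
elim: j => [|j IH]; first by rewrite big_ord0 !mul1r.
have -> : j.+2`!%:R = (j%:R + 2%:R) * j.+1`!%:R :> K.
  by rewrite [in LHS]factS natrM -addn2 natrD.
by rewrite big_ord_recr /= IH exprS !rmorphN /= -pmulrn; ring.
Qed.

Variables (V M : lmodType K) (YV : V -> int -> V -> V) (YM : V -> int -> M -> M).
Hypotheses (YVfield : is_field_map YV) (YMfield : is_field_map YM).

Lemma commutator_formula (a b : V) (c : M) (s : K) (m k : int) :
  borcherds_identity YV YM s a b c ->
  exists N0 : nat, forall N : nat, (N0 <= N)%N ->
    \sum_(j < N) ibinom K m j *: YM (YV a j%:Z b) (m + k - j%:Z) c
    = YM a m (YM b k c) - s *: YM b k (YM a m c).
Proof.
move=> /(_ m 0 k)[N0 H]; exists N0.+1 => -[//|N] hN.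
have := H N.+1 (ltnW hN).
under eq_bigr => j _ do rewrite add0r.
move=> ->; rewrite big_ord_recl big1 => [|j _]; last first.
  by rewrite ibinom0r mulr0 scale0r.
rewrite /= -[Posz 0]/(0 : int) ibinom0r ?(addr0, subr0, add0r).
by rewrite expr0 mul1r scale1r expr0z mul1r.
Qed.

Lemma associativity_formula (a b : V) (c : M) (s : K) (n k : int) :
  borcherds_identity YV YM s a b c ->
  exists N0 : nat, forall N : nat, (N0 <= N)%N ->
    YM (YV a n b) k c = \sum_(j < N) ((-1) ^+ j * ibinom K n j) *:
        (YM a (n - j%:Z) (YM b (k + j%:Z) c)
         - ((-1) ^ n * s) *: YM b (n + k - j%:Z) (YM a j%:Z c)).
Proof.
move=> /(_ 0 n k)[N0 H]; exists N0.+1 => -[//|N] hN.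
have := H N.+1 (ltnW hN); rewrite big_ord_recl big1 => [|j _]; last first.
  by rewrite ibinom0r scale0r.
rewrite /= -[Posz 0]/(0 : int) ibinom0r scale1r ?(addr0, add0r, subr0) => ->.
by apply: eq_bigr => j _; rewrite !add0r.
Qed.

End BorcherdsConsequences.

Section Translation.
Variables (K : numFieldType) (F : vertexSuperalgebra K).
Local Notation ind b := (GRing.natmul (1 : K) (nat_of_bool b)).

Lemma translE (a : F) : transl a = Y a (-2) (vac F).
Proof.
have := transl_cov a (-1) (vac F); rewrite Y_create1 transl_vac Y0 subr0 => ->.
by rewrite rmorphN scaleN1r opprK.
Qed.

(** The axiom [transl_cov] gives the commutator with T, not the field of T a. The latter comes from
    associativity applied to T a = a_(-2)|0>. *)
Lemma Y_transl p (a : F) m c : parity p a ->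
  Y (transl a) m c = - (m%:~R *: Y a (m - 1) c).
Proof.
move=> pa; rewrite translE.
have B : borcherds_identity (@Y _ F) (@Y _ F) 1 a (vac F) c.
  by have := Y_borcherds c pa (vac_even F); rewrite andbF.
have [N0 H] := associativity_formula (-2) m B.
rewrite (H (N0 + `|m| + 1)%N); last by rewrite -addnA leq_addr.
set N := (N0 + _ + _)%N; have mN : (`|m| + 1 <= N)%N by rewrite /N -addnA leq_addl.
(* The vacuum field is nonzero at index -1 only, so the first product survives for j = -1 - m and
   the second for j = m - 1; when m is nonzero exactly one of these is a natural number. *)
have E (j : 'I_N) : ((-1) ^+ j * ibinom K (-2) j) *:
    (Y a (-2 - j%:Z) (Y (vac F) (m + j%:Z) c)
     - ((-1) ^ (-2) * 1) *: Y (vac F) (-2 + m - j%:Z) (Y a j%:Z c)) =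
    (ind (j%:Z == -1 - m) + ind (j%:Z == m - 1)) *: - (m%:~R *: Y a (m - 1) c).
  have -> : (-1) ^+ j * ibinom K (-2) j = j.+1%:R.
    by rewrite (ibinomN2 K j) mulrA -exprMn mulrNN mulr1 expr1n mul1r.
  rewrite mulr1.
  rewrite (_ : (-1) ^ (-2) = 1 :> K); last by rewrite /exprz /= sqrrN expr1n invr1.
  rewrite scale1r !Y_vac.
  have -> : (m + j%:Z == -1) = (j%:Z == -1 - m) by lia.
  have -> : (-2 + m - j%:Z == -1) = (j%:Z == m - 1) by lia.
  have [j1|j1] := eqVneq j%:Z (-1 - m).
    have -> : (j%:Z == m - 1) = false by lia.
    rewrite subr0 addr0 scale1r -scaleNr (_ : -2 - j%:Z = m - 1); last by lia.
    by congr (_ *: _); rewrite -rmorphN pmulrn; congr (_%:~R); lia.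
  have [j2|j2] := eqVneq j%:Z (m - 1); last by rewrite Y0 subrr scaler0 addr0 scale0r.
  rewrite Y0 !add0r scale1r scalerN j2; congr (- (_ *: _)).
  by rewrite pmulrn; congr (_%:~R); lia.
under eq_bigr => j _ do rewrite E.
rewrite -scaler_suml big_split /= !sum_pick; [|lia|lia].
have [->|m0] := eqVneq m 0; first by rewrite mulr0z scale0r !oppr0 scaler0.
have -> : (0 <= -1 - m) = ~~ (0 <= m - 1) by lia.
by case: (0 <= m - 1); rewrite ?addr0 ?add0r scale1r.
Qed.

(** The field of a_(-1-b)|0> is the b-th derivative of a(z) divided by b!, obtained by iterating
    [Y_transl]. *)
Lemma Y_descendant p (a : F) (b : nat) m c : parity p a ->
  Y (Y a (-1 - b%:Z) (vac F)) m c = ((-1) ^+ b * ibinom K m b) *: Y a (m - b%:Z) c.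
Proof.
move=> pa; elim: b m => [|b IH] m.
  by rewrite !subr0 Y_create1 ibinomr0 mulr1 scale1r.
have nz : b.+1%:R != 0 :> K by rewrite pnatr_eq0.
have -> : Y a (-1 - b.+1%:Z) (vac F) =
    b.+1%:R^-1 *: transl (Y a (-1 - b%:Z) (vac F)).
  have := transl_cov a (-1 - b%:Z) (vac F); rewrite transl_vac Y0 subr0 => ->.
  rewrite -scaleNr scalerA (_ : -1 - b%:Z - 1 = -1 - b.+1%:Z); last by lia.
  have -> : - (-1 - b%:Z)%:~R = b.+1%:R :> K.
    by rewrite -rmorphN pmulrn; congr (_%:~R); lia.
  by rewrite mulVf // scale1r.
have pb : parity p (Y a (-1 - b%:Z) (vac F)).
  by have := Y_parity (-1 - b%:Z) pa (vac_even F); rewrite addbF.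
rewrite (linZ (Y_linearl _ _)) (Y_transl _ _ pb) IH.
rewrite (_ : m - 1 - b%:Z = m - b.+1%:Z); last by lia.
rewrite scalerN !scalerA -scaleNr; congr (_ *: _).
have -> : ibinom K m b.+1 = b.+1%:R^-1 * (m%:~R * ibinom K (m - 1) b).
  by rewrite -ibinomS mulKf.
by rewrite exprS; ring.
Qed.

End Translation.

(** * The fields W^n(z) on the Fock space *)

Section FockFields.
Variables (K : numFieldType) (F : vertexSuperalgebra K).
Variables (n : nat) (e : 'I_n -> F) (st : 'I_n -> 'I_n).
Hypothesis cl : clifford e st.
Local Notation psi i := (Y (e i)).
Local Notation rq := (rq e st).
Local Notation rhoF := (rhoF e st).

Lemma rhoF_W m k v : odd m -> rhoF (W m k) v = rq k (Wpoly K m k) v.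
Proof. by move=> om; rewrite W_E // rhoF_tmon mulr0 scale0r add0r. Qed.

Lemma rq_W_e m k j r v : odd m -> rq k (Wpoly K m k) (psi j r v) =
  psi j r (rq k (Wpoly K m k) v) + (Wpoly K m k).[r%:~R] *: psi j (r + k) v.
Proof. by move=> om; rewrite (rq_e cl) //; apply: antisym_Wpoly. Qed.

Lemma ffp_lt m (s : nat) : (s < m)%N -> (ffp K m).[s%:R] = 0.
Proof.
by move=> sm; rewrite ffpE (bigD1 (Ordinal sm)) //= subrr mul0r.
Qed.

Lemma ffp_diag m : (ffp K m).[m%:R] = m`!%:R.
Proof.
rewrite ffpE; elim: m => [|m IH]; first by rewrite big_ord0.
rewrite big_ord_recl /= subr0 factS natrM -IH; congr (_ * _).
by apply: eq_bigr => i _; rewrite -[bump 0 i]/(i.+1) -!natr1; ring.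
Qed.

(** Both falling factorials vanish at the interior points 0 < s < m; so only two modes s >= 0 of a
    fermion act nontrivially on W^m_(-m-1)|0>. *)
Lemma Wpoly_creation m (s : nat) : odd m -> (s <= m)%N ->
  (Wpoly K m (- m%:Z - 1)).[s%:R] =
  2%:R^-1 * m`!%:R * ((s == 0%N)%:R - (s == m)%:R).
Proof.
move=> om sm; rewrite WpolyE.
have -> : s%:R + (- m%:Z - 1)%:~R + m%:R = s%:R - 1 :> K.
  by rewrite rmorphB rmorphN /= -pmulrn; ring.
have m0 : (0 < m)%N by case: m om {sm}.
have -> : (ffp K m).[s%:R] = m`!%:R * (s == m)%:R.
  move: sm; rewrite leq_eqVlt => /orP[/eqP->|sm]; first by rewrite eqxx mulr1 ffp_diag.
  by rewrite ffp_lt // ltn_eqF // mulr0.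
have -> : (ffp K m).[s%:R - 1] = - m`!%:R * (s == 0%N)%:R.
  case: s sm => [_|s sm]; last by rewrite -natr1 addrK mulr0 ffp_lt.
  have := @ffp_refl K m m%:R; rewrite -signr_odd om mulN1r ffp_diag => <-.
  by rewrite mulr1; congr (_.[_]); ring.
ring.
Qed.

(* Skew-symmetry is avoided by computing [e_j (s) w] from [w = W |0>]. *)
Lemma W_field_e m k j r v : odd m ->
  Y (rhoF (W m (- m%:Z - 1)) (vac F)) (k + m%:Z) (psi j r v) =
  psi j r (Y (rhoF (W m (- m%:Z - 1)) (vac F)) (k + m%:Z) v)
  + (Wpoly K m k).[r%:~R] *: psi j (r + k) v.
Proof.
move=> om; set w := rhoF _ _; set k' := k + m%:Z.
have Dw := Dplus_W K (- m%:Z - 1) om.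
have pw : parity false w by apply: (rhoF_parity cl Dw); apply: vac_even.
have B : borcherds_identity (@Y _ F) (@Y _ F) 1 (e j) w v.
  by have := Y_borcherds v (cliff_odd cl j) pw.
have [N0 H] := commutator_formula r k' B.
have {H} := H _ (leq_addl m.+1 N0); rewrite scale1r.
have m0 : (0 < m)%N by case: m om {w k' Dw pw B}.
(* By [Wpoly_creation] only s = 0 and s = m contribute. The first gives the shifted and the second
   the unshifted falling factorial of [Wpoly]. *)
have E (s : 'I_(m.+1 + N0)) : ibinom K r s *: Y (Y (e j) s%:Z w) (r + k' - s%:Z) v =
   (2%:R^-1 * ((s == m :> nat)%:R * (ffp K m).[r%:~R]
      + (s == 0%N :> nat)%:R * (ffp K m).[r%:~R + k'%:~R])) *: psi j (r + k) v.
  have -> : Y (e j) s%:Z w =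
      - ((Wpoly K m (- m%:Z - 1)).[s%:R] *: Y (e j) (s%:Z - m%:Z - 1) (vac F)).
    have := rq_W_e (- m%:Z - 1) j s%:Z (vac F) om.
    rewrite (cliff_kill cl) // linear0 -rhoF_W // -/w addrA => /esym/eqP.
    by rewrite addr_eq0 => /eqP.
  have [sm|ms] := leqP s m; last first.
    rewrite (cliff_kill cl) ?scaler0 ?oppr0; last by lia.
    rewrite (lin0 (Y_linearl _ _)) scaler0 gtn_eqF // [_ == 0%N]gtn_eqF; last by lia.
    by rewrite !mul0r addr0 mulr0 scale0r.
  have -> : s%:Z - m%:Z - 1 = -1 - (m - s)%N%:Z by lia.
  rewrite (linN (Y_linearl _ _)) (linZ (Y_linearl _ _)).
  rewrite (Y_descendant _ _ _ (cliff_odd cl j)) Wpoly_creation //.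
  have -> : r + k' - s%:Z - (m - s)%N%:Z = r + k by rewrite /k'; lia.
  rewrite -scaleNr !scalerA; congr (_ *: _).
  have [s0|s0] := eqVneq (s : nat) 0%N.
    have -> : (s == m :> nat) = false by lia.
    rewrite s0 ibinomr0 subn0 subr0 -signr_odd om -rmorphD /= -(ibinom_ffp K (r + k')).
    have -> : r + k' - 0%N%:Z = r + k' by lia.
    ring.
  have [->|sm'] := eqVneq (s : nat) m; last by rewrite /=; ring.
  by rewrite subnn ibinomr0 -(ibinom_ffp K r) /=; ring.
under eq_bigr => s _ do rewrite E.
have -> : \sum_(s < m.+1 + N0) (2%:R^-1 * ((s == m :> nat)%:R * (ffp K m).[r%:~R]
      + (s == 0%N :> nat)%:R * (ffp K m).[r%:~R + k'%:~R])) *: psi j (r + k) v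
    = - ((Wpoly K m k).[r%:~R] *: psi j (r + k) v).
  rewrite -scaler_suml -scaleNr; congr (_ *: _).
  rewrite -mulr_sumr big_split /= -!mulr_suml WpolyE opprK.
  have -> : \sum_(s < m.+1 + N0) (s == m :> nat)%:R = 1 :> K.
    have mN : (m < m.+1 + N0)%N by lia.
    rewrite (bigD1 (Ordinal mN)) //= eqxx big1 ?addr0 // => s sm.
    by rewrite [_ == _ :> nat](negPf sm).
  have -> : \sum_(s < m.+1 + N0) (s == 0%N :> nat)%:R = 1 :> K.
    by rewrite addSn big_ord_recl /= big1 ?addr0.
  by rewrite /k' rmorphD /= -pmulrn !mul1r addrA.
move=> E'; apply: subr0_eq; rewrite -[RHS](subrr (Y w k' (psi j r v))).
have -> : Y w k' (psi j r v)
    - (psi j r (Y w k' v) + (Wpoly K m k).[r%:~R] *: psi j (r + k) v)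
  = - (psi j r (Y w k' v) - Y w k' (psi j r v))
    - (Wpoly K m k).[r%:~R] *: psi j (r + k) v.
  lincomb K.
by rewrite -E' opprK !subrr.
Qed.

Lemma transl_rhoF v : transl v = rhoF (W 1 (-1)) v.
Proof.
have W1 z : (Wpoly K 1 (-1)).[z] = - z.
  rewrite WpolyE !ffpE !big_ord1 rmorphN /=.
  have h2 : (2 : K) != 0 by rewrite pnatr_eq0.
  by field.
move: v; apply: (eq_on_vac cl) => [||i m v IH|].
- exact: transl_linear.
- exact: rhoF_linear.
- have := transl_cov (e i) m v; rewrite IH !rhoF_W // rq_W_e // W1 => /eqP.
  by rewrite subr_eq => /eqP->; rewrite scaleNr addrC.
rewrite transl_vac rhoF_W // (rq_vac_creation cl _ (_ : -1 = - 1%N%:Z)) //.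
by rewrite big_ord1 W1 oppr0 scale0r scaler0 oppr0.
Qed.

(* The vector is a variable here, lest unification compute the [W m k]. *)
Let W_field_eq m k v w : odd m -> w = rhoF (W m (- m%:Z - 1)) (vac F) ->
  Y w (k + m%:Z) v = rhoF (W m k) v.
Proof.
move=> om wE.
have We k' j r u : Y w (k' + m%:Z) (psi j r u) = psi j r (Y w (k' + m%:Z) u)
    + (Wpoly K m k').[r%:~R] *: psi j (r + k') u.
  by rewrite wE; apply: W_field_e.
pose Z k v := Y w (k + m%:Z) v - rhoF (W m k) v.
have Zc k' : exists c, forall u, Z k' u = c *: u.
  apply: (commutant_scalar cl).
    by apply: linear_sub; [apply: Y_linear|apply: rhoF_linear].
  move=> i r u; rewrite /Z We !(rhoF_W _ _ om) (rq_W_e _ _ _ _ om) YB; lincomb K.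
(* Each difference Z k' is a scalar by [Zc] and so commutes with [transl]; covariance of both fields
   then forces the next one to vanish unless k' + m = 0. *)
have ZT k' u : transl (Z k' u) - Z k' (transl u) = - (k' + m%:Z)%:~R *: Z (k' - 1) u.
  have TL := @transl_linear _ F.
  have E1 : transl (rhoF (W m k') u) - rhoF (W m k') (transl u) =
      - (k' + m%:Z)%:~R *: rhoF (W m (k' - 1)) u.
    have pW := Dplus_W K k' om; have p1 := Dplus_W K (-1) (isT : odd 1).
    rewrite !transl_rhoF -(rep_bracket (rhoF_rep cl) u p1 pW) (bracket_W1 K k' om).
    exact: (repZ (rhoF_rep cl) _ _ (Dplus_W K (k' - 1) om)).
  have E2 := transl_cov w (k' + m%:Z) u.
  rewrite /Z (linB TL) scalerBr -E1 scaleNr.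
  have -> : k' - 1 + m%:Z = k' + m%:Z - 1 by lia.
  rewrite -E2; move: (rhoF (W m k')) => f; lincomb K.
have Z0 k' : k' + m%:Z != 0 -> forall u, Z (k' - 1) u = 0.
  move=> k0 u; have [c cE] := Zc k'.
  have := ZT k' u; rewrite !cE (linZ (@transl_linear _ F)) subrr => /esym/eqP.
  by rewrite scaler_eq0 oppr_eq0 intr_eq0 (negPf k0) => /eqP.
suff : Z k v = 0 by move=> /eqP; rewrite subr_eq0 => /eqP.
(* The one mode that translation cannot reach is the product by -1, settled by the creation
   axiom. *)
have [k1|k1] := eqVneq (k + m%:Z) (-1); last first.
  by have := @Z0 (k + 1) _ v; rewrite addrK; apply; lia.
have [c cE] := Zc k; rewrite cE; have : Z k (vac F) = 0.
  by rewrite /Z k1 Y_create1 wE (_ : - m%:Z - 1 = k) ?subrr //; lia.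
rewrite cE => /eqP; rewrite scaler_eq0 (negPf (cliff_vac_neq0 cl)) orbF.
by move=> /eqP->; rewrite scale0r.
Qed.

Lemma W_field m k v : odd m ->
  Y (rhoF (W m (- m%:Z - 1)) (vac F)) (k + m%:Z) v = rhoF (W m k) v.
Proof. by move=> om; apply: W_field_eq. Qed.

End FockFields.

(** * The decomposition *)

Section Weights.
Variable K : numFieldType.

Definition sinh_den (m : nat) : K := 2%:R * fps_sinh 2%:R^-1 m.

(** The series 2 sinh(x/2) starts with x, so coefficient m of a factor is read off from coefficient
    m + 1 of the product. *)
Lemma fps_mul_inj (f g : nat -> K) :
  fps_mul f sinh_den =1 fps_mul g sinh_den -> f =1 g.
Proof.
have d0 : sinh_den 0 = 0 by rewrite /sinh_den /fps_sinh mulr0.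
have d1 : sinh_den 1 = 1.
  by rewrite /sinh_den /fps_sinh /= expr1 divr1 mulfV // pnatr_eq0.
move=> fg m; have [N] := ubnP m; elim: N m => [//|N IH] m mN.
have := fg m.+1; rewrite /fps_mul !big_ord_recr /= subnn d0 !mulr0 !addr0.
rewrite subSnn d1 !mulr1 (eq_bigr (fun i : 'I_m => g i * sinh_den (m.+1 - i))).
  by move=> /addrI.
by move=> i _; rewrite IH // (leq_trans (ltn_ord i)).
Qed.

Definition odd_series (s : nat -> K) (m : nat) : K := if odd m then s m else 0.

(** The identity 2 sinh(x/2)^2 = cosh x - 1, multiplied by c. *)
Lemma sinh_square (c : K) (m : nat) :
  fps_mul (odd_series (fun m => c * 2%:R^-1 ^+ m / m`!%:R)) sinh_den m =
  c * (fps_cosh 1 m - (m == 0%N)%:R).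
Proof.
have h2 : (2 : K) != 0 by rewrite pnatr_eq0.
have fz i : i`!%:R != 0 :> K by rewrite pnatr_eq0 -lt0n fact_gt0.
rewrite /fps_mul /fps_cosh; case: (boolP (odd m)) => [om|em].
  rewrite (_ : (m == 0%N) = false) ?subr0 ?mulr0; last by case: m om.
  apply: big1 => i _; rewrite /odd_series /sinh_den /fps_sinh oddB; last first.
    by rewrite -ltnS.
  by rewrite om; case: (odd i); rewrite ?mul0r ?mulr0.
(* The restriction to odd i is encoded by 1 - (-1)^i; the sum becomes (1+1)^m - (1-1)^m by the
   binomial theorem. *)
have E (i : 'I_m.+1) : odd_series (fun m => c * 2%:R^-1 ^+ m / m`!%:R) i
    * sinh_den (m - i) = c * 2%:R^-1 ^+ m / m`!%:R *
    ((1 ^+ (m - i) * 1 ^+ i) *+ 'C(m, i) - (1 ^+ (m - i) * (-1) ^+ i) *+ 'C(m, i)).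
  have im : (i <= m)%N by rewrite -ltnS.
  rewrite /odd_series /sinh_den /fps_sinh oddB // (negPf em) /=.
  rewrite -signr_odd !expr1n !mul1r; case: (odd i); last by rewrite mul0r subrr mulr0.
  have -> : 2%:R^-1 ^+ m = 2%:R^-1 ^+ i * 2%:R^-1 ^+ (m - i) :> K.
    by rewrite -exprD subnKC.
  rewrite -(bin_fact im) !natrM mulNrn opprK.
  rewrite -[1 *+ 'C(m, i)]/(('C(m, i))%:R) /= ?expr1.
  have bz : 'C(m, i)%:R != 0 :> K by rewrite pnatr_eq0 -lt0n bin_gt0.
  by field; rewrite bz !fz.
under eq_bigr => i _ do rewrite E.
rewrite -mulr_sumr sumrB -!exprDn subrr -mulr2n -[1 *+ 2]/(2%:R) expr1n expr0n.
case: eqP => [->|_]; first by rewrite expr0 fact0 !divr1 !subrr !mulr0.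
have E2 : 2%:R^-1 ^+ m * 2%:R ^+ m = 1 :> K by rewrite -exprMn mulVf // expr1n.
transitivity (c * (2%:R^-1 ^+ m * 2%:R ^+ m) / m`!%:R); first by rewrite /=; ring.
by rewrite E2 /=; ring.
Qed.

Lemma antisym_exp m : odd m -> @antisym K 0 (('X + (2%:R^-1)%:P) ^+ m).
Proof.
move=> om z; rewrite !horner_exp (antisym_H0 z) exprNn -signr_odd om.
by rewrite mulN1r.
Qed.

Lemma antisym0_ind (P : {poly K} -> Prop) :
  (forall a f g, antisym 0 f -> antisym 0 g -> P f -> P g -> P (a *: f + g)) ->
  P 0 -> (forall m, odd m -> P (('X + (2%:R^-1)%:P) ^+ m)) ->
  forall f, antisym 0 f -> P f.
Proof.
move=> PD P0 Pm f /antisymP[g og ->].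
have -> : g \Po ('X + ((0 + 1)%:~R / 2%:R)%:P) =
    \sum_(i < size g) g`_i *: ('X + (2%:R^-1)%:P) ^+ i.
  by rewrite comp_polyE add0r mul1r.
suff [] : antisym 0 (\sum_(i < size g) g`_i *: ('X + (2%:R^-1)%:P) ^+ i) /\
  P (\sum_(i < size g) g`_i *: ('X + (2%:R^-1)%:P) ^+ i) by [].
elim: (size g) => [|N [aN PN]].
  by rewrite big_ord0; split=> //; apply: antisym0.
rewrite big_ord_recr /= addrC; have [oN|/og->] := boolP (odd N); last first.
  by rewrite scale0r add0r.
split; first by apply: antisym_lin => //; apply: antisym_exp.
by apply: PD => //; [apply: antisym_exp|apply: Pm].
Qed.

End Weights.

(** * The vacuum and the determinant as highest weight vectors *)

Section HighestWeightPair.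
Variables (K : numFieldType) (F : vertexSuperalgebra K).
Variables (n : nat) (e : 'I_n -> F) (st : 'I_n -> 'I_n).
Hypothesis cl : clifford e st.
Local Notation rq := (rq e st).
Local Notation rhoF := (rhoF e st).
Variables (es : seq (K * K)) (c : K) (M : lmodType K) (rho : Dhat K -> M -> M).
Variables (v : M) (w : F) (s : nat -> K).
Hypothesis LM : is_L es c rho v.
Hypothesis cE : c = n%:R / 2%:R.
Hypothesis sE : fps_mul (odd_series s) (sinh_den K)
  =1 fun m => \sum_(p <- es) p.2 * (fps_cosh p.1 m - (m == 0%N)%:R).
Hypothesis w_pos : forall k f, antisym k f -> 0 < k -> rq k f w = 0.
Hypothesis w_zero : forall m, odd m ->
  rq 0 (('X + (2%:R^-1)%:P) ^+ m) w = - (s m * m`!%:R) *: w.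

(** The prescribed series determines the weight on the odd powers of D + 1/2, because 2 sinh(x/2)
    can be cancelled; these powers span degree 0 up to C, so both vectors have the same weight. *)
Lemma hw_pair : @hw_line K (M * F)%type (rho12 rho rhoF) (v, w).
Proof.
have [rep irr [xi [xiC xiE] hw]] := LM.
have rhoFt k f u : rhoF (tmon k f, 0) u = rq k f u.
  by rewrite rhoF_tmon mulr0 scale0r add0r.
split.
- move=> k f af k0; rewrite /rho12 /= rhoFt w_pos // (hwv_pos hw) //.
    exact: Dplus_tmon.
  by move=> i; rewrite /= tmonE; case: (i =P k) => [->|_]; rewrite ?eqxx.
- apply: antisym0_ind.
  + move=> a f g af ag [x Ex] [y Ey]; exists (a * x + y).
    have E : (tmon 0 (a *: f + g), 0) = a *: (tmon 0 f, 0) + (tmon 0 g, 0) :> Dhat K.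
      rewrite DhatZ dop_tmonZ -dop_tmonD mulr0; congr pair; by rewrite /= addr0.
    rewrite E (rep_linearl (rep12 rep (rhoF_rep cl))); try exact: Dplus_tmon.
    by rewrite Ex Ey scalerA scalerDl.
  + by exists 0; rewrite tmon0 scale0r (rep0 (rep12 rep (rhoF_rep cl))).
  move=> m om; exists (- (s m * m`!%:R)).
  have am := antisym_exp (K := K) om.
  rewrite /rho12 /= rhoFt w_zero // (hwv_weight hw); first last.
  + by move=> i; rewrite /= tmonE; case: (i =P 0) => [->|_]; rewrite ?eqxx.
  + exact: Dplus_tmon.
  congr (_ *: _, _); have := fps_mul_inj (fun m => etrans (xiE m) (esym (sE m))) m.
  rewrite /odd_series om => <-; rewrite mulfVK ?opprK //.
  by rewrite pnatr_eq0 -lt0n fact_gt0.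
exists c; rewrite /rho12 /= rhoF_Cc -cE (hwv_weight hw) ?xiC //.
  exact: Dplus_Cc.
by move=> i; rewrite /= mcoeff0 eqxx.
Qed.

End HighestWeightPair.

Section DetVector.
Variables (K : numFieldType) (F : vertexSuperalgebra K).
Variables (n : nat) (e : 'I_n -> F) (st : 'I_n -> 'I_n).
Hypothesis cl : clifford e st.
Local Notation rq := (rq e st).

Lemma rq_level0_pos k f (r : seq 'I_n) : antisym k f -> 0 < k ->
  rq k f (mono e [seq (i, 0%N) | i <- r]) = 0.
Proof.
move=> af k0; elim: r => [|i r IH] /=; first by rewrite rq_vac //; apply: ltW.
(* For k = 1 the mode -1 is sent to 0, which could contract, but -1 is the fixed point of the
   reflection and f(-1) = 0. For k > 1 the new mode is at least 1 and annihilates every level 0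
   monomial. *)
rewrite (rq_e cl) // IH Y0 add0r; have [k1|k1] := eqVneq k 1.
  have := @antisym_int _ k f (-1) (-1) af; rewrite k1 => /(_ erefl) /eqP.
  rewrite -addr_eq0 -mulr2n mulrn_eq0 /= => /eqP E.
  by rewrite subr0 E scale0r.
case: k {IH} k0 k1 af => // -[//|[//|k]] _ _ af.
rewrite (_ : -1 - 0%N%:Z + k.+2%:Z = k.+1%:Z); last by lia.
rewrite (annih_notin cl) ?scaler0 //.
by apply/mapP => -[j _].
Qed.

Lemma rq_level0_zero f (r : seq 'I_n) : antisym 0 f ->
  rq 0 f (mono e [seq (i, 0%N) | i <- r]) =
  ((size r)%:R * f.[-1]) *: mono e [seq (i, 0%N) | i <- r].
Proof.
move=> af; elim: r => [|i r IH] /=; first by rewrite (rq_vac cl) // mul0r scale0r.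
rewrite (rq_e cl) // IH YZ addr0 -scalerDl; congr (_ *: _).
by rewrite rmorphN /= -natr1; ring.
Qed.

Lemma parity_mono s : parity (odd (size s)) (mono e s).
Proof.
elim: s => [|x s IH]; first exact: vac_even.
by have := Y_parity (-1 - x.2%:Z) (cliff_odd cl x.1) IH.
Qed.

Lemma parity_detv : parity (odd n) (detv e).
Proof.
by have := parity_mono [seq (i, 0%N) | i <- enum 'I_n];
  rewrite size_map size_enum_ord.
Qed.

Lemma detv_neq0 : detv e != 0.
Proof.
apply: (mono_neq0 cl); rewrite map_inj_uniq ?enum_uniq // => i j [].
by [].
Qed.

Hypothesis n_odd : odd n.

(** The combination of vacuum and det found by [so_inv_singular] is even, whereas det is odd since n
    is; hence its det part vanishes. *)
Lemma even_submodule P : subspace P -> stable (rhoF e st) P ->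
  (forall v, P v -> so_inv e v /\ parity false v) -> (exists2 v, P v & v != 0) ->
  P (vac F).
Proof.
move=> sP rP Pv Pex.
have [|a [b [Pab ab0]]] := so_inv_singular cl sP rP _ Pex; first by move=> v /Pv[].
have [_ pab] := Pv _ Pab.
have bd : b *: detv e = 0.
  apply: parity_direct; last first.
    by apply: (subspaceZ (@parity_subspace _ F true)); have := parity_detv; rewrite n_odd.
  rewrite -[b *: _](addKr (a *: vac F)).
  apply: (subspaceD (@parity_subspace _ F false)) => //.
  apply: (subspaceN (@parity_subspace _ F false)).
  by apply: (subspaceZ (@parity_subspace _ F false)); apply: vac_even.
move: Pab ab0; rewrite bd addr0 scaler_eq0 negb_or => /(subspaceZ sP a^-1) + /andP[a0 _].
by rewrite scalerA mulVf // scale1r.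
Qed.

Lemma odd_submodule P : subspace P -> stable (rhoF e st) P ->
  (forall v, P v -> so_inv e v /\ parity true v) -> (exists2 v, P v & v != 0) ->
  P (detv e).
Proof.
move=> sP rP Pv Pex.
have [|a [b [Pab ab0]]] := so_inv_singular cl sP rP _ Pex; first by move=> v /Pv[].
have [_ pab] := Pv _ Pab.
have av : a *: vac F = 0.
  apply: parity_direct.
    by apply: (subspaceZ (@parity_subspace _ F false)); apply: vac_even.
  rewrite -[a *: _](addrK (b *: detv e)).
  apply: (subspaceB (@parity_subspace _ F true)) => //.
  by apply: (subspaceZ (@parity_subspace _ F true)); have := parity_detv; rewrite n_odd.
move: Pab ab0; rewrite av add0r scaler_eq0 negb_or => /(subspaceZ sP b^-1) + /andP[b0 _].
by rewrite scalerA mulVf // scale1r.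
Qed.

End DetVector.

(** * The two embeddings and the direct sum *)

Section Main.
Variables (K : numFieldType) (l : nat) (F : vertexSuperalgebra K).
Variables (psi : bool -> 'I_l -> F) (phi : F).
Hypothesis fock : fermionic_fock psi phi.
Variable act : 'M[K]_(l + l + 1) -> F -> F.
Hypothesis actSO : SO_action psi phi act.
Local Notation n := (l + l + 1)%N.
Local Notation e := (fermion psi phi).
Local Notation st := (@dual l).
Local Notation rhoF := (rhoF e st).
Let cl : clifford e st := fock_clifford fock.

Let n_odd : odd n. Proof. by rewrite addnn addn1 /= odd_double. Qed.

Let chargeE : l%:R + 2%:R^-1 = n%:R / 2%:R :> K.
Proof.
have h2 : (2 : K) != 0 by rewrite pnatr_eq0.
by rewrite !natrD; field.
Qed.

Lemma generated_invariant p w : WB act w -> parity p w ->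
  forall u, generated rhoF w u -> WB act u /\ parity p u.
Proof.
move=> Ww pw u gu; split.
  by apply: gu => //; [exact: WB_subspace actSO|exact: WB_stable fock actSO].
by apply: gu => //; [exact: parity_subspace|exact: (rhoF_parity cl)].
Qed.

Lemma generated_so_inv p w : WB act w -> parity p w ->
  forall u, generated rhoF w u -> so_inv e u /\ parity p u.
Proof.
move=> Ww pw u /(generated_invariant Ww pw)[Wu pu]; split=> //.
exact: WB_so_inv fock actSO _ Wu.
Qed.

Lemma vac_embedding (V : lmodType K) (rhoV : Dhat K -> V -> V) (v : V) :
  is_L [::] (l%:R + 2%:R^-1) rhoV v -> exists iota : V -> F,
  [/\ linear iota, injective iota, iota v = vac F,
      forall X u, Dplus X -> iota (rhoV X u) = rhoF X (iota u)
    & forall u, WB act (iota u) /\ parity false (iota u)].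
Proof.
move=> LV; have [rep irr [xi _ hw]] := LV.
have hw12 : @hw_line K (V * F)%type (rho12 rhoV rhoF) (v, vac F).
  apply: (hw_pair (s := fun=> 0) cl LV chargeE).
  - move=> m; rewrite big_nil; apply: big1 => i _.
    by rewrite /odd_series if_same mul0r.
  - by move=> k f _ k0; rewrite (rq_vac cl) // ltW.
  - by move=> m _; rewrite (rq_vac cl) // mul0r oppr0 scale0r.
have [iota [iL iI iv iX ig]] := hw_embedding rep (rhoF_rep cl) irr (hwv_neq0 hw)
  (cliff_vac_neq0 cl) hw12 (fun P sP rP gP => even_submodule cl n_odd sP rP
    (fun u Pu => generated_so_inv (WB_vac actSO) (vac_even F) (gP u Pu))).
exists iota; split=> // u; apply: generated_invariant (ig u).
  exact: WB_vac actSO.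
exact: vac_even.
Qed.

Lemma det_parity : parity true (detv e).
Proof. by have := parity_detv cl; rewrite n_odd. Qed.

Lemma det_embedding (L : lmodType K) (rhoL : Dhat K -> L -> L) (v : L) :
  is_L (e_det l) (l%:R + 2%:R^-1) rhoL v -> exists iota : L -> F,
  [/\ linear iota, injective iota, iota v = detv e,
      forall X u, Dplus X -> iota (rhoL X u) = rhoF X (iota u)
    & forall u, WB act (iota u) /\ parity true (iota u)].
Proof.
move=> LL; have [rep irr [xi _ hw]] := LL.
have Wdet : WB act (detv e) := WB_detv fock actSO.
have nE : (2 * l + 1)%:R = n%:R :> K by rewrite mul2n addnn.
have hw12 : @hw_line K (L * F)%type (rho12 rhoL rhoF) (v, detv e).
  (* The quotient n (cosh x - 1) / (2 sinh(x/2)) is n sinh(x/2). On the Fock side each of the n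
     modes -1 contributes (-1 + 1/2)^m. *)
  apply: (hw_pair (s := fun m => n%:R * 2%:R^-1 ^+ m / m`!%:R) cl LL chargeE).
  - by move=> m; rewrite sinh_square /e_det big_seq1 /= nE.
  - by move=> k f af k0; apply: (rq_level0_pos cl).
  move=> m om; have am : @antisym K 0 (('X + (2%:R^-1)%:P) ^+ m).
    by apply: antisym_exp.
  rewrite (rq_level0_zero cl) // size_enum_ord; congr (_ *: _).
  have -> : (('X + (2%:R^-1)%:P) ^+ m).[-1] = - 2%:R^-1 ^+ m :> K.
    rewrite horner_exp !hornerE.
    have -> : -1 + 2%:R^-1 = - 2%:R^-1 :> K.
      have h2 : (2 : K) != 0 by rewrite pnatr_eq0.
      by field.
    by rewrite exprNn -signr_odd om mulN1r.
  by rewrite divfK ?mulrN // pnatr_eq0 -lt0n fact_gt0.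
have [iota [iL iI iv iX ig]] := hw_embedding rep (rhoF_rep cl) irr (hwv_neq0 hw)
  (detv_neq0 cl) hw12 (fun P sP rP gP => odd_submodule cl n_odd sP rP
    (fun u Pu => generated_so_inv Wdet det_parity (gP u Pu))).
exists iota; split=> // u; exact: generated_invariant Wdet det_parity _ (ig u).
Qed.

Section Decomposition.
Variables (V : vertexAlgebra K) (rhoV : Dhat K -> V -> V).
Hypothesis VVc : is_Vc (l%:R + 2%:R^-1) rhoV.
Variable iota : V -> F.
Hypothesis iL : linear iota.
Hypothesis iI : injective iota.
Hypothesis iv : iota (vac V) = vac F.
Hypothesis iX : forall X u, Dplus X -> iota (rhoV X u) = rhoF X (iota u).
Hypothesis iW : forall u, WB act (iota u) /\ parity false (iota u).

Let repV : Dplus_rep rhoV. Proof. by case: (Vc_L VVc). Qed.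

Lemma iota_W m n' b : odd m ->
  iota (Y (rhoV (W m (- m%:Z - 1)) (vac V)) n' b) =
  Y (iota (rhoV (W m (- m%:Z - 1)) (vac V))) n' (iota b).
Proof.
move=> om; rewrite -[n'](subrK m%:Z) (Vc_fields VVc) // !iX ?iv; try exact: Dplus_W.
by rewrite (W_field cl).
Qed.

(** The vectors a with this property contain the vacuum and are closed under products by
    associativity in [V] and [F]. As they include the W^n generators, whose modes span Dplus
    together with C, they form a nonzero submodule. *)
Lemma iota_Y a k b : iota (Y a k b) = Y (iota a) k (iota b).
Proof.
pose S a := forall k b, iota (Y a k b) = Y (iota a) k (iota b).
suff : S a by apply.
have sS : subspace S.
  apply: subspace_forall => k'; apply: subspace_forall => b'.
  apply: subspace_eq => c x y; first by rewrite Y_linearl iL.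
  by rewrite iL Y_linearl.
have Svac : S (vac V).
  by move=> k' b'; rewrite iv !Y_vac; case: ifP => _ //; apply: (lin0 iL).
have SY a' m b' : S a' -> S b' -> S (Y a' m b').
  move=> Sa Sb k' c.
  have BV : borcherds_identity (@Y _ V) (@Y _ V) 1 a' b' c.
    exact: (Y_borcherds c (va_even a') (va_even b')).
  have BF : borcherds_identity (@Y _ F) (@Y _ F) 1 (iota a') (iota b') (iota c).
    exact: (Y_borcherds (iota c) (iW a').2 (iW b').2).
  have [N1 H1] := associativity_formula m k' BV.
  have [N2 H2] := associativity_formula m k' BF.
  rewrite (H1 (maxn N1 N2)) ?leq_maxl // Sa (H2 (maxn N1 N2)) ?leq_maxr //.
  rewrite (lin_sum iL); apply: eq_bigr => j _.
  by rewrite (linZ iL) (linB iL) (linZ iL) !(Sa, Sb).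
have rS : stable rhoV S.
  apply: (rep_W_stable repV sS) => [a' Sa k' b'|m k' a' om Sa].
    have -> : rhoV Cc a' = (n%:R / 2%:R) *: a'.
      by apply: iI; rewrite iX ?rhoF_Cc ?(linZ iL) //; apply: Dplus_Cc.
    by rewrite !(linZ iL, linZ (Y_linearl _ _)) Sa.
  rewrite -(Vc_fields VVc) //; apply: SY => // n' b'; exact: iota_W.
have [_ irr] := L_irreducible (Vc_L VVc).
have [|S0|] := irr S sS; last by apply.
  by move=> [X pX] v; apply: rS.
by have := cliff_vac_neq0 cl; rewrite -iv (S0 _ Svac) (lin0 iL) eqxx.
Qed.

Lemma iota_morphism : vsa_morphism iota.
Proof.
split=> // [p a pa|a|a k b]; last exact: iota_Y.
  case: p pa => pa; last by case: (iW a).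
  have -> : a = 0 by apply: parity_direct => //; apply: va_even.
  rewrite (lin0 iL); exact: subspace0 (@parity_subspace _ F true).
by rewrite (Vc_transl VVc) iX ?(transl_rhoF cl) //; apply: Dplus_W.
Qed.

Variables (L : lmodType K) (rhoL : Dhat K -> L -> L) (vL : L).
Hypothesis LL : is_L (e_det l) (l%:R + 2%:R^-1) rhoL vL.
Variable j : L -> F.
Hypothesis jL : linear j.
Hypothesis jI : injective j.
Hypothesis jv : j vL = detv e.
Hypothesis jX : forall X u, Dplus X -> j (rhoL X u) = rhoF X (j u).
Hypothesis jW : forall u, WB act (j u) /\ parity true (j u).

Lemma WB_decomposition v : WB act v -> exists a x, v = iota a + j x.
Proof.
move=> Wv; pose P v := exists a x, v = iota a + j x.
apply: (@so_inv_generated _ _ _ _ _ cl P).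
- split; first by exists 0, 0; rewrite (lin0 iL) (lin0 jL) addr0.
  move=> c _ _ [a [x ->]] [b [y ->]]; exists (c *: a + b), (c *: x + y).
  by rewrite iL jL scalerDr addrACA.
- move=> X _ pX [a [x ->]]; exists (rhoV X a), (rhoL X x).
  by rewrite iX // jX // (linD (rhoF_linear _ _ _)).
- by exists (vac V), 0; rewrite iv (lin0 jL) addr0.
- by exists 0, vL; rewrite jv (lin0 iL) add0r.
exact: WB_so_inv fock actSO _ Wv.
Qed.

Lemma even_odd_eq0 a x : iota a + j x = 0 -> iota a = 0 /\ j x = 0.
Proof.
move=> E; have ax : iota a = - j x by apply/eqP; rewrite -addr_eq0 E.
have a0 : iota a = 0.
  apply: parity_direct; first by case: (iW a).
  by rewrite ax; apply: (subspaceN (@parity_subspace _ F true)); case: (jW x).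
by split=> //; move: E; rewrite a0 add0r.
Qed.

Lemma odd_image v : WB act v -> parity true v -> exists x, j x = v.
Proof.
move=> /WB_decomposition[a [x vE]] pv; exists x.
suff a0 : iota a = 0 by rewrite vE a0 add0r.
apply: parity_direct; first by case: (iW a).
have -> : iota a = v - j x by rewrite vE addrK.
by apply: (subspaceB (@parity_subspace _ F true)) => //; case: (jW x).
Qed.

(** Fields of even invariants preserve the odd invariants, which are the image of [j], so they can
    be pulled back along [j]; the module axioms follow by injectivity. *)
Lemma det_module : exists YL : V -> int -> L -> L,
  [/\ va_module YL, W_compatible rhoV rhoL YL, va_irreducible YL
    & forall a k x, j (YL a k x) = Y (iota a) k (j x)].
Proof.
have ex a k x : exists y, j y = Y (iota a) k (j x).
  apply: odd_image.
    exact: (vsub_Y (WB_vertex_subalgebra actSO)) (iW a).1 (jW x).1.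
  exact: Y_parity (iW a).2 (jW x).2.
pose YL a k x := sval (cid (ex a k x)).
have YLE a k x : j (YL a k x) = Y (iota a) k (j x) by apply: svalP (cid (ex a k x)).
have YLW : W_compatible rhoV rhoL YL.
  move=> m k v om; apply: jI; rewrite YLE jX; last exact: Dplus_W.
  by rewrite iX ?iv ?(W_field cl) //; apply: Dplus_W.
exists YL; split=> //.
- split.
  + split=> [a k c x y|k x c a b|a x].
    * by apply: jI; rewrite jL !YLE jL Y_linear.
    * by apply: jI; rewrite jL !YLE iL Y_linearl.
    have [_ _ /(_ (iota a) (j x))[N HN]] := @Y_field _ F.
    by exists N => k Nk; apply: jI; rewrite YLE HN // (lin0 jL).
  + move=> k v; apply: jI; rewrite YLE iv Y_vac; case: ifP => // _.
    by rewrite (lin0 jL).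
  move=> a b x m n' k.
  have [N0 H] := Y_borcherds (j x) (iW a).2 (iW b).2 m n' k.
  exists N0 => N /H E; apply: jI; rewrite !(lin_sum jL).
  transitivity (\sum_(t < N) ibinom K m t *:
      Y (Y (iota a) (n' + t%:Z) (iota b)) (m + k - t%:Z) (j x)).
    by apply: eq_bigr => t _; rewrite (linZ jL) YLE iota_Y.
  rewrite E; apply: eq_bigr => t _.
  by rewrite (linZ jL) (linB jL) (linZ jL) !YLE.
(* The operators W^n_k are modes of [YL] and C acts by a scalar, so a subspace stable under [YL] is
   a Dplus-submodule. *)
have [[v v0] irr] := L_irreducible LL.
split; first by exists v.
move=> P sP PY; apply: irr => // -[X pX] /= u Pu.
apply: (rep_W_stable (L_rep LL) sP _ _ pX Pu) => [w Pw|m k w om Pw].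
  have -> : rhoL Cc w = (n%:R / 2%:R) *: w.
    by apply: jI; rewrite jX ?rhoF_Cc ?(linZ jL) //; apply: Dplus_Cc.
  exact: (subspaceZ sP).
by rewrite -YLW //; apply: (PY (_, _)).
Qed.

End Decomposition.

Lemma WB_odd_orthogonal_decomposition
    (V : vertexAlgebra K) (rhoV : Dhat K -> V -> V)
    (VVc : is_Vc (l%:R + 2%:R^-1) rhoV)
    (L : lmodType K) (rhoL : Dhat K -> L -> L) (vL : L)
    (LL : is_L (e_det l) (l%:R + 2%:R^-1) rhoL vL) :
  exists (iota : V -> F) (YL : V -> int -> L -> L) (Phi : V * L -> F),
    [/\ vsa_morphism iota, injective iota & forall a, WB act (iota a)] /\
    [/\ va_module YL, W_compatible rhoV rhoL YL & va_irreducible YL] /\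
    [/\ linear Phi,
        injective Phi,
        forall v, WB act v <-> exists x, v = Phi x,
        forall a n x, Phi (dsum_Y (@Y _ V) YL a n x) = Y (iota a) n (Phi x)
      & forall a, Phi (a, 0) = iota a].
Proof.
have [iota [iL iI iv iX iW]] := vac_embedding (Vc_L VVc).
have [j [jL jI jv jX jW]] := det_embedding LL.
have [YL [YLmod YLW YLirr YLE]] :=
  det_module VVc iL iI iv iX iW LL jL jI jv jX jW.
exists iota, YL, (fun x => iota x.1 + j x.2).
split; first by split=> // [|a]; [exact: (iota_morphism VVc iL iI iv iX iW)|case: (iW a)].
split; first by split.
split.
- move=> c [a x] [b y] /=; rewrite iL jL scalerDr addrACA; reflexivity.
- move=> [a x] [b y] /= E.
  have [|/eqP a0 /eqP x0] := @even_odd_eq0 V iota iW L j jW (a - b) (x - y).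
    by rewrite (linB iL) (linB jL) addrACA -opprD E subrr.
  move: a0 x0; rewrite (linB iL) (linB jL) !subr_eq0.
  by move=> /eqP/iI-> /eqP/jI->.
- move=> v; split.
    move=> /(WB_decomposition iL iv iX jL jv jX)[a [x ->]].
    by exists (a, x).
  move=> [[a x] ->]; apply: (subspaceD (WB_subspace actSO)).
    by case: (iW a).
  by case: (jW x).
- move=> a k [b y] /=; rewrite YLE YD; congr (_ + _).
  exact: (iota_Y VVc iL iI iv iX iW).
by move=> a; rewrite /= (lin0 jL) addr0.
Qed.

End Main.

Theorem theorem14p4 (R : realType) (l : nat) (l_ge1 : (1 <= l)%N)
    (F : vertexSuperalgebra R[i]) (psi : bool -> 'I_l -> F) (phi : F)
    (F_fock : fermionic_fock psi phi)
    (act : 'M[R[i]]_(l + l + 1) -> F -> F) (act_SO : SO_action psi phi act)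
    (V : vertexAlgebra R[i]) (rhoV : Dhat R[i] -> V -> V)
    (V_Vc : is_Vc (l%:R + 2%:R^-1) rhoV)
    (L : lmodType R[i]) (rhoL : Dhat R[i] -> L -> L) (vL : L)
    (L_det : is_L (e_det l) (l%:R + 2%:R^-1) rhoL vL) :
  exists (iota : V -> F) (YL : V -> int -> L -> L) (Phi : V * L -> F),
    [/\ vsa_morphism iota, injective iota & forall a, WB act (iota a)] /\
    [/\ va_module YL, W_compatible rhoV rhoL YL & va_irreducible YL] /\
    [/\ linear Phi,
        injective Phi,
        forall v, WB act v <-> exists x, v = Phi x,
        forall a n x, Phi (dsum_Y (@Y _ V) YL a n x) = Y (iota a) n (Phi x)
      & forall a, Phi (a, 0) = iota a].
Proof.
exact: (WB_odd_orthogonal_decomposition F_fock act_SO V_Vc L_det).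
Qed.
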